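(* For every $X\in\mathcal H_{\rm sp}$ and every $M\in\mathbb R^P$, $$\langle A_MX,X\rangle=-\frac12\int_{\mathbb R^3}\big|\mathbf B^{\rm vect}(x,X)\big|^2\,dx,$$ where the norm in the integrand is that of $\mathcal H_{\rm sp}^3$.
   Context: Fix an integer $P\ge1$ and points $x^{[1]},\dots,x^{[P]}\in\mathbb R^3$. Let $\phi\in\mathcal S(\mathbb R)$ and for $k\in\mathbb R^3$ write $\phi(|k|)$. Let $\mathfrak H=\{V\in L^2(\mathbb R^3,\mathbb C^3):\ k\cdot V(k)=0\text{ a.e.}\}$, $\mathcal H_{\rm ph}$ the symmetric Fock space over $\mathfrak H$ with vacuum $\Psi_0$, Segal fields $\Phi_S(V)=\frac1{\sqrt2}(a^*(V)+a(V))$, and $H_{\rm ph}=d\Gamma(M_\omega)$ with $M_\omega$ multiplication by $|k|$. Let $\mathcal H_{\rm sp}=(\mathbb C^2)^{\otimes P}$, $\mathcal H_{\rm tot}=\mathcal H_{\rm ph}\otimes\mathcal H_{\rm sp}$, $\sigma_1,\sigma_2,\sigma_3$ the Pauli matrices, and $\sigma_m^{[\lambda]}$ the operator acting as $\sigma_m$ on the $\lambda$-th tensor factor and as identity elsewhere. For $m\in\{1,2,3\}$, $x\in\mathbb R^3$, $B_{m,x}(k)=\frac{i\phi(|k|)|k|^{1/2}}{(2\pi)^{3/2}}e^{-ik\cdot x}\frac{k\times e_m}{|k|}$ ($e_m$ canonical basis). For $M=(M^{[1]},\dots,M^{[P]})\in\mathbb R^P$, $H_{\rm int}(M)=\sum_{\lambda=1}^P\sum_{m=1}^3M^{[\lambda]}\Phi_S(B_{m,x^{[\lambda]}})\otimes\sigma_m^{[\lambda]}$.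 Let $EX=\Psi_0\otimes X$ and define the operator $A_M$ on $\mathcal H_{\rm sp}$ by $A_MX=-E^*H_{\rm int}(M)(H_{\rm ph}^{-1}\otimes I)H_{\rm int}(M)EX$, where $H_{\rm int}(M)EX$ lies in the one-photon sector, on which $H_{\rm ph}^{-1}$ is multiplication by $1/|k|$. Let $\rho(x)=(2\pi)^{-3}\int_{\mathbb R^3}\phi(|k|)e^{ik\cdot x}dk$. For $a\in\mathbb R^3$ and $Y=(Y_1,Y_2,Y_3)\in\mathcal H_{\rm sp}^3$, $a\times Y\in\mathcal H_{\rm sp}^3$ is defined by the usual cross product formula, and $\sigma^{[\lambda]}X=(\sigma_1^{[\lambda]}X,\sigma_2^{[\lambda]}X,\sigma_3^{[\lambda]}X)$. Define $\mathbf j^{\rm vect}(x,X)=\sum_{\lambda=1}^PM^{[\lambda]}\nabla\rho(x-x^{[\lambda]})\times\sigma^{[\lambda]}X\in\mathcal H_{\rm sp}^3$, and let $x\mapsto\mathbf B^{\rm vect}(x,X)$ be the square-integrable $\mathcal H_{\rm sp}^3$-valued field solving $\nabla\cdot\mathbf B^{\rm vect}=0$, $\nabla\times\mathbf B^{\rm vect}=\mathbf j^{\rm vect}(\cdot,X)$. *)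

(* Defs.v *)
From HB Require Import structures.
From mathcomp Require Import all_boot all_order all_algebra.
From mathcomp Require Import all_classical all_reals all_analysis.
From mathcomp Require Import complex.

Set Implicit Arguments.
Unset Strict Implicit.
Unset Printing Implicit Defensive.
Import Order.TTheory GRing.Theory Num.Theory.
Import numFieldNormedType.Exports.
Local Open Scope classical_set_scope.
Local Open Scope ring_scope.
Local Open Scope complex_scope.

Section Defs.
Variable R : realType.
Local Notation C := R[i].

Definition pt3 := 'rV[R]_3.
Definition ev3 (i : 'I_3) : pt3 := delta_mx 0 i.
Definition dot3 (a b : pt3) : R := \sum_(i < 3) a 0 i * b 0 i.
Definition enorm (k : pt3) : R := Num.sqrt (dot3 k k).
(* cross product of two vectors given by components, 'I_3 has Z/3 arithmetic *)
Definition cross3 (T : pzRingType) (a b : 'I_3 -> T) : 'I_3 -> T :=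
  fun i => a (i + 1)%R * b (i + 1 + 1)%R - a (i + 1 + 1)%R * b (i + 1)%R.
Definition vec3 (p : R * R * R) : pt3 :=
  \row_(i < 3) nth 0 [:: p.1.1; p.1.2; p.2] i.

Definition leb3 := ((@lebesgue_measure R \x @lebesgue_measure R)
                      \x @lebesgue_measure R)%E.
Definition RInt3 (g : pt3 -> R) : R := Rintegral leb3 setT (g \o vec3).
Definition CInt3 (g : pt3 -> C) : C :=
  (RInt3 (fun x => complex.Re (g x))) +i* (RInt3 (fun x => complex.Im (g x))).
Definition iC : C := 0 +i* 1.
Definition sqmod (z : C) : R := complex.Re z ^+ 2 + complex.Im z ^+ 2.
Definition cexpi (t : R) : C := (cos t) +i* (sin t).

Definition cpartial (i : 'I_3) (g : pt3 -> C) (x : pt3) : C :=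
  ('D_(ev3 i) (fun y => complex.Re (g y)) x) +i* ('D_(ev3 i) (fun y => complex.Im (g y)) x).

Definition schwartzR (f : R -> R) : Prop :=
  (forall (n : nat) (x : R), derivable (f^`(n))%classic x 1) /\
  (forall a b : nat, exists c : R, forall x : R, `| x ^+ a * (f^`(b))%classic x | <= c).
Definition schwartzC (f : R -> C) : Prop :=
  schwartzR (fun x => complex.Re (f x)) /\ schwartzR (fun x => complex.Im (f x)).

(* ---------- spin space H_sp = (C^2)^{\otimes P} ---------- *)
Definition spin (P : nat) := {ffun 'I_P -> 'I_2}.   (* basis of (C^2)^{\otimes P} *)
Definition Hsp (P : nat) := spin P -> C.
Definition ipsp P (X Y : Hsp P) : C := \sum_(s : spin P) X s * (Y s)^*.

(* Pauli matrices sigma_1, sigma_2, sigma_3 (indexed 0,1,2); basis 0 = e_1, 1 = e_2 *)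
Definition pauli (m : 'I_3) (a b : 'I_2) : C :=
  if val m == 0%N then (if a != b then 1 else 0)
  else if val m == 1%N then
    (if (val a == 0%N) && (val b == 1%N) then - iC
     else if (val a == 1%N) && (val b == 0%N) then iC else 0)
  else (if a == b then (if val a == 0%N then 1 else -1) else 0).

(* sigma_m^{[lam]} : sigma_m on the lam-th tensor factor, identity elsewhere *)
Definition sigma_on P (lam : 'I_P) (m : 'I_3) (X : Hsp P) : Hsp P :=
  fun s => \sum_(t : spin P | [forall mu : 'I_P, (mu != lam) ==> (t mu == s mu)])
             pauli m (s lam) (t lam) * X t.

Definition Bmx (phi : R -> C) (m : 'I_3) (x : pt3) (k : pt3) : 'I_3 -> C :=
  fun j => iC * phi (enorm k) * (Num.sqrt (enorm k))%:C
           / (Num.sqrt ((2 * pi) ^+ 3))%:C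
           * cexpi (- dot3 k x)
           * (cross3 (fun l => k 0 l) (fun l => ev3 m 0 l) j / enorm k)%:C.

(* one-photon sector tensor spin space: k |-> (polarisation j |-> H_sp) *)
Definition onephot P := pt3 -> 'I_3 -> Hsp P.

(* H_int(M) E X  (lies in the one-photon sector; Phi_S(V) Psi_0 = V / sqrt 2) *)
Definition HintE P (phi : R -> C) (xs : 'I_P -> pt3) (M : 'I_P -> R) (X : Hsp P)
  : onephot P :=
  fun k j s => \sum_(lam < P) \sum_(m < 3)
     (M lam)%:C * Bmx phi m (xs lam) k j * sigma_on lam m X s
     / (Num.sqrt 2)%:C.

(* H_ph^{-1} (x) I on the one-photon sector: multiplication by 1/|k| *)
Definition Hphinv P (f : onephot P) : onephot P :=
  fun k j s => f k j s / (enorm k)%:C.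

(* E^* H_int(M) on the one-photon sector: only the vacuum component of
   Phi_S(V) f = (a^*(V) f + a(V) f)/sqrt 2 survives, namely <V, f> Psi_0 / sqrt 2,
   with <V, f> = int conj(V(k)) . f(k) dk *)
Definition EstarHint P (phi : R -> C) (xs : 'I_P -> pt3) (M : 'I_P -> R)
  (f : onephot P) : Hsp P :=
  fun s => \sum_(lam < P) \sum_(m < 3)
     (M lam)%:C / (Num.sqrt 2)%:C *
     sigma_on lam m
       (fun s' => \sum_(j < 3) CInt3 (fun k => (Bmx phi m (xs lam) k j)^* * f k j s'))
       s.

Definition A_M P phi xs M (X : Hsp P) : Hsp P :=
  fun s => - EstarHint phi xs M (Hphinv (HintE phi xs M X)) s.

Definition rho (phi : R -> C) (x : pt3) : C :=
  ((2 * pi) ^+ 3)^-1%:C * CInt3 (fun k => phi (enorm k) * cexpi (dot3 k x)).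

Definition gradrho (phi : R -> C) (x : pt3) : 'I_3 -> C :=
  fun i => cpartial i (rho phi) x.

Definition jvect P phi (xs : 'I_P -> pt3) (M : 'I_P -> R) (X : Hsp P)
  (x : pt3) : 'I_3 -> Hsp P :=
  fun i s => \sum_(lam < P) (M lam)%:C *
      cross3 (gradrho phi (x - xs lam)) (fun l => sigma_on lam l X s) i.

Definition divB P (B : pt3 -> 'I_3 -> Hsp P) (x : pt3) : Hsp P :=
  fun s => \sum_(i < 3) cpartial i (fun y => B y i s) x.
Definition curlB P (B : pt3 -> 'I_3 -> Hsp P) (x : pt3) : 'I_3 -> Hsp P :=
  fun i s => cpartial (i + 1)%R (fun y => B y (i + 1 + 1)%R s) x
           - cpartial (i + 1 + 1)%R (fun y => B y (i + 1)%R s) x.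

Definition sqnorm3 P (Y : 'I_3 -> Hsp P) : R :=
  \sum_(i < 3) \sum_(s : spin P) sqmod (Y i s).

Definition is_Bvect P phi xs M (X : Hsp P) (B : pt3 -> 'I_3 -> Hsp P) : Prop :=
  [/\ forall i s x, differentiable (fun y => complex.Re (B y i s)) x /\
                    differentiable (fun y => complex.Im (B y i s)) x,
      leb3.-integrable setT (fun p => (sqnorm3 (B (vec3 p)))%:E),
      forall x, divB B x = (fun _ => 0) &
      forall x, curlB B x = jvect phi xs M X x].

End Defs.

(* Main.v *)
(** Both sides are integrals over Fourier space of [|k x S(k)|^2], where [S] collects the
    phases [exp (- i k.x_lam)] and the spins, once [B] is known to be the Fourier integral
    of [G = i k x J / |k|^2], [J] being the amplitude of the current.

    To obtain this representation at a point [x], average [B] against the Gaussian of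
    width [1/s] around [x] and differentiate in [s]: this produces the Laplacian of the
    Gaussian, and integration by parts with [div B = 0] moves it to [curl curl B], so the
    derivative is that of the same average of the Fourier integral of [G]. The two averages
    hence differ by a constant, which is [0] because both tend to [0] as [s -> 0] (for [B],
    by square integrability); let [s -> oo].

    [B] is only differentiable, so the integration by parts uses a divergence theorem
    obtained by Goursat's bisection argument, with tent functions in place of cubes. The
    Plancherel identity is proved with a Gaussian window, whose transform is an approximate
    identity, and [|k x V| = |k| |V|] for [V] orthogonal to [k] compares the integrands. *)

Require Import Defs.
From HB Require Import structures.
From mathcomp Require Import all_boot all_order all_algebra.
From mathcomp Require Import all_classical all_reals all_analysis.
From mathcomp Require Import complex.
From mathcomp Require Import measurable_realfun ring lra.

Set Implicit Arguments.
Unset Strict Implicit.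
Unset Printing Implicit Defensive.
Import Order.TTheory GRing.Theory Num.Theory.
Import numFieldNormedType.Exports.
Local Open Scope classical_set_scope.
Local Open Scope ring_scope.

(** * Integration over R^3 *)

(** The obstacle is the low regularity of [B]: differentiable at every point and square integrable,
    but with partial derivatives that may be neither continuous nor integrable. So [curl curl B] is
    never formed. Second derivatives fall on the Gaussian, and the divergence theorem is applied to
    a field whose divergence involves only [B], [div B] and [curl B]; it is continuous because
    [curl B] is a Fourier integral.

    The factor [k / |k|] makes [G] bounded and rapidly decaying, but possibly discontinuous at the
    origin. No almost-everywhere argument is made: since division by zero gives zero, the amplitude
    vanishes at the origin, and limits under the integral hold at every point.

    Constants: each photon amplitude carries [|k|^(1/2)], so the pairing carries [|k|], which the
    inverse of [H_ph] removes. The two factors [1 / sqrt 2] of the Segal fields give the [1/2]. Of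
    the two powers of [(2 pi)^-3] in [|G|^2], Plancherel's identity cancels one, and the other is
    the squared normalisation of [Bmx]. *)

Section SigmaFinite.
Local Open Scope ereal_scope.

Lemma sigma_finite_prod d1 d2 (R : realType) (T1 : measurableType d1)
  (T2 : measurableType d2)
  (m1 : {measure set T1 -> \bar R}) (m2 : {sigma_finite_measure set T2 -> \bar R}) :
  sigma_finite setT m1 -> sigma_finite setT (m1 \x m2).
Proof.
move=> /sigma_finiteP[F [TF ndF Foo]].
have /sigma_finiteP[G [TG ndG Goo]] := sigma_finiteT m2.
exists (fun n => F n `*` G n) => [|n].
  apply/esym; rewrite -subTset => -[x y] _.
  have [i _ Fx] : (\bigcup_i F i) x by rewrite -TF.
  have [j _ Gy] : (\bigcup_i G i) y by rewrite -TG.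
  exists (maxn i j) => //; split => /=.
    by move: x Fx; exact/subsetPset/ndF/leq_maxl.
  by move: y Gy; exact/subsetPset/ndG/leq_maxr.
have [mF Fn] := Foo n; have [mG Gn] := Goo n.
split; first exact: measurableX.
by rewrite product_measure1E// lte_mul_pinfty// ge0_fin_numE.
Qed.

(** [sigma_finite_prod] takes sigma-finiteness of the first factor as a hypothesis, not as a
    structure, so it iterates over the nested product. The instances below then make Fubini's
    theorem available for [leb3]. *)
Lemma leb3_sigma_finite (R : realType) : sigma_finite setT (@leb3 R).
Proof. by do 2 apply: sigma_finite_prod; exact: sigma_finiteT. Qed.

End SigmaFinite.

HB.instance Definition _ (R : realType) := Measure.on (@leb3 R).
HB.instance Definition _ (R : realType) :=
  @Measure_isSigmaFinite.Build _ _ _ (@leb3 R) (@leb3_sigma_finite R).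

(** The indices are spelled [0], [1], [1 + 1], the form to which the cyclic indices [i + 1] and
    [i + 1 + 1] of [cross3] are reduced. *)
Lemma sum3E (V : nmodType) (F : 'I_3 -> V) :
  \sum_(i < 3) F i = F 0 + F 1 + F (1 + 1).
Proof.
by rewrite !big_ord_recl big_ord0 addr0 addrA; congr (_ + F _ + F _); apply: val_inj.
Qed.

Lemma I3P (P : 'I_3 -> Prop) : P 0 -> P 1 -> P (1 + 1) -> forall i, P i.
Proof.
move=> P0 P1 P2 i.
have : [\/ i = 0, i = 1 | i = 1 + 1].
  by case: i => -[|[|[|m]]] //= ?; [apply: Or31|apply: Or32|apply: Or33];
     apply: val_inj.
by case=> ->.
Qed.

Lemma I3_neq : (((0 : 'I_3) == 1) = false) * (((1 : 'I_3) == 0) = false) *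
  (((0 : 'I_3) == 1 + 1) = false) * (((1 + 1 : 'I_3) == 0) = false) *
  (((1 : 'I_3) == 1 + 1) = false) * (((1 + 1 : 'I_3) == 1) = false).
Proof. by []. Qed.

Section Integral3.
Variable R : realType.
Local Notation V3 := (pt3 R).
Local Notation T3 := (measurableTypeR R * measurableTypeR R * measurableTypeR R)%type.
Implicit Types (f g h : V3 -> R).

(** The measure lives on nested pairs, differential calculus on row vectors. Functions are kept on
    row vectors and pulled back along [vec3] to speak of integrability and measurability. *)
Definition L1 f := (@leb3 R).-integrable setT (EFin \o (f \o @vec3 R)).
Definition meas f := measurable_fun (setT : set T3) (f \o @vec3 R).
Definition unvec3 (x : V3) : R * R * R := (x 0 0, x 0 1, x 0 (1 + 1)).

Lemma unvec3K : cancel unvec3 (@vec3 R).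
Proof. by move=> x; apply/rowP; apply: I3P; rewrite mxE. Qed.

Lemma dot3_ge0 (x : V3) : 0 <= dot3 x x.
Proof. by apply: sumr_ge0 => i _; rewrite -expr2 sqr_ge0. Qed.

Lemma dot3_eq0 (x : V3) : (dot3 x x == 0) = (x == 0).
Proof.
apply/eqP/eqP => [xx0|->]; last by rewrite /dot3 big1// => i _; rewrite mxE mul0r.
apply/rowP => j; rewrite mxE; apply/eqP; rewrite -sqrf_eq0 expr2.
by have /psumr_eq0P/(_ j isT) -> // := xx0 => l _; rewrite -expr2 sqr_ge0.
Qed.

Lemma L1_meas f : L1 f -> meas f.
Proof. by case/integrableP => /measurable_EFinP. Qed.

Lemma L1D f g : L1 f -> L1 g -> L1 (fun x => f x + g x).
Proof. by move=> lf lg; apply: eq_integrable (integrableD _ lf lg). Qed.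

Lemma L1Z c f : L1 f -> L1 (fun x => c * f x).
Proof. by move=> lf; apply: eq_integrable (integrableZl measurableT c lf). Qed.

Lemma L1N f : L1 f -> L1 (fun x => - f x).
Proof. by move=> lf; apply: eq_integrable (integrableN lf). Qed.

Lemma L1B f g : L1 f -> L1 g -> L1 (fun x => f x - g x).
Proof. by move=> lf lg; apply: L1D => //; exact: L1N. Qed.

Lemma L1_0 : L1 (fun=> 0).
Proof. exact: integrable0. Qed.

Lemma L1_sum (I : Type) (s : seq I) (P : pred I) (F : I -> V3 -> R) :
  (forall i, P i -> L1 (F i)) -> L1 (fun x => \sum_(i <- s | P i) F i x).
Proof.
move=> LF; elim: s => [|i s IH].
  by rewrite (_ : (fun _ => _) = fun=> 0); [exact: L1_0|
    apply/funext => x; rewrite big_nil].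
rewrite (_ : (fun _ => _) = fun x =>
    (if P i then F i x else 0) + \sum_(i <- s | P i) F i x); last first.
  by apply/funext => x; rewrite big_cons; case: ifP; rewrite ?add0r.
by apply: L1D => //; case Pi: (P i); [exact: LF|exact: L1_0].
Qed.

Lemma L1_norm f : L1 f -> L1 (fun x => `|f x|).
Proof. by move=> lf; exact: integrable_norm. Qed.

Lemma L1_le f h : meas f -> L1 h -> (forall x, `|f x| <= h x) -> L1 f.
Proof.
move=> mf Lh fh; apply: le_integrable Lh => //; first exact/measurable_EFinP.
by move=> x _ /=; rewrite lee_fin (le_trans (fh _)) ?ler_norm.
Qed.

Lemma RInt3D f g : L1 f -> L1 g ->
  RInt3 (fun x => f x + g x) = RInt3 f + RInt3 g.
Proof. by move=> lf lg; exact: RintegralD. Qed.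

Lemma RInt3B f g : L1 f -> L1 g ->
  RInt3 (fun x => f x - g x) = RInt3 f - RInt3 g.
Proof. by move=> lf lg; exact: RintegralB. Qed.

Lemma RInt3_cst0 : RInt3 (fun _ : V3 => 0) = 0 :> R.
Proof. by rewrite /RInt3 /Rintegral integral0. Qed.

Lemma RInt3Z c f : L1 f -> RInt3 (fun x => c * f x) = c * RInt3 f.
Proof. by move=> lf; exact: RintegralZl. Qed.

Lemma RInt3N f : L1 f -> RInt3 (fun x => - f x) = - RInt3 f.
Proof.
by move=> lf; rewrite -mulN1r -RInt3Z//; congr RInt3; apply/funext => x; rewrite mulN1r.
Qed.

Lemma RInt3_sum (I : Type) (s : seq I) (P : pred I) (F : I -> V3 -> R) :
  (forall i, P i -> L1 (F i)) ->
  RInt3 (fun x => \sum_(i <- s | P i) F i x) = \sum_(i <- s | P i) RInt3 (F i).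
Proof.
move=> LF; elim: s => [|i s IH].
  rewrite big_nil (_ : (fun _ => _) = fun=> 0) ?RInt3_cst0//.
  by apply/funext => x; rewrite big_nil.
rewrite big_cons (_ : (fun _ => _) = fun x =>
    (if P i then F i x else 0) + \sum_(i <- s | P i) F i x); last first.
  by apply/funext => x; rewrite big_cons; case: ifP; rewrite ?add0r.
rewrite RInt3D; last exact: L1_sum.
  by rewrite IH; case: (P i); rewrite // RInt3_cst0 add0r.
by case Pi: (P i); [exact: LF|exact: L1_0].
Qed.

Lemma RInt3_ge0 f : (forall x, 0 <= f x) -> 0 <= RInt3 f.
Proof. by move=> f0; apply: Rintegral_ge0 => x _; exact: f0. Qed.

Lemma RInt3_norm_le f h : L1 f -> L1 h -> (forall x, `|f x| <= h x) ->
  `|RInt3 f| <= RInt3 h.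
Proof.
move=> lf lh fh; apply: (le_trans (le_normr_Rintegral measurableT lf)).
by apply: (le_Rintegral measurableT (L1_norm lf) lh) => x _; exact: fh.
Qed.

Lemma measD f g : meas f -> meas g -> meas (fun x => f x + g x).
Proof. by move=> mf mg; exact: measurable_funD. Qed.

Lemma measM f g : meas f -> meas g -> meas (fun x => f x * g x).
Proof. by move=> mf mg; exact: measurable_funM. Qed.

Lemma measB f g : meas f -> meas g -> meas (fun x => f x - g x).
Proof. by move=> mf mg; exact: measurable_funB. Qed.

Lemma meas_cst c : meas (fun=> c).
Proof. exact: measurable_cst. Qed.

Lemma measN f : meas f -> meas (fun x => - f x).
Proof.
move=> mf; have -> : (fun x => - f x) = (fun x => 0 - f x).
  by apply/funext => x; rewrite sub0r.
by apply: measB => //; exact: meas_cst.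
Qed.

Lemma meas_sum (I : Type) (s : seq I) (P : pred I) (F : I -> V3 -> R) :
  (forall i, meas (F i)) -> meas (fun x => \sum_(i <- s | P i) F i x).
Proof.
move=> LF; elim: s => [|i s IH].
  by rewrite (_ : (fun _ => _) = fun=> 0); [exact: meas_cst|
    apply/funext => x; rewrite big_nil].
rewrite (_ : (fun _ => _) = fun x =>
    (if P i then F i x else 0) + \sum_(i <- s | P i) F i x); last first.
  by apply/funext => x; rewrite big_cons; case: ifP; rewrite ?add0r.
by apply: measD => //; case: (P i); [exact: LF|exact: meas_cst].
Qed.

Lemma meas_comp (u : R -> R) f : measurable_fun setT u -> meas f ->
  meas (fun x => u (f x)).
Proof. by move=> mu mf; exact: (@measurableT_comp _ _ _ _ _ _ u). Qed.

Lemma measurable_inv : measurable_fun setT (@GRing.inv R : R -> R).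
Proof.
rewrite (_ : setT = [set~ 0] `|` [set (0 : R)]); last by rewrite setUC setUv.
apply/measurable_funU => //; first exact: measurableC.
split; last exact: measurable_fun_set1.
apply: open_continuous_measurable_fun.
  rewrite (_ : [set~ 0] = [set x | x != 0]); first exact: open_neq.
  by apply/seteqP; split => x /= /eqP.
by move=> x; rewrite inE => /eqP x0; exact: inv_continuous.
Qed.

Lemma measV f : meas f -> meas (fun x => (f x)^-1).
Proof. by move=> mf; exact: (meas_comp measurable_inv mf). Qed.

Lemma meas_coord i : meas (fun x => x 0 i).
Proof.
rewrite /meas.
have m1 : measurable_fun setT (fst \o fst : T3 -> measurableTypeR R).
  exact: measurableT_comp.
have m2 : measurable_fun setT (snd \o fst : T3 -> measurableTypeR R).
  exact: measurableT_comp.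
have m3 : measurable_fun setT (snd : T3 -> measurableTypeR R) by [].
move: i; apply: I3P.
- by apply: eq_measurable_fun m1 => x _ /=; rewrite mxE.
- by apply: eq_measurable_fun m2 => x _ /=; rewrite mxE.
- by apply: eq_measurable_fun m3 => x _ /=; rewrite mxE.
Qed.

Lemma meas_cvg (F : nat -> V3 -> R) f : (forall n, meas (F n)) ->
  (forall x, F n x @[n --> \oo] --> f x) -> meas f.
Proof.
by move=> mF Ff; apply: (measurable_fun_cvg mF) => x _; exact: Ff.
Qed.

End Integral3.

(** * Integrals of products of functions of separate variables *)

Section ProductIntegral.
Context d1 d2 (T1 : measurableType d1) (T2 : measurableType d2) (R : realType).
Variables (m1 : {sigma_finite_measure set T1 -> \bar R}).
Variables (m2 : {sigma_finite_measure set T2 -> \bar R}).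
Variables (f : T1 -> R) (g : T2 -> R).
Hypotheses (if_ : m1.-integrable setT (EFin \o f)).
Hypotheses (ig : m2.-integrable setT (EFin \o g)).

Let mfg : measurable_fun setT (fun p : T1 * T2 => (f p.1 * g p.2)%:E).
Proof.
apply/measurable_EFinP/measurable_funM.
  by apply: (@measurableT_comp _ _ _ _ _ _ f) => //; case/integrableP: if_ => /measurable_EFinP.
by apply: (@measurableT_comp _ _ _ _ _ _ g) => //; case/integrableP: ig => /measurable_EFinP.
Qed.

Lemma integrable_prodM :
  (m1 \x m2)%E.-integrable setT (fun p : T1 * T2 => (f p.1 * g p.2)%:E).
Proof.
apply/integrable12ltyP => //=.
under eq_integral => x _.
  under eq_integral => y _ do rewrite normrM EFinM.
  rewrite ge0_integralZl//; last first.
    by apply/measurable_EFinP; apply: measurableT_comp => //; case/integrableP: ig => /measurable_EFinP.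
  over.
rewrite ge0_integralZr//.
- apply: lte_mul_pinfty.
  + by apply: integral_ge0.
  + by apply: integrable_fin_num => //; exact: (integrable_abse if_).
  + by case/integrableP: ig.
- by apply/measurable_EFinP; apply: measurableT_comp => //; case/integrableP: if_ => /measurable_EFinP.
- exact: integral_ge0.
Qed.

Lemma Rintegral_prodM :
  Rintegral (m1 \x m2)%E setT (fun p : T1 * T2 => f p.1 * g p.2) =
  Rintegral m1 setT f * Rintegral m2 setT g.
Proof.
rewrite {1}/Rintegral -(integral12_prod_meas1 integrable_prodM) /fubini_F/=.
have e x : (\int[m2]_y (f x * g y)%:E)%E = (f x * Rintegral m2 setT g)%:E.
  under eq_integral => y _ do rewrite EFinM.
  rewrite integralZl// EFinM; congr (_ * _)%E.
  by rewrite fineK// integrable_fin_num.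
under eq_integral => x _ do rewrite e EFinM.
rewrite integralZr// fineM//.
exact: integrable_fin_num.
Qed.

End ProductIntegral.

(** * Fubini, dominated convergence and differentiation under the integral on R^3 *)

Section Integral3more.
Variable R : realType.
Local Notation V3 := (pt3 R).
Local Notation T3 := (measurableTypeR R * measurableTypeR R * measurableTypeR R)%type.
Implicit Types (f g h : V3 -> R).

Definition leb2 := (@lebesgue_measure R \x @lebesgue_measure R)%E.
HB.instance Definition _ := Measure.on leb2.
Lemma leb2_sigma_finite : sigma_finite setT leb2.
Proof. by apply: sigma_finite_prod; exact: sigma_finiteT. Qed.
HB.instance Definition _ := @Measure_isSigmaFinite.Build _ _ _ leb2 leb2_sigma_finite.

Definition int1 (u : R -> R) := Rintegral (@lebesgue_measure R) setT u.
Definition I1 (u : R -> R) := (@lebesgue_measure R).-integrable setT (EFin \o u).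

Lemma L1_tensor (u0 u1 u2 : R -> R) : I1 u0 -> I1 u1 -> I1 u2 ->
  L1 (fun x => u0 (x 0 0) * u1 (x 0 1) * u2 (x 0 (1 + 1))).
Proof.
move=> i0 i1 i2.
have := integrable_prodM (m1 := leb2) (integrable_prodM i0 i1) i2.
by apply: eq_integrable => // -[[x y] z] _ /=; rewrite !mxE.
Qed.

Lemma RInt3_tensor (u0 u1 u2 : R -> R) : I1 u0 -> I1 u1 -> I1 u2 ->
  RInt3 (fun x => u0 (x 0 0) * u1 (x 0 1) * u2 (x 0 (1 + 1))) =
  int1 u0 * int1 u1 * int1 u2.
Proof.
move=> i0 i1 i2.
have := Rintegral_prodM (m1 := leb2) (integrable_prodM i0 i1) i2.
rewrite (Rintegral_prodM i0 i1) => <-.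
by apply: eq_Rintegral => -[[x y] z] _ /=; rewrite !mxE.
Qed.

Definition meas2 (K : V3 -> V3 -> R) :=
  measurable_fun setT (fun p : T3 * T3 => K (vec3 p.1) (vec3 p.2)).

Lemma meas2M K L : meas2 K -> meas2 L -> meas2 (fun x y => K x y * L x y).
Proof. by move=> mK mL; exact: measurable_funM. Qed.

Lemma meas2D K L : meas2 K -> meas2 L -> meas2 (fun x y => K x y + L x y).
Proof. by move=> mK mL; exact: measurable_funD. Qed.

Lemma meas2_comp (u : R -> R) K : measurable_fun setT u -> meas2 K ->
  meas2 (fun x y => u (K x y)).
Proof. by move=> mu mf; exact: (@measurableT_comp _ _ _ _ _ _ u). Qed.

Lemma meas2l f : meas f -> meas2 (fun x _ => f x).
Proof. by move=> mf; exact: (@measurableT_comp _ _ _ _ _ _ (f \o @vec3 R) _ fst). Qed.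

Lemma meas2r f : meas f -> meas2 (fun _ x => f x).
Proof. by move=> mf; exact: (@measurableT_comp _ _ _ _ _ _ (f \o @vec3 R) _ snd). Qed.

Lemma meas2_slice K x : meas2 K -> meas (K x).
Proof.
move=> mK; rewrite -(unvec3K x).
exact: (measurable_fun_pair2 (unvec3 x : T3) mK).
Qed.

Lemma meas2_slice2 K y : meas2 K -> meas (K^~ y).
Proof.
move=> mK; rewrite -(unvec3K y).
exact: (measurable_fun_pair1 (unvec3 y : T3) mK).
Qed.

Lemma EFin_RInt3 f : L1 f ->
  (RInt3 f)%:E = (\int[@leb3 R]_p (f (vec3 p))%:E)%E.
Proof. by move=> lf; rewrite fineK//; exact: integrable_fin_num. Qed.

Lemma integrable_kernel K g h C : meas2 K -> (forall x y, `|K x y| <= C) ->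
  L1 g -> L1 h -> (@leb3 R \x @leb3 R)%E.-integrable setT
    (fun p : T3 * T3 => (g (vec3 p.1) * h (vec3 p.2) * K (vec3 p.1) (vec3 p.2))%:E).
Proof.
move=> mK KC lg lh.
have C0 : 0 <= C by apply: le_trans (KC 0 0).
have := integrableZl measurableT C (integrable_prodM (L1_norm lg) (L1_norm lh)).
apply: le_integrable => //.
  apply/measurable_EFinP/measurable_funM => //.
  by apply: measurable_funM; [exact: meas2l (L1_meas lg)|exact: meas2r (L1_meas lh)].
move=> -[p q] _ /=; rewrite lee_fin [leRHS]ger0_norm ?mulr_ge0//.
by rewrite !normrM mulrC ler_wpM2r// mulr_ge0.
Qed.

Lemma L1_kernel K h C x : meas2 K -> (forall x y, `|K x y| <= C) -> L1 h ->
  L1 (fun y => h y * K x y).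
Proof.
move=> mK KC lh; apply: L1_le (L1Z C (L1_norm lh)) _.
  by apply: measM; [exact: L1_meas|exact: meas2_slice].
by move=> y; rewrite normrM mulrC ler_wpM2r.
Qed.

(** A bounded kernel need not be integrable in [x], so Fubini is applied with an integrable weight
    [g]; measurability survives division by [g], which vanishes nowhere. A Gaussian serves as the
    weight later. *)
Lemma meas_RInt3_kernel K g h C : meas2 K -> (forall x y, `|K x y| <= C) ->
  L1 g -> L1 h -> (forall x, g x != 0) -> meas (fun x => RInt3 (fun y => h y * K x y)).
Proof.
move=> mK KC lg lh g0.
have mF := measurable_fubini_F (integrable_kernel mK KC lg lh).
have m : meas (fun x => g x * RInt3 (fun y => h y * K x y)).
  apply/measurable_EFinP; apply: eq_measurable_fun mF => p _; rewrite /fubini_F /=.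
  under eq_integral => q _ do rewrite -mulrA EFinM.
  rewrite (integralZl measurableT (L1_kernel (vec3 p) mK KC lh)) EFinM.
  by congr (_ * _)%E; rewrite (EFin_RInt3 (L1_kernel (vec3 p) mK KC lh)).
have := measM m (measV (L1_meas lg)); congr meas; apply/funext => x.
by rewrite mulrAC mulfV ?mul1r.
Qed.

Lemma RInt3_swap K g h C : meas2 K -> (forall x y, `|K x y| <= C) ->
  L1 g -> L1 h ->
  RInt3 (fun x => g x * RInt3 (fun y => h y * K x y)) =
  RInt3 (fun y => h y * RInt3 (fun x => g x * K x y)).
Proof.
move=> mK KC lg lh.
have iF := integrable_kernel mK KC lg lh.
have hK x := L1_kernel x mK KC lh.
have gK y : L1 (fun x => g x * K x y).
  apply: L1_le (L1Z C (L1_norm lg)) _.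
    by apply: measM; [exact: L1_meas|exact: meas2_slice2].
  by move=> x; rewrite normrM mulrC ler_wpM2r.
have FF := Fubini iF; rewrite /= in FF.
apply: (f_equal fine).
transitivity (\int[@leb3 R]_p \int[@leb3 R]_q
    (g (vec3 p) * h (vec3 q) * K (vec3 p) (vec3 q))%:E)%E.
  apply: eq_integral => p _.
  under [RHS]eq_integral => q _ do rewrite -mulrA EFinM.
  rewrite (integralZl measurableT (hK (vec3 p))) EFinM.
  by congr (_ * _)%E; rewrite (EFin_RInt3 (hK (vec3 p))).
rewrite FF; apply: eq_integral => q _.
under eq_integral => p _ do rewrite [g _ * h _]mulrC -mulrA EFinM.
rewrite (integralZl measurableT (gK (vec3 q))) EFinM.
by congr (_ * _)%E; rewrite (EFin_RInt3 (gK (vec3 q))).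
Qed.

Lemma RInt3_cvg (F : nat -> V3 -> R) f g : (forall n, meas (F n)) -> L1 g ->
  (forall x, F n x @[n --> \oo] --> f x) -> (forall n x, `|F n x| <= g x) ->
  RInt3 (F n) @[n --> \oo] --> RInt3 f.
Proof.
move=> mF lg Ff Fg.
have mf := meas_cvg mF Ff.
have fg x : `|f x| <= g x.
  by apply: (cvgr_to_le (cvg_norm (Ff x))); apply: nearW => n; exact: Fg.
apply: fine_cvg; rewrite fineK.
  2: exact: (integrable_fin_num measurableT (L1_le mf lg fg)).
apply: (@dominated_cvg _ _ _ (@leb3 R) setT measurableT
  (fun n p => (F n (vec3 p))%:E) (fun p => (f (vec3 p))%:E)
  (fun p => (g (vec3 p))%:E)) => //.
- by move=> n; apply/measurable_EFinP; exact: mF.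
- by move=> p _; apply: cvg_EFin; [exact: nearW|exact: Ff].
- by move=> n p _; rewrite lee_fin; exact: Fg.
Qed.

(** The domination is asked only on an interval around [a]: the bounds met later, in the inverse
    width [s] of a Gaussian, are not uniform down to [s = 0]. *)
Lemma is_derive_RInt3 (F dF : R -> V3 -> R) G a u v : u < a -> a < v ->
  (forall s, u < s < v -> L1 (F s)) ->
  (forall s y, u < s < v -> is_derive s 1 (F^~ y) (dF s y)) ->
  L1 G -> (forall s y, u < s < v -> `|dF s y| <= G y) ->
  is_derive a 1 (fun s => RInt3 (F s)) (RInt3 (dF a)).
Proof.
move=> ua av lF DF lG FG.
have Ia : `]u, v[%classic a by rewrite /= in_itv/= ua av.
have p1 s y : u < s < v -> partial1of2 (fun s p => F s (vec3 p)) s y = dF s (vec3 y).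
  by move=> us; rewrite partial1of2E; have [_ ->] := DF s (vec3 y) us.
have G0 y : 0 <= (G \o @vec3 R) y.
  by rewrite (le_trans _ (FG a _ _)) ?ua ?av.
have FG' (x : R) (y : T3) : `]u, v[%classic x -> setT y ->
    `|partial1of2 (fun s p => F s (vec3 p)) x y| <= (G \o @vec3 R) y.
  by rewrite /= in_itv/= => xuv _; rewrite p1//; exact: FG.
have DF' (x : R) (y : T3) : `]u, v[%classic x -> setT y ->
    derivable (fun s => F s (vec3 y)) x 1.
  by rewrite /= in_itv/= => xuv _; have [] := DF x (vec3 y) xuv.
have lF' (x : R) : `]u, v[%classic x -> (@leb3 R).-integrable setT (EFin \o (fun p => F x (vec3 p))).
  by rewrite /= in_itv/= => xuv; exact: lF.
apply: DeriveDef.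
  exact: (derivable_under_integral measurableT Ia lF' DF' G0 lG FG').
rewrite -derive1E (differentiation_under_integral measurableT Ia lF' DF' G0 lG FG').
by apply: eq_Rintegral => y _; rewrite p1 ?ua ?av.
Qed.

End Integral3more.

(** * Continuity and gradients on R^3 *)

Section Space3.
Variable R : realType.
Local Notation V3 := (pt3 R).
Local Notation T3 := (measurableTypeR R * measurableTypeR R * measurableTypeR R)%type.
Implicit Types (f g h : V3 -> R).

Lemma cvg_coord3 (T : Type) (F : set_system T) (FF : Filter F) (u : T -> V3) (x : V3) :
  (forall i, u t 0 i @[t --> F] --> x 0 i) -> u t @[t --> F] --> x.
Proof.
move=> ux; apply/cvg_ballP => e e0.
have H : \forall t \near F, forall i : 'I_3, ball (x 0 i) e (u t 0 i).
  by apply: filter_forall => i; exact: (cvg_ball (ux i)).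
by apply: filterS H => t H; split => // i j; rewrite !ord1; exact: H.
Qed.

Lemma nbhs3P (x : V3) (P : V3 -> Prop) : nbhs x P ->
  exists2 e, 0 < e & forall y : V3, (forall i, `|y 0 i - x 0 i| < e) -> P y.
Proof.
case/nbhs_ballP => e e0 H; exists e => // y xy; apply: H; split => // i j.
by rewrite !ord1 /ball/= distrC; exact: xy.
Qed.

Lemma normr3_le (x : V3) e : 0 <= e -> (forall i, `|x 0 i| <= e) -> `|x| <= e.
Proof.
move=> e0 H; rewrite [leLHS]/Num.Def.normr /= mx_normrE.
by apply: bigmax_le => // -[i j] _ /=; rewrite ord1.
Qed.

Lemma measurable_floor_fiber (a : int) :
  measurable ([set t | Num.floor t = a] : set (measurableTypeR R)).
Proof.
rewrite (_ : [set t | _] = `[a%:~R, (a + 1)%:~R[%classic); first exact: measurable_itv.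
apply/seteqP; split => [t /= <-|t /=].
  by rewrite in_itv/=; exact: floor_itv.
by rewrite in_itv/= => /floor_def.
Qed.

(* [f] is the pointwise limit of functions that are constant on the cells of a
   cubic grid. *)
Lemma continuous_meas f : continuous f -> meas f.
Proof.
move=> cf; pose r n (t : R) := (Num.floor (t * n.+1%:R))%:~R / n.+1%:R : R.
pose F n (x : V3) := f (\row_i r n (x 0 i)).
have rcvg (t : R) : r n t @[n --> \oo] --> t.
  apply/cvgrPdist_le => e e0; near=> n.
  have n0 : 0 < n.+1%:R :> R by [].
  have /andP[h1 h2] := floor_itv (t * n.+1%:R).
  have -> : t - r n t = (t * n.+1%:R - (Num.floor (t * n.+1%:R))%:~R) / n.+1%:R.
    by rewrite mulrBl mulfK ?lt0r_neq0.
  rewrite normrM normfV [`|n.+1%:R|]gtr0_norm// ler_pdivrMr//.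
  rewrite ger0_norm ?subr_ge0// (@le_trans _ _ 1)//.
    by rewrite lerBlDr (le_trans (ltW h2))// intrD addrC.
  rewrite -ler_pdivrMr// div1r.
  apply/ltW; near: n; exact: (near_infty_natSinv_lt (PosNum e0)).
apply: (@meas_cvg _ F) => [n|x]; last first.
  apply: (@continuous_cvg _ _ _ _ _ (fun n : nat => \row_i r n (x 0 i)) f _ (cf x)).
  apply: cvg_coord3 => i; rewrite (_ : (fun _ => _) = r^~ (x 0 i)) //.
  by apply/funext => n; rewrite mxE.
move=> _ A mA; rewrite setTI.
pose q i (p : T3) := Num.floor ((vec3 p) 0 i * n.+1%:R).
pose cell (a : {ffun 'I_3 -> int}) := q 0 @^-1` [set a 0] `&`
  q 1 @^-1` [set a 1] `&` q (1 + 1) @^-1` [set a (1 + 1)].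
pose v (a : {ffun 'I_3 -> int}) : V3 := \row_i ((a i)%:~R / n.+1%:R).
rewrite (_ : _ @^-1` A = \bigcup_a (if f (v a) \in A then cell a else set0)).
  apply: countable_bigcupT_measurable => // a; case: ifP => // _.
  have mq i : measurable (q i @^-1` [set a i]).
    have : measurable_fun (setT : set T3) ((fun x : V3 => x 0 i * n.+1%:R) \o @vec3 R).
      by apply: measM; [exact: meas_coord|exact: meas_cst].
    move=> /(_ measurableT _ (measurable_floor_fiber (a i))); rewrite setTI.
    by congr measurable; apply/seteqP; split.
  by do 2 apply: measurableI => //.
have cellv p a : cell a p -> v a = \row_i r n ((vec3 p) 0 i).
  move=> [[q0 q1] q2]; apply/rowP => i; rewrite !mxE /r; congr (_%:~R / _).
  by move: i; apply: I3P; [rewrite -q0|rewrite -q1|rewrite -q2]; rewrite /q mxE.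
apply/seteqP; split => [p /= Ap|p [a _]].
  exists [ffun i => q i p] => //.
  have cp : cell [ffun i => q i p] p by split; [split|]; rewrite /= ffunE.
  by rewrite ifT//; rewrite (cellv _ _ cp) inE.
case: ifP => // fa cp; move: fa; rewrite (cellv _ _ cp) inE => fa.
exact: fa.
Unshelve. all: by end_near. Qed.

End Space3.

(** * Gradient calculus and first-order expansion *)

Section Gradient.
Variable R : realType.
Local Notation V3 := (pt3 R).
Implicit Types (f g : V3 -> R) (df dg : V3 -> 'I_3 -> R).

(** Differentiability is paired with a formula for the partial derivatives, so that the product and
    chain rules below deliver both at once. *)
Definition has_grad f df := forall x : V3,
  differentiable f x /\ forall i, 'D_(ev3 R i) f x = df x i.

Lemma has_grad_eq f df dg : has_grad f df -> (forall x i, df x i = dg x i) ->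
  has_grad f dg.
Proof. by move=> H e x; have [h1 h2] := H x; split => // i; rewrite h2. Qed.

Lemma has_grad_continuous f df : has_grad f df -> continuous f.
Proof. by move=> H x; apply: differentiable_continuous; case: (H x). Qed.

Lemma has_grad_cst c : has_grad (fun=> c) (fun _ _ => 0).
Proof. by move=> x; split => [|i]; [exact: differentiable_cst|exact: derive_cst]. Qed.

Lemma has_grad_coord j : has_grad (fun x => x 0 j) (fun _ i => (i == j)%:R).
Proof.
move=> x; have dx : differentiable (fun x : V3 => x 0 j) x.
  exact: differentiable_coord.
split => // i.
rewrite /derive; apply: cvg_lim => //; apply: cvg_near_cst.
near=> h.
have h0 : h != 0 by near: h; exact: nbhs_dnbhs_neq.
by rewrite /= !mxE addrK /= eq_sym /GRing.scale /= mulKf.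
Unshelve. all: by end_near. Qed.

Lemma has_gradD f df g dg : has_grad f df -> has_grad g dg ->
  has_grad (fun x => f x + g x) (fun x i => df x i + dg x i).
Proof.
move=> Hf Hg x; have [f1 f2] := Hf x; have [g1 g2] := Hg x.
split => [|i]; first exact: differentiableD.
by rewrite -f2 -g2; apply: deriveD; exact: diff_derivable.
Qed.

Lemma has_gradM f df g dg : has_grad f df -> has_grad g dg ->
  has_grad (fun x => f x * g x) (fun x i => f x * dg x i + g x * df x i).
Proof.
move=> Hf Hg x; have [f1 f2] := Hf x; have [g1 g2] := Hg x.
split => [|i]; first exact: differentiableM.
by rewrite -f2 -g2; apply: deriveM; exact: diff_derivable.
Qed.

Lemma has_gradZ f df c : has_grad f df ->
  has_grad (fun x => c * f x) (fun x i => c * df x i).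
Proof.
move=> Hf; apply: has_grad_eq (has_gradM (has_grad_cst c) Hf) _ => x i.
by rewrite mulr0 addr0.
Qed.

Lemma has_gradB f df g dg : has_grad f df -> has_grad g dg ->
  has_grad (fun x => f x - g x) (fun x i => df x i - dg x i).
Proof.
move=> Hf Hg; have := has_gradD Hf (has_gradZ (-1) Hg).
rewrite (_ : (fun x => f x + _) = fun x => f x - g x); last first.
  by apply/funext => x; rewrite mulN1r.
by move/has_grad_eq; apply => x i; rewrite mulN1r.
Qed.

Lemma has_grad_sum (I : Type) (s : seq I) (F : I -> V3 -> R) dF :
  (forall i, has_grad (F i) (dF i)) ->
  has_grad (fun x => \sum_(i <- s) F i x) (fun x j => \sum_(i <- s) dF i x j).
Proof.
move=> H; elim: s => [|i s IH].
  rewrite (_ : (fun _ => _) = fun=> 0); last by apply/funext => x; rewrite big_nil.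
  by apply: has_grad_eq (has_grad_cst _) _ => x j; rewrite big_nil.
rewrite (_ : (fun _ => _) = fun x => F i x + \sum_(i <- s) F i x); last first.
  by apply/funext => x; rewrite big_cons.
by apply: has_grad_eq (has_gradD (H i) IH) _ => x j; rewrite big_cons.
Qed.

Lemma has_grad_comp (u du : R -> R) f df : (forall t : R, is_derive t 1 u (du t)) ->
  has_grad f df -> has_grad (fun x => u (f x)) (fun x i => du (f x) * df x i).
Proof.
move=> Hu Hf x; have [f1 f2] := Hf x.
have u1 : differentiable u (f x) by apply/derivable1_diffP; case: (Hu (f x)).
split => [|i]; first exact: (@differentiable_comp _ _ _ _ f u).
rewrite deriveE; last exact: (@differentiable_comp _ _ _ _ f u).
rewrite (_ : 'd _ x = 'd u (f x) \o 'd f x :> (V3 -> R)); last exact: (diff_comp f1 u1).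
rewrite /= -(deriveE _ f1) f2 deriv1E; last by case: (Hu (f x)).
by rewrite derive1E (@derive_val _ _ _ _ _ _ _ (Hu (f x))) mulrC.
Qed.

Lemma has_grad_dot (k : V3) : has_grad (fun x => dot3 k x) (fun _ i => k 0 i).
Proof.
have H := has_grad_sum (index_enum 'I_3) (fun j => has_gradZ (k 0 j) (has_grad_coord j)).
apply: has_grad_eq H _.
move=> x i; rewrite (bigD1 i)//= eqxx mulr1 big1 ?addr0// => j /negbTE ji.
by rewrite eq_sym ji mulr0.
Qed.

(** The little-o of the differential, with the sup norm of the displacement replaced by the larger
    sum over the coordinates. This is the only form in which Goursat's argument uses
    differentiability, at the limit point of the bisection. *)
Lemma differentiable_local f x : differentiable f x -> forall e, 0 < e ->
  exists2 d, 0 < d & forall y : V3, (forall i, `|y 0 i - x 0 i| < d) ->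
    `|f y - f x - \sum_(i < 3) (y 0 i - x 0 i) * 'D_(ev3 R i) f x| <=
      e * \sum_(i < 3) `|y 0 i - x 0 i|.
Proof.
move=> dfx e e0.
have /eqaddoP/(_ e e0) H := diff_locally dfx.
have [d d0 {}H] := nbhs3P H.
exists d => // y yd; have := H (y - x); rewrite /= => {}H.
have {}H := H (fun i => _); rewrite !fctE /= subrK in H.
apply: le_trans (le_trans (H _) _).
- rewrite le_eqVlt; apply/orP; left; apply/eqP; congr `|_|.
  rewrite opprD addrA; congr (_ - _).
  have -> : y - x = \sum_(i < 3) (y 0 i - x 0 i) *: ev3 R i.
    by rewrite {1}(row_sum_delta (y - x)); apply: eq_bigr => i _; rewrite !mxE.
  rewrite linear_sum; apply: eq_bigr => i _.
  by rewrite linearZ /= deriveE.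
- by move=> i; rewrite !mxE subr0; exact: yd.
- rewrite ler_wpM2l ?(ltW e0)//; apply: normr3_le => [|i]; first exact: sumr_ge0.
  by rewrite !mxE (bigD1 i)//= lerDl sumr_ge0.
Qed.

End Gradient.

(** * The divergence theorem for differentiable fields *)

Section Tent.
Variable R : realType.
Local Notation V3 := (pt3 R).

Lemma integral_affine (p q al be : R) : p <= q ->
  int1 (fun t => (al + be * t) * \1_(`[p, q[%classic) t) =
  al * (q - p) + be * (q ^+ 2 - p ^+ 2) / 2.
Proof.
rewrite le_eqVlt => /predU1P[->|pq].
  rewrite !subrr mulr0 mulr0 mul0r addr0 /int1 /Rintegral.
  rewrite (_ : (fun _ => _) = cst 0%E) ?integral0//; apply/funext => t /=.
  by rewrite indicE set_itvco0 ?in_set0 ?mulr0.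
have <- : Rintegral (@lebesgue_measure R) `[p, q[%classic (fun t => al + be * t) =
    int1 (fun t => (al + be * t) * \1_(`[p, q[%classic) t).
  rewrite Rintegral_mkcond /int1; apply: eq_Rintegral => t _.
  by rewrite patchE indicE; case: ifP => _; rewrite ?mulr1 ?mulr0.
pose F (t : R) := al * t + be * t ^+ 2 / 2.
have dF (t : R) : is_derive t 1 F (al + be * t).
  rewrite /F; apply: is_derive_eq.
  by rewrite /GRing.scale /= ?mulr1 ?expr1; field.
have cf (t : R) : {for t, continuous (fun t => al + be * t)}.
  apply: differentiable_continuous; apply/derivable1_diffP.
  by apply: ex_derive.
have ci : {within `[p, q], continuous (fun t => al + be * t)}.
  by apply: continuous_subspaceT => t; exact: cf.
have ii := @continuous_compact_integrable R _ _ (@segment_compact _ p q) ci.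
rewrite Rintegral_itv_bndo_bndc; last first.
  by apply: integrableS ii => //; apply: subset_itvl; rewrite bnd_simp.
rewrite /Rintegral (@continuous_FTC2 _ _ F)//.
- by rewrite -EFinB /= /F; field.
- have cF t : {for t, continuous F}.
    by apply: differentiable_continuous; apply/derivable1_diffP; case: (dF t).
  split => [t _||]; first by case: (dF t).
    by apply: cvg_at_right_filter; exact: cF.
  by apply: cvg_at_left_filter; exact: cF.
- by move=> t _; rewrite derive1E; case: (dF t).
Qed.

Lemma I1_bounded (u : R -> R) (p q C : R) : measurable_fun setT u ->
  (forall t, `|u t| <= C * \1_(`[p, q[%classic) t) -> I1 u.
Proof.
move=> mu uC.
apply: le_integrable (integrableZl measurableT C (integrable_indic_itv p q true true)) => //.
  exact/measurable_EFinP.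
by move=> t _ /=; rewrite lee_fin (le_trans (uC t))// ler_norm.
Qed.

Lemma measurable_indic_co (p q : R) : measurable_fun setT (\1_(`[p, q[%classic) : R -> R).
Proof. by apply: measurable_indic; exact: measurable_itv. Qed.

Lemma I1_affine (p q al be : R) : I1 (fun t => (al + be * t) * \1_(`[p, q[%classic) t).
Proof.
apply: (@I1_bounded _ p q (`|al| + `|be| * (`|p| + `|q|))).
  apply: measurable_funM; last exact: measurable_indic_co.
  by apply: measurable_funD => //; apply: measurable_funM.
move=> t; rewrite normrM indicE mem_setE in_itv /=.
case: (leP p t) => pt; last by rewrite normr0 !mulr0.
case: (ltP t q) => tq; last by rewrite normr0 !mulr0.
rewrite normr1 !mulr1 (le_trans (ler_normD _ _))// lerD2l normrM ler_wpM2l//.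
rewrite ler_norml; have := ler_norm p; have := ler_norm q.
have := ler_norm (- p); have := ler_norm (- q); rewrite !normrN.
by move=> *; apply/andP; split; lra.
Qed.

(** The piecewise linear tent of height [1] on [[a - h, a + h[]. Half-open pieces tile the line, so
    the refinement identities hold at every point, breakpoints included. *)
Definition hat (h a t : R) : R :=
  (1 + (t - a) / h) * \1_(`[a - h, a[%classic) t +
  (1 - (t - a) / h) * \1_(`[a, a + h[%classic) t.
(** The slope of [hat], given as a step function; no derivative of [hat] is ever taken. *)
Definition dhat (h a t : R) : R :=
  h^-1 * \1_(`[a - h, a[%classic) t - h^-1 * \1_(`[a, a + h[%classic) t.
Definition box (h a t : R) : R := \1_(`[a - h, a + h[%classic) t.

Let indicE' (p q t : R) : \1_(`[p, q[%classic) t = ((p <= t < q)%R)%:R :> R.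
Proof. by rewrite indicE mem_setE in_itv. Qed.

(** Interpolation on the mesh of half size: at its three inner nodes the tent takes the values
    [1/2], [1], [1/2]. *)
Lemma hat_refine h a t : 0 < h -> hat h a t =
  hat (h / 2) a t + 2^-1 * hat (h / 2) (a - h / 2) t + 2^-1 * hat (h / 2) (a + h / 2) t.
Proof.
move=> h0; rewrite /hat !indicE'.
have -> : a - h / 2 - h / 2 = a - h by field.
have -> : a + h / 2 + h / 2 = a + h by field.
rewrite subrK addrK.
have e x : x / (h / 2) = 2 * (x / h) by field; rewrite lt0r_neq0.
rewrite !e {e}; set u := (t - a) / h.
have -> : (t - (a - h / 2)) / h = u + 2^-1 by rewrite /u; field; rewrite lt0r_neq0.
have -> : (t - (a + h / 2)) / h = u - 2^-1 by rewrite /u; field; rewrite lt0r_neq0.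
move: u => u; rewrite !ltNge; case: (leP a t) => t0.
  have -> : a - h <= t by lra.
  have -> : a - h / 2 <= t by lra.
  case: (leP (a + h / 2) t) => t1; last have -> : (a + h <= t) = false by apply: lt_geF; lra.
    by case: (leP (a + h) t) => t2 /=; lra.
  by rewrite /=; lra.
have -> : (a + h / 2 <= t) = false by apply: lt_geF; lra.
have -> : (a + h <= t) = false by apply: lt_geF; lra.
case: (leP (a - h / 2) t) => t1; first have -> : a - h <= t by lra.
  by rewrite /=; lra.
by case: (leP (a - h) t) => t2 /=; lra.
Qed.

(** Slopes obey the relation of the tents with the same weights, which is what lets a tent and its
    slope be refined as a pair. *)
Lemma dhat_refine h a t : 0 < h -> dhat h a t =
  dhat (h / 2) a t + 2^-1 * dhat (h / 2) (a - h / 2) t + 2^-1 * dhat (h / 2) (a + h / 2) t.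
Proof.
move=> h0; rewrite /dhat !indicE'.
have -> : a - h / 2 - h / 2 = a - h by field.
have -> : a + h / 2 + h / 2 = a + h by field.
rewrite subrK addrK.
have -> : (h / 2)^-1 = 2 * h^-1 by field; rewrite lt0r_neq0.
rewrite !ltNge; case: (leP a t) => t0.
  have -> : a - h <= t by lra.
  have -> : a - h / 2 <= t by lra.
  case: (leP (a + h / 2) t) => t1; last have -> : (a + h <= t) = false by apply: lt_geF; lra.
    by case: (leP (a + h) t) => t2 /=; lra.
  by rewrite /=; lra.
have -> : (a + h / 2 <= t) = false by apply: lt_geF; lra.
have -> : (a + h <= t) = false by apply: lt_geF; lra.
case: (leP (a - h / 2) t) => t1; first have -> : a - h <= t by lra.
  by rewrite /=; lra.
by case: (leP (a - h) t) => t2 /=; lra.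
Qed.

End Tent.

(** * Moments of tents and of their slopes *)

Section TentIntegrals.
Variable R : realType.
Implicit Types (h a t : R).

Lemma I1D (u v : R -> R) : I1 u -> I1 v -> I1 (fun t => u t + v t).
Proof. by move=> iu iv; apply: eq_integrable (integrableD _ iu iv). Qed.

Lemma int1D (u v : R -> R) : I1 u -> I1 v -> int1 (fun t => u t + v t) = int1 u + int1 v.
Proof. by move=> iu iv; exact: RintegralD. Qed.

Lemma integral_two_affine h a (al be ga de : R) : 0 < h ->
  let u t := (al + be * t) * \1_(`[a - h, a[%classic) t +
             (ga + de * t) * \1_(`[a, a + h[%classic) t in
  I1 u /\ int1 u = al * h + be * (a ^+ 2 - (a - h) ^+ 2) / 2 +
                   (ga * h + de * ((a + h) ^+ 2 - a ^+ 2) / 2).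
Proof.
move=> h0 u; have i1 := I1_affine (a - h) a al be.
have i2 := I1_affine a (a + h) ga de.
split; first exact: I1D.
rewrite int1D// !integral_affine; [|lra|lra].
by field.
Qed.

Lemma hat_integral h a : 0 < h -> I1 (hat h a) /\ int1 (hat h a) = h.
Proof.
move=> h0.
have [] := @integral_two_affine h a (1 - a / h) h^-1 (1 + a / h) (- h^-1) h0.
rewrite (_ : (fun t => _) = hat h a); last first.
  apply/funext => t; rewrite /hat; congr (_ * _ + _ * _); by field; rewrite lt0r_neq0.
by move=> i1 ->; split => //; field; rewrite lt0r_neq0.
Qed.

Lemma dhat_integral h a : 0 < h -> I1 (dhat h a) /\ int1 (dhat h a) = 0.
Proof.
move=> h0.
have [] := @integral_two_affine h a h^-1 0 (- h^-1) 0 h0.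
rewrite (_ : (fun t => _) = dhat h a); last first.
  by apply/funext => t; rewrite /dhat !mul0r !addr0 mulNr.
by move=> i1 ->; split => //; field; rewrite lt0r_neq0.
Qed.

(** Integration by parts made explicit: the first moment of the slope is minus the integral [h] of
    the tent. *)
Lemma Mdhat_integral h a : 0 < h -> I1 (fun t => (t - a) * dhat h a t) /\
  int1 (fun t => (t - a) * dhat h a t) = - h.
Proof.
move=> h0.
have [] := @integral_two_affine h a (- a / h) h^-1 (a / h) (- h^-1) h0.
rewrite (_ : (fun t => _) = fun t => (t - a) * dhat h a t); last first.
  by apply/funext => t; rewrite /dhat; field; rewrite lt0r_neq0.
by move=> i1 ->; split => //; field; rewrite lt0r_neq0.
Qed.

Lemma box_integral h a : 0 < h -> I1 (box h a) /\ int1 (box h a) = 2 * h.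
Proof.
move=> h0.
have -> : box h a = fun t => (1 + 0 * t) * \1_(`[a - h, a + h[%classic) t.
  by apply/funext => t; rewrite /box mul0r addr0 mul1r.
split; first exact: I1_affine.
by rewrite integral_affine; [field|lra].
Qed.

Lemma measurable_hat h a : measurable_fun setT (hat h a).
Proof.
apply: measurable_funD; apply: measurable_funM; try exact: measurable_indic_co.
  by apply: measurable_funD => //; apply: measurable_funM => //; exact: measurable_funB.
by apply: measurable_funB => //; apply: measurable_funM => //; exact: measurable_funB.
Qed.

Lemma measurable_dhat h a : measurable_fun setT (dhat h a).
Proof.
by apply: measurable_funB; apply: measurable_funM => //; exact: measurable_indic_co.
Qed.

Lemma hat_box h a t : 0 < h -> `|hat h a t| <= box h a t.
Proof.
move=> h0; rewrite /hat /box !indicE !mem_setE !in_itv /=.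
have e : t - a = ((t - a) / h) * h by field; rewrite lt0r_neq0.
set u := (t - a) / h in e *.
rewrite ler_norml; case: (leP a t) => t1; case: (ltP t a) => t2;
 case: (leP (a - h) t) => t3; case: (ltP t (a + h)) => t4 //=; try lra.
- have u0 : 0 <= u by rewrite /u divr_ge0//; lra.
  have u1 : u <= 1 by rewrite /u ler_pdivrMr//; lra.
  lra.
- have u0 : u <= 0 by rewrite /u ler_pdivrMr//; lra.
  have u1 : -1 <= u by rewrite /u ler_pdivlMr//; lra.
  lra.
Qed.

Lemma dhat_box h a t : 0 < h -> `|dhat h a t| <= h^-1 * box h a t.
Proof.
move=> h0; rewrite /dhat /box !indicE !mem_setE !in_itv /=.
have : 0 < h^-1 by rewrite invr_gt0.
set u := h^-1 => u0.
rewrite ler_norml; case: (leP a t) => t1; case: (ltP t a) => t2;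
 case: (leP (a - h) t) => t3; case: (ltP t (a + h)) => t4 //=; lra.
Qed.

Lemma box_le1 h a t : box h a t <= 1 /\ 0 <= box h a t.
Proof. by rewrite /box indicE; case: (_ \in _). Qed.

Lemma box_supp h a t : box h a t != 0 -> `|t - a| <= h.
Proof.
rewrite /box indicE mem_setE in_itv/=; case: (leP (a - h) t) => t3; last by rewrite eqxx.
case: (ltP t (a + h)) => t4; last by rewrite eqxx.
by move=> _; rewrite ler_norml; apply/andP; split; lra.
Qed.

Lemma Mhat_integrable h a : 0 < h -> I1 (fun t => (t - a) * hat h a t).
Proof.
move=> h0; apply: (@I1_bounded _ _ (a - h) (a + h) h).
  by apply: measurable_funM; [exact: measurable_funB|exact: measurable_hat].
move=> t; rewrite -/(box h a t) normrM.
have [b0|b0] := eqVneq (box h a t) 0.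
  have := hat_box a t h0; rewrite b0 normr_le0 => /eqP ->.
  by rewrite normr0 !mulr0.
by apply: ler_pM => //; [exact: box_supp|exact: hat_box].
Qed.

End TentIntegrals.

(** * Goursat's argument with tents *)

Section DivergenceTheorem.
Variable R : realType.
Local Notation V3 := (pt3 R).

Lemma L1_mul_bounded (g u : V3 -> R) (C : R) : L1 g -> meas u ->
  (forall x, `|u x| <= C) -> L1 (fun x => g x * u x).
Proof.
move=> lg mu uC; apply: L1_le (L1Z C (L1_norm lg)) _.
  by apply: measM => //; exact: L1_meas.
by move=> x; rewrite normrM mulrC ler_wpM2r.
Qed.

(** Integrability and value travel together, so that a linear combination of known integrals yields
    both. *)
Definition has_int3 (g : V3 -> R) (v : R) := L1 g /\ RInt3 g = v.

Lemma has_int3D g g' v v' : has_int3 g v -> has_int3 g' v' ->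
  has_int3 (fun x => g x + g' x) (v + v').
Proof. by move=> [lg <-] [lg' <-]; split; [exact: L1D|rewrite RInt3D]. Qed.

Lemma has_int3Z c g v : has_int3 g v -> has_int3 (fun x => c * g x) (c * v).
Proof. by move=> [lg <-]; split; [exact: L1Z|rewrite RInt3Z]. Qed.

Lemma has_int3_eq g g' v v' : has_int3 g v -> (forall x, g x = g' x) -> v = v' ->
  has_int3 g' v'.
Proof. by move=> H /funext <- <-. Qed.

Definition tens (u0 u1 u2 : R -> R) (x : V3) : R :=
  u0 (x 0 0) * u1 (x 0 1) * u2 (x 0 (1 + 1)).

Lemma has_int3_tens (u0 u1 u2 : R -> R) : I1 u0 -> I1 u1 -> I1 u2 ->
  has_int3 (tens u0 u1 u2) (int1 u0 * int1 u1 * int1 u2).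
Proof. by move=> i0 i1 i2; split; [exact: L1_tensor|exact: RInt3_tensor]. Qed.

Lemma meas_tens (u0 u1 u2 : R -> R) : measurable_fun setT u0 ->
  measurable_fun setT u1 -> measurable_fun setT u2 -> meas (tens u0 u1 u2).
Proof.
move=> m0 m1 m2; apply: measM; first apply: measM.
- exact: (meas_comp m0 (meas_coord 0)).
- exact: (meas_comp m1 (meas_coord 1)).
- exact: (meas_comp m2 (meas_coord (1 + 1))).
Qed.

Lemma tens_bound (u0 u1 u2 : R -> R) C0 C1 C2 x :
  (forall t, `|u0 t| <= C0) -> (forall t, `|u1 t| <= C1) -> (forall t, `|u2 t| <= C2) ->
  `|tens u0 u1 u2 x| <= C0 * C1 * C2.
Proof.
move=> b0 b1 b2; rewrite /tens !normrM.
by apply: ler_pM => //; apply: ler_pM.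
Qed.

Variables (V : 'I_3 -> V3 -> R) (f : V3 -> R).
Hypothesis dV : forall i x, differentiable (V i) x.
Hypothesis fE : forall x, f x = \sum_(i < 3) 'D_(ev3 R i) (V i) x.
Hypothesis cf : continuous f.
Hypothesis lV : forall i, L1 (V i).
Hypothesis lf : L1 f.

Local Notation pair := ((R -> R) * (R -> R))%type.

(** Each pair holds a tent and its slope. When [g] is the divergence of [W], this is formally the
    divergence of [W] times the product of the three tents, so its integral is what has to
    vanish. *)
Definition tented (g : V3 -> R) (W : 'I_3 -> V3 -> R) (p0 p1 p2 : pair) (x : V3) : R :=
  g x * tens p0.1 p1.1 p2.1 x + W 0 x * tens p0.2 p1.1 p2.1 x +
  W 1 x * tens p0.1 p1.2 p2.1 x + W (1 + 1) x * tens p0.1 p1.1 p2.2 x.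

Definition tent (h a : R) : pair := (hat h a, dhat h a).

Let T p0 p1 p2 := RInt3 (tented f V p0 p1 p2).

Lemma hat_le1 (h a t : R) : 0 < h -> `|hat h a t| <= 1.
Proof. by move=> h0; rewrite (le_trans (hat_box a t h0))//; case: (box_le1 h a t). Qed.

Lemma dhat_le (h a t : R) : 0 < h -> `|dhat h a t| <= h^-1.
Proof.
move=> h0; apply: le_trans (dhat_box a t h0) _.
by apply: ler_piMr; [rewrite invr_ge0 ltW|case: (box_le1 h a t)].
Qed.

Lemma L1_tented (h0 h1 h2 a0 a1 a2 : R) : 0 < h0 -> 0 < h1 -> 0 < h2 ->
  L1 (tented f V (tent h0 a0) (tent h1 a1) (tent h2 a2)).
Proof.
move=> p0 p1 p2.
have mh := @measurable_hat R; have md := @measurable_dhat R.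
have i0 : 0 <= h0^-1 by rewrite invr_ge0 ltW.
have i1 : 0 <= h1^-1 by rewrite invr_ge0 ltW.
have i2 : 0 <= h2^-1 by rewrite invr_ge0 ltW.
rewrite /tented; apply: L1D; [apply: L1D; [apply: L1D|]|].
- apply: (@L1_mul_bounded _ _ (1 * 1 * 1)) => //; first by apply: meas_tens => /=.
  by move=> x; apply: tens_bound => t /=; first [exact: hat_le1|exact: dhat_le].
- apply: (@L1_mul_bounded _ _ (h0^-1 * 1 * 1)) => //; first by apply: meas_tens => /=.
  by move=> x; apply: tens_bound => t /=; first [exact: hat_le1|exact: dhat_le].
- apply: (@L1_mul_bounded _ _ (1 * h1^-1 * 1)) => //; first by apply: meas_tens => /=.
  by move=> x; apply: tens_bound => t /=; first [exact: hat_le1|exact: dhat_le].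
- apply: (@L1_mul_bounded _ _ (1 * 1 * h2^-1)) => //; first by apply: meas_tens => /=.
  by move=> x; apply: tens_bound => t /=; first [exact: hat_le1|exact: dhat_le].
Qed.

(** The weights [1], [1/2], [1/2] sum to [2], so at least one of the three values reaches half of
    the bound. *)
Lemma refine_pick (S : R -> R) (h a K : R) : 0 < h ->
  K <= `|S a + 2^-1 * S (a - h / 2) + 2^-1 * S (a + h / 2)| ->
  exists2 a', `|a' - a| <= h / 2 & K / 2 <= `|S a'|.
Proof.
move=> h0 HK.
have [H0|H0] := leP (K / 2) `|S a|; first by exists a => //; rewrite subrr normr0; lra.
have [H1|H1] := leP (K / 2) `|S (a - h / 2)|.
  by exists (a - h / 2) => //; rewrite addrC addKr normrN ger0_norm//; lra.
exists (a + h / 2); first by rewrite addrC addKr ger0_norm//; lra.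
move: HK; have := ler_normD (S a + 2^-1 * S (a - h / 2)) (2^-1 * S (a + h / 2)).
have := ler_normD (S a) (2^-1 * S (a - h / 2)).
rewrite !normrM (_ : `|2^-1| = 2^-1 :> R); last by rewrite gtr0_norm// invr_gt0.
lra.
Qed.

Let has_T h0 h1 h2 a0 a1 a2 (p0 : 0 < h0) (p1 : 0 < h1) (p2 : 0 < h2) :
  has_int3 (tented f V (tent h0 a0) (tent h1 a1) (tent h2 a2))
           (T (tent h0 a0) (tent h1 a1) (tent h2 a2)).
Proof. by split => //; exact: L1_tented. Qed.

Lemma T_refine0 h0 h1 h2 a0 a1 a2 : 0 < h0 -> 0 < h1 -> 0 < h2 ->
  let S a := T (tent (h0 / 2) a) (tent h1 a1) (tent h2 a2) in
  T (tent h0 a0) (tent h1 a1) (tent h2 a2) =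
  S a0 + 2^-1 * S (a0 - h0 / 2) + 2^-1 * S (a0 + h0 / 2).
Proof.
move=> p0 p1 p2 S; have q0 : 0 < h0 / 2 by rewrite divr_gt0.
have HS a : has_int3 (tented f V (tent (h0 / 2) a) (tent h1 a1) (tent h2 a2)) (S a).
  exact: has_T.
have := has_int3D (has_int3D (HS a0) (has_int3Z 2^-1 (HS (a0 - h0 / 2))))
   (has_int3Z 2^-1 (HS (a0 + h0 / 2))).
case=> _ <-; apply: (f_equal (@RInt3 R)); apply/funext => x.
rewrite /tented /tent /tens /= (hat_refine a0 _ p0) (dhat_refine a0 _ p0).
by ring.
Qed.

Lemma T_refine1 h0 h1 h2 a0 a1 a2 : 0 < h0 -> 0 < h1 -> 0 < h2 ->
  let S a := T (tent h0 a0) (tent (h1 / 2) a) (tent h2 a2) in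
  T (tent h0 a0) (tent h1 a1) (tent h2 a2) =
  S a1 + 2^-1 * S (a1 - h1 / 2) + 2^-1 * S (a1 + h1 / 2).
Proof.
move=> p0 p1 p2 S; have q0 : 0 < h1 / 2 by rewrite divr_gt0.
have HS a : has_int3 (tented f V (tent h0 a0) (tent (h1 / 2) a) (tent h2 a2)) (S a).
  exact: has_T.
have := has_int3D (has_int3D (HS a1) (has_int3Z 2^-1 (HS (a1 - h1 / 2))))
   (has_int3Z 2^-1 (HS (a1 + h1 / 2))).
case=> _ <-; apply: (f_equal (@RInt3 R)); apply/funext => x.
rewrite /tented /tent /tens /= (hat_refine a1 _ p1) (dhat_refine a1 _ p1).
by ring.
Qed.

Lemma T_refine2 h0 h1 h2 a0 a1 a2 : 0 < h0 -> 0 < h1 -> 0 < h2 ->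
  let S a := T (tent h0 a0) (tent h1 a1) (tent (h2 / 2) a) in
  T (tent h0 a0) (tent h1 a1) (tent h2 a2) =
  S a2 + 2^-1 * S (a2 - h2 / 2) + 2^-1 * S (a2 + h2 / 2).
Proof.
move=> p0 p1 p2 S; have q0 : 0 < h2 / 2 by rewrite divr_gt0.
have HS a : has_int3 (tented f V (tent h0 a0) (tent h1 a1) (tent (h2 / 2) a)) (S a).
  exact: has_T.
have := has_int3D (has_int3D (HS a2) (has_int3Z 2^-1 (HS (a2 - h2 / 2))))
   (has_int3Z 2^-1 (HS (a2 + h2 / 2))).
case=> _ <-; apply: (f_equal (@RInt3 R)); apply/funext => x.
rewrite /tented /tent /tens /= (hat_refine a2 _ p2) (dhat_refine a2 _ p2).
by ring.
Qed.

Let T3 (h : R) (c : V3) := T (tent h (c 0 0)) (tent h (c 0 1)) (tent h (c 0 (1 + 1))).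

(** The coordinates are halved one after the other, each at the cost of a factor [2]. The total [8]
    is the ratio of the volumes, so the size relative to the volume is not lost. *)
Lemma refine_step h (c : V3) K : 0 < h -> K <= `|T3 h c| ->
  exists2 c' : V3, forall i, `|c' 0 i - c 0 i| <= h / 2 & K / 8 <= `|T3 (h / 2) c'|.
Proof.
move=> h0; have h20 : 0 < h / 2 by rewrite divr_gt0.
rewrite /T3 T_refine0//.
move=> /(@refine_pick (fun a => T (tent (h / 2) a) _ _) _ _ _ h0)[a0 A0].
rewrite T_refine1//.
move=> /(@refine_pick (fun a => T _ (tent (h / 2) a) _) _ _ _ h0)[a1 A1].
rewrite T_refine2//.
move=> /(@refine_pick (fun a => T _ _ (tent (h / 2) a)) _ _ _ h0)[a2 A2] HK.
exists (vec3 (a0, a1, a2)); first by apply: I3P; rewrite mxE.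
by rewrite !mxE /=; lra.
Qed.

(** The divergence theorem for an affine field, by explicit integration. A constant or off-diagonal
    term contains the integral of a slope, which is [0]; a diagonal term contains its first moment
    [- h], and the three of them cancel the trace term. *)
Lemma tented_affine h (c : V3) (K : 'I_3 -> R) (D : 'I_3 -> 'I_3 -> R) : 0 < h ->
  has_int3 (tented (fun=> \sum_(i < 3) D i i)
      (fun i y => K i + \sum_(j < 3) (y 0 j - c 0 j) * D i j)
      (tent h (c 0 0)) (tent h (c 0 1)) (tent h (c 0 (1 + 1)))) 0.
Proof.
move=> h0.
have H i := hat_integral (c 0 i) h0.
have dH i := dhat_integral (c 0 i) h0.
have eH i := Mdhat_integral (c 0 i) h0.
have mH i := Mhat_integrable (c 0 i) h0.
pose Q (u0 u1 u2 : R -> R) v := has_int3 (tens u0 u1 u2) v.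
have HQ (u0 u1 u2 : R -> R) v0 v1 v2 : I1 u0 /\ int1 u0 = v0 -> I1 u1 /\ int1 u1 = v1 ->
    I1 u2 /\ int1 u2 = v2 -> Q u0 u1 u2 (v0 * v1 * v2).
  by move=> [i0 <-] [i1 <-] [i2 <-]; exact: has_int3_tens.
(* The first moment of the tent needs no value: wherever it occurs, it is multiplied by the
   vanishing integral of a slope. *)
pose m i := int1 (fun t => (t - c 0 i) * hat h (c 0 i) t).
have {}mH i : I1 (fun t => (t - c 0 i) * hat h (c 0 i) t) /\
  int1 (fun t => (t - c 0 i) * hat h (c 0 i) t) = m i by [].
have t0 := has_int3Z (\sum_(i < 3) D i i) (HQ _ _ _ _ _ _ (H 0) (H 1) (H (1 + 1))).
have r0 := has_int3D (has_int3Z (K 0) (HQ _ _ _ _ _ _ (dH 0) (H 1) (H (1 + 1))))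
  (has_int3D (has_int3D (has_int3Z (D 0 0) (HQ _ _ _ _ _ _ (eH 0) (H 1) (H (1 + 1))))
   (has_int3Z (D 0 1) (HQ _ _ _ _ _ _ (dH 0) (mH 1) (H (1 + 1)))))
   (has_int3Z (D 0 (1 + 1)) (HQ _ _ _ _ _ _ (dH 0) (H 1) (mH (1 + 1))))).
have r1 := has_int3D (has_int3Z (K 1) (HQ _ _ _ _ _ _ (H 0) (dH 1) (H (1 + 1))))
  (has_int3D (has_int3D (has_int3Z (D 1 0) (HQ _ _ _ _ _ _ (mH 0) (dH 1) (H (1 + 1))))
   (has_int3Z (D 1 1) (HQ _ _ _ _ _ _ (H 0) (eH 1) (H (1 + 1)))))
   (has_int3Z (D 1 (1 + 1)) (HQ _ _ _ _ _ _ (H 0) (dH 1) (mH (1 + 1))))).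
have r2 := has_int3D (has_int3Z (K (1 + 1)) (HQ _ _ _ _ _ _ (H 0) (H 1) (dH (1 + 1))))
  (has_int3D (has_int3D (has_int3Z (D (1 + 1) 0) (HQ _ _ _ _ _ _ (mH 0) (H 1) (dH (1 + 1))))
   (has_int3Z (D (1 + 1) 1) (HQ _ _ _ _ _ _ (H 0) (mH 1) (dH (1 + 1)))))
   (has_int3Z (D (1 + 1) (1 + 1)) (HQ _ _ _ _ _ _ (H 0) (H 1) (eH (1 + 1))))).
apply: has_int3_eq (has_int3D (has_int3D (has_int3D t0 r0) r1) r2) _ _.
  by move=> x; rewrite /tented /tent /tens !sum3E /=; ring.
by rewrite !sum3E; ring.
Qed.

(** The affine expansion at [c] integrates to [0], so only the error remains. It is at most [e] for
    [f] and at most [6 * e * h] for each component, against a slope bounded by [1 / h]. Hence the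
    integrand is at most [19 * e] on a cube of volume [8 * h ^+ 3], and [152 = 19 * 8]. *)
Lemma local_estimate (c : V3) e : 0 < e -> exists2 d, 0 < d &
  forall h (c' : V3), 0 < h -> 2 * h < d -> (forall i, `|c' 0 i - c 0 i| <= h) ->
    `|T3 h c'| <= 152 * e * h ^+ 3.
Proof.
move=> e0.
have [d0 d00 H0] := differentiable_local (dV 0 c) e0.
have [d1 d10 H1] := differentiable_local (dV 1 c) e0.
have [d2 d20 H2] := differentiable_local (dV (1 + 1) c) e0.
have /cvgrPdist_lt/(_ e e0)/nbhs3P[d3 d30 H3] := @cf c.
exists (Num.min (Num.min d0 d1) (Num.min d2 d3)); first by rewrite !lt_min d00 d10 d20 d30.
move=> h c' h0; rewrite !lt_min => /andP[/andP[l0 l1] /andP[l2 l3]] cc'.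
pose D i j := 'D_(ev3 R j) (V i) c.
(* [A] is the affine expansion of [V] at [c], rewritten around the centre [c'] of the tent as
   [tented_affine] wants it. *)
pose K i := V i c + \sum_(j < 3) (c' 0 j - c 0 j) * D i j.
pose A i (y : V3) := K i + \sum_(j < 3) (y 0 j - c' 0 j) * D i j.
have AE i y : A i y = V i c + \sum_(j < 3) (y 0 j - c 0 j) * D i j.
  rewrite /A /K -addrA -big_split; congr (_ + _); apply: eq_bigr => j _ /=.
  by rewrite -mulrDl addrC subrKA.
have [LA IA] := tented_affine c' K D h0.
rewrite -/A -[\sum_(i < 3) D i i]fE in LA IA.
have LT := L1_tented (c' 0 0) (c' 0 1) (c' 0 (1 + 1)) h0 h0 h0.
have HB i := box_integral (c' 0 i) h0.
have [LB IB] := has_int3Z (19 * e) (has_int3_tens (HB 0).1 (HB 1).1 (HB (1 + 1)).1).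
rewrite (HB 0).2 (HB 1).2 (HB (1 + 1)).2 in IB.
rewrite -[T3 h c']subr0 -IA -RInt3B//.
have -> : 152 * e * h ^+ 3 = 19 * e * (2 * h * (2 * h) * (2 * h)) by ring.
rewrite -IB; apply: RInt3_norm_le => // [|y]; first exact: L1B.
rewrite /tented /tent /tens /=.
set k0 := hat h _ _; set k1 := hat h _ _; set k2 := hat h _ _.
set g0 := dhat h _ _; set g1 := dhat h _ _; set g2 := dhat h _ _.
have K0' : `|k0| <= box h (c' 0 0) (y 0 0) by exact: hat_box.
have K1' : `|k1| <= box h (c' 0 1) (y 0 1) by exact: hat_box.
have K2' : `|k2| <= box h (c' 0 (1 + 1)) (y 0 (1 + 1)) by exact: hat_box.
have G0 : `|g0| <= h^-1 * box h (c' 0 0) (y 0 0) by exact: dhat_box.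
have G1 : `|g1| <= h^-1 * box h (c' 0 1) (y 0 1) by exact: dhat_box.
have G2 : `|g2| <= h^-1 * box h (c' 0 (1 + 1)) (y 0 (1 + 1)) by exact: dhat_box.
have zero (k g b : R) : b = 0 -> `|k| <= b -> `|g| <= h^-1 * b -> k = 0 /\ g = 0.
  by move=> ->; rewrite mulr0 !normr_le0 => /eqP -> /eqP ->.
have rhs0 : 0 <= 19 * e * (box h (c' 0 0) (y 0 0) * box h (c' 0 1) (y 0 1) *
    box h (c' 0 (1 + 1)) (y 0 (1 + 1))).
  by rewrite !mulr_ge0 ?(ltW e0)//; case: (box_le1 h _ _).
(* Outside the cube some tent vanishes together with its slope, and both integrands are [0]; inside,
   all three boxes equal [1]. *)
have [b0|/[dup] b0 /box_supp s0] := eqVneq (box h (c' 0 0) (y 0 0)) 0.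
  have [-> ->] := zero _ _ _ b0 K0' G0.
  by rewrite !(mul0r, mulr0, addr0) subrr normr0.
have [b1|/[dup] b1 /box_supp s1] := eqVneq (box h (c' 0 1) (y 0 1)) 0.
  have [-> ->] := zero _ _ _ b1 K1' G1.
  by rewrite !(mul0r, mulr0, addr0) subrr normr0.
have [b2|/[dup] b2 /box_supp s2] := eqVneq (box h (c' 0 (1 + 1)) (y 0 (1 + 1))) 0.
  have [-> ->] := zero _ _ _ b2 K2' G2.
  by rewrite !(mul0r, mulr0, addr0) subrr normr0.
have box1 (a t : R) : box h a t != 0 -> box h a t = 1.
  by rewrite /box indicE; case: (_ \in _); rewrite ?eqxx.
move: K0' K1' K2' G0 G1 G2; rewrite (box1 _ _ b0) (box1 _ _ b1) (box1 _ _ b2) !mulr1 => K0' K1' K2' G0 G1 G2.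
have yc i : `|y 0 i - c 0 i| <= 2 * h.
  have ys : `|y 0 i - c' 0 i| <= h by move: i; exact: I3P.
  have -> : y 0 i - c 0 i = (y 0 i - c' 0 i) + (c' 0 i - c 0 i) by rewrite addrA subrK.
  by rewrite (le_trans (ler_normD _ _))// mulr_natl mulr2n lerD.
have S6 : \sum_(i < 3) `|y 0 i - c 0 i| <= 6 * h.
  by rewrite sum3E (_ : 6 * h = 2 * h + 2 * h + 2 * h); [rewrite !lerD|ring].
have F3 : `|f y - f c| <= e.
  by rewrite distrC; apply/ltW/H3 => i; exact: le_lt_trans (yc i) l3.
have V0 : `|V 0 y - A 0 y| <= e * (6 * h).
  rewrite AE opprD addrA; apply: (le_trans (H0 y _)); last by rewrite ler_wpM2l ?(ltW e0).
  by move=> i; exact: le_lt_trans (yc i) l0.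
have V1 : `|V 1 y - A 1 y| <= e * (6 * h).
  rewrite AE opprD addrA; apply: (le_trans (H1 y _)); last by rewrite ler_wpM2l ?(ltW e0).
  by move=> i; exact: le_lt_trans (yc i) l1.
have V2 : `|V (1 + 1) y - A (1 + 1) y| <= e * (6 * h).
  rewrite AE opprD addrA; apply: (le_trans (H2 y _)); last by rewrite ler_wpM2l ?(ltW e0).
  by move=> i; exact: le_lt_trans (yc i) l2.
have e1 : `|(f y - f c) * (k0 * k1 * k2)| <= e * (1 * 1 * 1).
  by rewrite !normrM; do 3 apply: ler_pM => //; rewrite ?mulr_ge0.
have e2 : `|(V 0 y - A 0 y) * (g0 * k1 * k2)| <= e * (6 * h) * (h^-1 * 1 * 1).
  by rewrite !normrM; do 3 apply: ler_pM => //; rewrite ?mulr_ge0.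
have e3 : `|(V 1 y - A 1 y) * (k0 * g1 * k2)| <= e * (6 * h) * (1 * h^-1 * 1).
  by rewrite !normrM; do 3 apply: ler_pM => //; rewrite ?mulr_ge0.
have e4 : `|(V (1 + 1) y - A (1 + 1) y) * (k0 * k1 * g2)| <= e * (6 * h) * (1 * 1 * h^-1).
  by rewrite !normrM; do 3 apply: ler_pM => //; rewrite ?mulr_ge0.
rewrite (_ : _ - _ = (f y - f c) * (k0 * k1 * k2) + (V 0 y - A 0 y) * (g0 * k1 * k2) +
  (V 1 y - A 1 y) * (k0 * g1 * k2) + (V (1 + 1) y - A (1 + 1) y) * (k0 * k1 * g2)); last first.
  by ring.
have E : 19 * e = e * (1 * 1 * 1) + e * (6 * h) * (h^-1 * 1 * 1) +
   e * (6 * h) * (1 * h^-1 * 1) + e * (6 * h) * (1 * 1 * h^-1).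
  by field; rewrite lt0r_neq0.
rewrite E.
by apply: (le_trans (ler_normD _ _)); apply: lerD => //;
   apply: (le_trans (ler_normD _ _)); apply: lerD => //;
   apply: (le_trans (ler_normD _ _)); apply: lerD.
Qed.

Lemma nested_intervals (a b : nat -> R) :
  (forall n, a n <= a n.+1) -> (forall n, b n.+1 <= b n) -> (forall n, a n <= b n) ->
  exists x, forall n, a n <= x <= b n.
Proof.
move=> aI bD ab.
have aM m n : (m <= n)%N -> a m <= a n by move/(homo_leq (@lexx _ _) (@le_trans _ _) aI).
have bM m n : (m <= n)%N -> b n <= b m.
  by apply: (homo_leq (r := fun x y => y <= x)) => // x y z xy yz; exact: le_trans yz xy.
have abmn m n : a m <= b n.
  by rewrite (le_trans (aM _ (maxn m n) (leq_maxl _ _)))// (le_trans (ab _))// bM// leq_maxr.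
exists (sup [set a n | n in setT]) => n; apply/andP; split.
  by apply: ub_le_sup; [exists (b 0%N) => _ [k _ <-]|exists n].
by apply: ge_sup; [exists (a 0%N), 0%N|move=> _ [k _ <-]].
Qed.

(* Goursat's bisection argument: a tent on which [T3] is large relative to its volume
   contains a tent of half the size with the same property. *)
Lemma T3_eq0 h (c : V3) : 0 < h -> T3 h c = 0.
Proof.
move=> h0; apply: contrapT => /eqP; rewrite -normr_gt0; set K := `|_| => K0.
pose hn n := h / 2 ^+ n.
have hn0 n : 0 < hn n by rewrite divr_gt0// exprn_gt0.
have hnS n : hn n / 2 = hn n.+1.
  by rewrite /hn exprS; field; rewrite expf_neq0.
pose ok (p : nat * V3) := K / 8 ^+ p.1 <= `|T3 (hn p.1) p.2|.
(* The clause on sizes is conditional on [ok p], so that every pair has a successor and dependent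
   choice applies; [ok] is then propagated by induction. *)
pose Rel (p q : nat * V3) := q.1 = p.1.+1 /\ (ok p -> ok q /\
  forall i, `|q.2 0 i - p.2 0 i| <= hn q.1).
have tot p : {q | Rel p q}.
  apply: cid; case: p => n x.
  have [okx|nok] := pselect (ok (n, x)); last by exists (n.+1, x); split => // /nok.
  have [x' xx' Kx'] := refine_step (hn0 n) okx.
  exists (n.+1, x'); split => // _; split; last by move=> i; rewrite -hnS; exact: xx'.
  rewrite /ok /= -hnS; apply: le_trans Kx'.
  by rewrite exprSr invfM mulrA.
have [u [u0 uS]] := dependent_choice tot (0%N, c).
have u1 n : (u n).1 = n.
  by elim: n => [|n IH]; [rewrite u0|case: (uS n) => -> _; rewrite IH].
have uok n : ok (u n).
  elim: n => [|n IH]; last by case: (uS n) => _ /(_ IH)[].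
  by rewrite u0 /ok /= /hn !expr0 !divr1.
have ustep n i : `|(u n.+1).2 0 i - (u n).2 0 i| <= hn n.+1.
  by case: (uS n) => _ /(_ (uok n))[_ /(_ i)]; rewrite u1.
(* A centre moves by at most [hn n.+1], which is half of [hn n], so the intervals of radius [hn n]
   around the centres are nested. *)
have lim i : exists x, forall n, (u n).2 0 i - hn n <= x <= (u n).2 0 i + hn n.
  by apply: nested_intervals => n; have := ustep n i; have := hn0 n; have := hnS n;
     rewrite ler_norml => ? ? /andP[]; lra.
have [x Hx] := choice lim.
pose cx : V3 := \row_i x i.
(* With [153] in place of the [152] of [local_estimate], the upper bound at stage [n] is [152 / 153]
   of the lower bound [K / 8 ^+ n], a contradiction as [K] is positive. *)
pose e := K / (153 * h ^+ 3).
have h30 : 0 < h ^+ 3 by rewrite exprn_gt0.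
have e0 : 0 < e by rewrite divr_gt0// mulr_gt0.
have [d d0 Hd] := local_estimate cx e0.
have [n nd] : exists n, 2 * hn n < d.
  have := cvg_geometric (2 * h) (z := 2^-1 : R).
  rewrite ger0_norm ?invr_ge0// invf_lt1 ?ltr1n// => /(_ isT).
  move=> /cvgrPdist_lt/(_ d d0)[n _ /(_ n (leqnn _))] /=.
  rewrite sub0r normrN exprVn ger0_norm ?mulr_ge0 ?invr_ge0 ?exprn_ge0 ?ltW// => H.
  by exists n; rewrite /hn mulrA.
have := Hd (hn n) (u n).2 (hn0 n) nd.
have ucx i : `|(u n).2 0 i - cx 0 i| <= hn n.
  by rewrite mxE ler_norml; have /andP[] := Hx i n; move=> *; apply/andP; split; lra.
move=> /(_ ucx); apply/negP; rewrite -ltNge.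
have := uok n; rewrite /ok u1; apply: lt_le_trans.
have -> : 152 * e * hn n ^+ 3 = (152 / 153) * (K / 8 ^+ n).
  rewrite /e /hn expr_div_n -exprM mulnC exprM (_ : 2 ^+ 3 = 8 :> R); last by rewrite -natrX.
  by field; rewrite !expf_neq0 ?lt0r_neq0.
have : 0 < K / 8 ^+ n by rewrite divr_gt0// exprn_gt0.
lra.
Qed.

Lemma hat_cvg1 (t : R) : hat n.+1%:R 0 t @[n --> \oo] --> (1 : R).
Proof.
apply/cvgrPdist_le => e e0; near=> n.
have n0 : 0 < n.+1%:R :> R by [].
have : `|t| + `|t| / e < n.+1%:R.
  by apply: (@lt_trans _ _ n%:R); [near: n; exact: nbhs_infty_gtr|rewrite ltr_nat].
have te : 0 <= `|t| / e by rewrite divr_ge0// ltW.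
move=> tn; have t1 : `|t| < n.+1%:R by lra.
have t2 : `|t| / n.+1%:R <= e.
  by rewrite ler_pdivrMr// mulrC -ler_pdivrMr//; have := normr_ge0 t; lra.
move: t1; rewrite ltr_norml => /andP[t3 t4].
rewrite /hat !indicE !mem_setE !in_itv /= sub0r add0r subr0 t4 (ltW t3) /= andbT.
case: (leP 0 t) t2 => t5.
  by rewrite ger0_norm// mulr0 mulr1 add0r opprB addrC subrK ger0_norm// divr_ge0.
rewrite ltr0_norm// mulNr mulr0 mulr1 addr0 opprD addrA subrr sub0r normrN.
by rewrite ler0_norm// mulr_le0_ge0 ?ltW ?invr_ge0.
Unshelve. all: by end_near. Qed.

Lemma dhat_cvg0 (t : R) : dhat n.+1%:R 0 t @[n --> \oo] --> (0 : R).
Proof.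
apply: norm_cvg0; apply: (squeeze_cvgr _ (cvg_cst 0) (@cvg_harmonic R)).
by apply: nearW => n; rewrite normr_ge0 /= dhat_le.
Qed.

(** Tents of width [n.+1] tend to [1] pointwise and their slopes, at most [1 / n.+1], tend to [0].
    Since [f] and [V] are integrable, dominated convergence carries the vanishing of the tented
    integrals to that of [f]. *)
Lemma divergence_theorem : RInt3 f = 0.
Proof.
pose p n := tent n.+1%:R 0.
pose F n := tented f V (p n) (p n) (p n).
have n0 n : 0 < n.+1%:R :> R by [].
have F0 n : RInt3 (F n) = 0.
  by have := T3_eq0 0 (n0 n); rewrite /T3 !mxE.
have G : L1 (fun x => `|f x| + `|V 0 x| + `|V 1 x| + `|V (1 + 1) x|).
  by do 3 (apply: L1D; last exact: L1_norm); exact: L1_norm.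
have : RInt3 (F n) @[n --> \oo] --> RInt3 f.
  apply: (RInt3_cvg _ G) => [n|x|n x]; first by apply: L1_meas; exact: L1_tented.
    have c1 i : (p n).1 (x 0 i) @[n --> \oo] --> (1 : R) by exact: hat_cvg1.
    have c0 i : (p n).2 (x 0 i) @[n --> \oo] --> (0 : R) by exact: dhat_cvg0.
    have -> : f x = f x * (1 * 1 * 1) + V 0 x * (0 * 1 * 1) + V 1 x * (1 * 0 * 1) +
      V (1 + 1) x * (1 * 1 * 0) by ring.
    have tc (a b c : nat -> R) (A B C : R) g : a n @[n --> \oo] --> A -> b n @[n --> \oo] --> B ->
      c n @[n --> \oo] --> C -> g * (a n * b n * c n) @[n --> \oo] --> g * (A * B * C).
      by move=> ? ? ?; apply: cvgM; [exact: cvg_cst|apply: cvgM => //; exact: cvgM].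
    by apply: cvgD; [apply: cvgD; [apply: cvgD|]|]; apply: tc.
  have h1 t : `|(p n).1 t| <= 1 by exact: hat_le1.
  have d1 t : `|(p n).2 t| <= 1.
    by apply: le_trans (dhat_le _ _ _) _ => //; rewrite invf_le1// ler1n.
  have tb g u0 u1 u2 : (forall t, `|u0 t| <= 1) -> (forall t, `|u1 t| <= 1) ->
      (forall t, `|u2 t| <= 1) -> `|g * tens u0 u1 u2 x| <= `|g|.
    move=> b0 b1 b2; rewrite normrM ler_piMr// -[leRHS](mulr1 1) -{1}[1](mulr1 1).
    exact: tens_bound.
  rewrite /F /tented.
  by do 3 (apply: (le_trans (ler_normD _ _)); apply: lerD; last exact: tb); exact: tb.
under eq_fun do rewrite F0.
by move/(cvg_unique _ (cvg_cst 0)) => ->.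
Qed.

End DivergenceTheorem.

(** * Gaussian integrals *)

Section Gaussian.
Variable R : realType.
Local Notation V3 := (pt3 R).
Implicit Types (s t : R) (x y k : V3).

Definition gauss1 s m t : R := expR (- (s ^+ 2 * (t - m) ^+ 2)).

(** A multiple of the normal density with standard deviation [g = 1 / (s * sqrt 2)], for which
    [2 * g ^+ 2 = 1 / s ^+ 2]; the value follows from total mass [1]. *)
Lemma gauss1_integral s m : 0 < s ->
  I1 (gauss1 s m) /\ int1 (gauss1 s m) = Num.sqrt pi / s.
Proof.
move=> s0; pose g := (s * Num.sqrt 2)^-1 : R.
have r20 : 0 < Num.sqrt 2 :> R by rewrite sqrtr_gt0.
have r2 : Num.sqrt 2 ^+ 2 = 2 :> R by rewrite sqr_sqrtr.
have g0 : 0 < g by rewrite invr_gt0 mulr_gt0.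
have g2 : g ^+ 2 *+ 2 = (s ^+ 2)^-1.
  by rewrite -mulr_natl /g exprVn exprMn r2; field; rewrite lt0r_neq0.
have pk : (normal_peak g)^-1 = Num.sqrt pi / s.
  rewrite /normal_peak invrK -mulrnAl g2.
  by rewrite sqrtrM ?invr_ge0 ?sqr_ge0// sqrtrV ?sqr_ge0// sqrtr_sqr gtr0_norm// mulrC.
have E : gauss1 s m = fun t => (normal_peak g)^-1 * normal_pdf m g t.
  apply/funext => t; rewrite normal_pdfE ?lt0r_neq0// mulrA mulVf ?mul1r; last first.
    by rewrite lt0r_neq0// normal_peak_gt0// lt0r_neq0.
  by rewrite /gauss1 /normal_fun g2 invrK mulNr mulrC.
have ip := integrable_normal_pdf m g.
rewrite E; split; first exact: (integrableZl measurableT _ ip).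
rewrite /int1 RintegralZl//.
by rewrite /Rintegral integral_normal_pdf mulr1 pk.
Qed.

Definition sqd x y : R := \sum_(i < 3) (y 0 i - x 0 i) ^+ 2.
Definition gs s x y : R := expR (- (s ^+ 2 * sqd x y)).

Lemma sqd_ge0 x y : 0 <= sqd x y.
Proof. by apply: sumr_ge0 => i _; exact: sqr_ge0. Qed.

Lemma gs_gt0 s x y : 0 < gs s x y. Proof. exact: expR_gt0. Qed.
Lemma gs_ge0 s x y : 0 <= gs s x y. Proof. exact: expR_ge0. Qed.

Lemma gs_integral s x : 0 < s -> has_int3 (gs s x) ((Num.sqrt pi / s) ^+ 3).
Proof.
move=> s0; have H i := gauss1_integral (x 0 i) s0.
have := has_int3_tens (H 0).1 (H 1).1 (H (1 + 1)).1.
rewrite (H 0).2 (H 1).2 (H (1 + 1)).2 => /has_int3_eq; apply => [y|].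
  by rewrite /tens /gauss1 /gs /sqd sum3E !mulrDr !opprD !expRD.
by rewrite !exprS expr0 mulr1 mulrA.
Qed.

Lemma meas_sqd x : meas (sqd x).
Proof.
apply: meas_sum => i; rewrite (_ : (fun _ => _) = fun y : V3 => (y 0 i - x 0 i) * (y 0 i - x 0 i)).
  by apply: measM; apply: measB; [exact: meas_coord|exact: meas_cst|exact: meas_coord|exact: meas_cst].
by apply/funext => y; rewrite expr2.
Qed.

Lemma meas_gs s x : meas (gs s x).
Proof.
apply: meas_comp; first exact: measurable_expR.
by apply: measN; apply: measM; [exact: meas_cst|exact: meas_sqd].
Qed.

(* From [t <= expR t]: powers of the distance are absorbed by a wider Gaussian. *)
Lemma gs_absorb s x y : 0 < s ->
  (1 + sqd x y) ^+ 2 * gs s x y <= (1 + 8 / (3 * s ^+ 2)) ^+ 2 * gs (s / 2) x y.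
Proof.
move=> s0; have q0 := sqd_ge0 x y; have s20 : 0 < s ^+ 2 by rewrite exprn_gt0.
set q := sqd x y in q0 *; pose r := 3 * s ^+ 2 / 8 * q.
have r0 : 0 <= r by apply: mulr_ge0 => //; apply: divr_ge0 => //; apply: mulr_ge0 => //; exact: ltW.
have h1 : 1 + q <= (1 + 8 / (3 * s ^+ 2)) * expR r.
  rewrite mulrDl mul1r; apply: lerD.
    by rewrite -expR0 ler_expR.
  have -> : q = 8 / (3 * s ^+ 2) * r by rewrite /r; field; rewrite lt0r_neq0.
  apply: ler_wpM2l; first by apply: divr_ge0 => //; apply: mulr_ge0 => //; exact: ltW.
  by apply: le_trans (expR_ge1Dx r); rewrite lerDr.
have -> : gs (s / 2) x y = expR r ^+ 2 * gs s x y.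
  rewrite expr2 /gs -!expRD -/q /r; congr expR; by field.
rewrite mulrA -exprMn ler_wpM2r ?gs_ge0// ler_sqr ?nnegrE ?addr_ge0//.
apply: mulr_ge0 (expR_ge0 _); apply: addr_ge0 => //.
by apply: divr_ge0 => //; apply: mulr_ge0 => //; exact: ltW.
Qed.

Lemma sqdX2_ge1 x y : 1 + sqd x y <= (1 + sqd x y) ^+ 2.
Proof. by have q0 := sqd_ge0 x y; rewrite expr2 ler_peMr// ?addr_ge0// lerDl. Qed.

(** The one growth rate [(1 + sqd x y) ^+ 2] covers the weights met below: constants, coordinates
    and the squared distance itself. *)
Lemma L1_gsM s x u C : 0 < s -> meas u -> (forall y, `|u y| <= C * (1 + sqd x y) ^+ 2) ->
  L1 (fun y => u y * gs s x y).
Proof.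
move=> s0 mu uC.
have s20 : 0 < s / 2 by rewrite divr_gt0.
have [L _] := gs_integral x s20.
apply: L1_le (L1Z (`|C| * (1 + 8 / (3 * s ^+ 2)) ^+ 2) L) _.
  by apply: measM => //; exact: meas_gs.
move=> y; rewrite normrM (ger0_norm (gs_ge0 _ _ _)).
apply: le_trans (ler_wpM2r (gs_ge0 s x y) (uC y)) _.
rewrite -[leLHS]mulrA -[leRHS]mulrA; apply: (@le_trans _ _ (`|C| * ((1 + sqd x y) ^+ 2 * gs s x y))).
  by rewrite ler_wpM2r ?ler_norm// mulr_ge0 ?gs_ge0 ?sqr_ge0.
by rewrite ler_wpM2l//; exact: gs_absorb.
Qed.

Lemma L1_gs s x : 0 < s -> L1 (gs s x).
Proof. by move=> s0; case: (gs_integral x s0). Qed.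

Lemma coord_sqd x y i : `|y 0 i - x 0 i| <= 1 + sqd x y.
Proof.
have : (y 0 i - x 0 i) ^+ 2 <= sqd x y.
  by rewrite /sqd (bigD1 i)//= lerDl; apply: sumr_ge0 => j _; exact: sqr_ge0.
set u := y 0 i - x 0 i => h; apply: le_trans (lerD (lexx 1) h).
rewrite -[u ^+ 2]real_normK ?num_real//; have := sqr_ge0 (`|u| - 1); nra.
Qed.

Definition dgs s x y (i : 'I_3) : R := - (2 * s ^+ 2 * (y 0 i - x 0 i)) * gs s x y.

Lemma has_grad_shift x i : has_grad (fun y : V3 => y 0 i - x 0 i) (fun _ j => (j == i)%:R).
Proof.
have := has_gradB (has_grad_coord i) (has_grad_cst (x 0 i)).
by move/has_grad_eq; apply => y j; rewrite subr0.
Qed.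

Lemma has_grad_sqd x : has_grad (sqd x) (fun y j => 2 * (y 0 j - x 0 j)).
Proof.
have H i := has_gradM (has_grad_shift x i) (has_grad_shift x i).
apply: has_grad_eq (_ : has_grad (sqd x) (fun y j => \sum_(i < 3)
   ((y 0 i - x 0 i) * (j == i)%:R + (y 0 i - x 0 i) * (j == i)%:R))) _ => [|y j].
  by have := has_grad_sum (index_enum 'I_3) H.
rewrite (bigD1 j)//= big1 ?addr0 => [|i /negbTE ij]; first by rewrite eqxx mulr1; ring.
by rewrite eq_sym ij mulr0 addr0.
Qed.

Lemma has_grad_gs s x : has_grad (gs s x) (dgs s x).
Proof.
have := has_grad_comp (@is_derive_expR R) (has_gradZ (- s ^+ 2) (has_grad_sqd x)).
rewrite (_ : (fun x => _) = gs s x); last by apply/funext => y; rewrite /gs mulNr.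
by move/has_grad_eq; apply => y i; rewrite /dgs /gs mulNr; ring.
Qed.

Lemma has_grad_dgs s x i : has_grad (dgs s x ^~ i) (fun y j =>
  (4 * s ^+ 4 * (y 0 i - x 0 i) * (y 0 j - x 0 j) - 2 * s ^+ 2 * (j == i)%:R) * gs s x y).
Proof.
have := has_gradM (has_gradZ (- (2 * s ^+ 2)) (has_grad_shift x i)) (has_grad_gs s x).
rewrite (_ : (fun x0 => _) = dgs s x ^~ i); last by apply/funext => y; rewrite /dgs mulNr.
by move/has_grad_eq; apply => y j; rewrite /dgs; ring.
Qed.

End Gaussian.

(** * The Fourier transform of a Gaussian *)

Section GaussianFourier.
Variable R : realType.
Local Notation V3 := (pt3 R).
Implicit Types (s t : R) (x y k : V3).

Lemma divergence_theorem_grad (V : 'I_3 -> V3 -> R) dV (f : V3 -> R) :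
  (forall i, has_grad (V i) (dV i)) -> (forall x, f x = \sum_(i < 3) dV i x i) ->
  continuous f -> (forall i, L1 (V i)) -> L1 f -> RInt3 f = 0.
Proof.
move=> HV fE cf lV lf; apply: (@divergence_theorem _ V) => // [i x|x].
  by case: (HV i x).
by rewrite fE; apply: eq_bigr => i _; case: (HV i x) => _ ->.
Qed.

Lemma derivable_zero_cst (u : R -> R) (x y : R) : (forall t, is_derive t 1 u 0) -> u x = u y.
Proof. by move=> H; exact: is_derive_0_is_cst. Qed.

Definition dotd k x y : R := \sum_(i < 3) k 0 i * (y 0 i - x 0 i).

Lemma dotdE k x y : dotd k x y = dot3 k y - dot3 k x.
Proof. by rewrite /dotd /dot3 -sumrB; apply: eq_bigr => i _; rewrite mulrBr. Qed.

Lemma has_grad_dotd k x : has_grad (dotd k x) (fun _ i => k 0 i).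
Proof.
rewrite (_ : dotd k x = fun y => dot3 k y - dot3 k x); last by apply/funext => y; exact: dotdE.
by apply: has_grad_eq (has_gradB (has_grad_dot k) (has_grad_cst (dot3 k x))) _ => y i; rewrite subr0.
Qed.

Lemma dotd_bound k x y : `|dotd k x y| <= (\sum_(i < 3) `|k 0 i|) * (1 + sqd x y) ^+ 2.
Proof.
rewrite (le_trans (ler_norm_sum _ _ _))// mulr_suml; apply: ler_sum => i _.
by rewrite normrM ler_wpM2l// (le_trans (coord_sqd x y i))// sqdX2_ge1.
Qed.

Lemma one_sqd2 x y : 1 <= (1 + sqd x y) ^+ 2.
Proof. by rewrite (le_trans _ (sqdX2_ge1 x y))// lerDl sqd_ge0. Qed.

Lemma measurable_cos : measurable_fun setT (@cos R).
Proof. by apply: continuous_measurable_fun; exact: continuous_cos. Qed.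

Lemma measurable_sin : measurable_fun setT (@sin R).
Proof. by apply: continuous_measurable_fun; exact: continuous_sin. Qed.

Section Fixed.
Variables (s : R) (x k : V3) (th : R).
Hypothesis s0 : 0 < s.

Let w := dotd k x.
Let E (r : R) := RInt3 (fun y => gs s x y * cos (r * w y + th)).
Let kk := dot3 k k.

Let hg_arg r : has_grad (fun y => r * w y + th) (fun _ i => r * k 0 i).
Proof.
by apply: has_grad_eq (has_gradD (has_gradZ r (has_grad_dotd k x)) (has_grad_cst th)) _ => y i; rewrite addr0.
Qed.

Let mw : meas w.
Proof. exact: continuous_meas (has_grad_continuous (has_grad_dotd k x)). Qed.

Let m_arg r : meas (fun y => r * w y + th).
Proof. exact: continuous_meas (has_grad_continuous (hg_arg r)). Qed.

Let L1_cos r : L1 (fun y => gs s x y * cos (r * w y + th)).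
Proof.
by apply: (L1_mul_bounded (L1_gs x s0) (meas_comp measurable_cos (m_arg r))) => y; exact: cos_max.
Qed.

Let L1_sin r : L1 (fun y => gs s x y * sin (r * w y + th)).
Proof.
by apply: (L1_mul_bounded (L1_gs x s0) (meas_comp measurable_sin (m_arg r))) => y; exact: sin_max.
Qed.

Let L1_wg : L1 (fun y => w y * gs s x y).
Proof. by apply: (L1_gsM s0 mw) => y; exact: dotd_bound. Qed.

Let L1_w_sin r : L1 (fun y => w y * gs s x y * sin (r * w y + th)).
Proof.
by apply: (L1_mul_bounded L1_wg (meas_comp measurable_sin (m_arg r))) => y; exact: sin_max.
Qed.

(** The divergence theorem for the field with components [k_i * gs * sin (r * w + th)]. *)
Let parts r : 2 * s ^+ 2 * RInt3 (fun y => w y * gs s x y * sin (r * w y + th)) =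
  r * kk * E r.
Proof.
have hsin := has_grad_comp (@is_derive_sin R) (hg_arg r).
have hcos := has_grad_comp (@is_derive_cos R) (hg_arg r).
have hG := has_grad_gs s x.
have HV i := has_gradZ (k 0 i) (has_gradM hG hsin).
pose f y := - (2 * s ^+ 2) * (w y * gs s x y * sin (r * w y + th)) +
  (r * kk) * (gs s x y * cos (r * w y + th)).
have lf : L1 f by apply: L1D; [apply: L1Z; exact: L1_w_sin|apply: L1Z; exact: L1_cos].
have cf : continuous f.
  exact: has_grad_continuous (has_gradD
    (has_gradZ (- (2 * s ^+ 2)) (has_gradM (has_gradM (has_grad_dotd k x) hG) hsin))
    (has_gradZ (r * kk) (has_gradM hG hcos))).
have : RInt3 f = 0.
  apply: (divergence_theorem_grad HV) => // [y|i]; last by apply: L1Z; exact: L1_sin.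
  by rewrite /f /w /kk /dotd /dot3 !sum3E /dgs; ring.
rewrite /f RInt3D ?RInt3Z//; [|exact: L1Z|exact: L1Z].
by rewrite mulNr addrC => /eqP; rewrite subr_eq0 => /eqP <-.
Qed.

Let dE (r : R) : is_derive r 1 E (- (r * kk / (2 * s ^+ 2)) * E r).
Proof.
have s2 : s != 0 by rewrite lt0r_neq0.
have -> : - (r * kk / (2 * s ^+ 2)) * E r =
    RInt3 (fun y => - (w y * gs s x y * sin (r * w y + th))).
  rewrite RInt3N//; have := parts r; set J := RInt3 _ => pr.
  have -> : J = (2 * s ^+ 2 * J) / (2 * s ^+ 2) by field.
  by rewrite pr; field.
apply: (@is_derive_RInt3 _ (fun r y => gs s x y * cos (r * w y + th))
  (fun r y => - (w y * gs s x y * sin (r * w y + th))) (fun y => `|w y * gs s x y|) r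
  (r - 1) (r + 1)); rewrite ?ltrBlDr ?ltrDl//.
- move=> t y _; apply: is_derive_eq.
  by rewrite /GRing.scale /=; ring.
- exact: L1_norm.
- by move=> t y _; rewrite normrN normrM ler_piMr// sin_max.
Qed.

(** By [parts], differentiation under the integral gives the equation
    [E' = - (r * kk / (2 * s ^+ 2)) * E], so [E r * exp (r ^+ 2 * kk / (4 * s ^+ 2))] is constant;
    at [r = 0] it is the Gaussian integral times [cos th]. The phase [th] lets the cosine and the
    sine transform share one proof. *)
Lemma fourier_gs : has_int3 (fun y => gs s x y * cos (dotd k x y + th))
  ((Num.sqrt pi / s) ^+ 3 * expR (- (dot3 k k / (4 * s ^+ 2))) * cos th).
Proof.
have s2 : s != 0 by rewrite lt0r_neq0.
split; first by have := L1_cos 1; rewrite (_ : (fun y => _) = fun y => gs s x y * cos (dotd k x y + th)) //; apply/funext => y; rewrite mul1r.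
pose Z (r : R) := E r * expR (r ^+ 2 * (kk / (4 * s ^+ 2))).
have dZ (r : R) : is_derive r 1 Z 0.
  have dEr := dE r.
  rewrite /Z; apply: is_derive_eq; rewrite /GRing.scale /=.
  by field.
have := derivable_zero_cst 1 0 dZ; rewrite /Z expr1n mul1r expr0n /= mul0r expR0 mulr1.
have -> : E 0 = (Num.sqrt pi / s) ^+ 3 * cos th.
  have [L <-] := gs_integral x s0; rewrite mulrC -RInt3Z//.
  by apply: (f_equal (@RInt3 R)); apply/funext => y; rewrite mul0r add0r mulrC.
rewrite (_ : RInt3 _ = E 1); last first.
  by apply: (f_equal (@RInt3 R)); apply/funext => y; rewrite mul1r.
move=> H; rewrite mulrAC -H -mulrA -expRD /kk addrN expR0 mulr1 //.
Qed.

End Fixed.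

End GaussianFourier.

(** * Transforms of Gaussian derivatives and the approximate identity *)

Section ApproximateIdentity.
Variable R : realType.
Local Notation V3 := (pt3 R).
Implicit Types (s t : R) (x y k : V3).

Lemma dot3C (k y : V3) : dot3 k y = dot3 y k.
Proof. by apply: eq_bigr => i _; rewrite mulrC. Qed.

Lemma fourier_gs_cos s x k th : 0 < s ->
  has_int3 (fun y => gs s x y * cos (dot3 k y + th))
    ((Num.sqrt pi / s) ^+ 3 * expR (- (dot3 k k / (4 * s ^+ 2))) * cos (dot3 k x + th)).
Proof.
move=> s0; apply: has_int3_eq (fourier_gs x k (dot3 k x + th) s0) _ _ => // y.
by rewrite dotdE addrA subrK.
Qed.

Lemma fourier_gs_sin s x k th : 0 < s ->
  has_int3 (fun y => gs s x y * sin (dot3 k y + th))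
    ((Num.sqrt pi / s) ^+ 3 * expR (- (dot3 k k / (4 * s ^+ 2))) * sin (dot3 k x + th)).
Proof.
move=> s0; apply: has_int3_eq (fourier_gs_cos x k (th - pi / 2) s0) _ _ => [y|].
  by rewrite addrA cosBpihalf.
by rewrite addrA cosBpihalf.
Qed.

Lemma meas_dot k th : meas (fun y => dot3 k y + th).
Proof. by apply: measD; [exact: continuous_meas (has_grad_continuous (has_grad_dot k))|exact: meas_cst]. Qed.

Lemma L1_dgs s x j : 0 < s -> L1 (fun y => dgs s x y j).
Proof.
move=> s0; apply: (@L1_gsM _ s x (fun y => - (2 * s ^+ 2 * (y 0 j - x 0 j))) (2 * s ^+ 2)) => //.
  apply: measN; apply: measM; first exact: meas_cst.
  by apply: measB; [exact: meas_coord|exact: meas_cst].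
have c0 : 0 <= 2 * s ^+ 2 by apply: mulr_ge0 => //; exact: sqr_ge0.
move=> y; rewrite normrN normrM (ger0_norm c0); apply: ler_wpM2l => //.
by rewrite (le_trans (coord_sqd x y j))// sqdX2_ge1.
Qed.

(** The divergence theorem, for the field whose only nonzero component is the [j]-th one,
    [gs * cos], moves the derivative from the Gaussian to the cosine. *)
Lemma fourier_dgs s x k th j : 0 < s ->
  RInt3 (fun y => dgs s x y j * cos (dot3 k y + th)) =
  k 0 j * ((Num.sqrt pi / s) ^+ 3 * expR (- (dot3 k k / (4 * s ^+ 2))) * sin (dot3 k x + th)).
Proof.
move=> s0; have [Ls <-] := fourier_gs_sin x k th s0.
have [Lc _] := fourier_gs_cos x k th s0.
have hk : has_grad (fun y => dot3 k y + th) (fun _ i => k 0 i).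
  by apply: has_grad_eq (has_gradD (has_grad_dot k) (has_grad_cst th)) _ => y i; rewrite addr0.
have hsin := has_grad_comp (@is_derive_sin R) hk.
have hcos := has_grad_comp (@is_derive_cos R) hk.
have hG := has_grad_gs s x.
pose f y := dgs s x y j * cos (dot3 k y + th) - k 0 j * (gs s x y * sin (dot3 k y + th)).
have Ld : L1 (fun y => dgs s x y j * cos (dot3 k y + th)).
  by apply: (L1_mul_bounded (L1_dgs x j s0) (meas_comp (@measurable_cos R) (meas_dot k th))) => y; exact: cos_max.
have lf : L1 f by apply: L1B => //; exact: L1Z.
have cf : continuous f.
  exact: has_grad_continuous (has_gradB (has_gradM (has_grad_dgs s x j) hcos)
    (has_gradZ (k 0 j) (has_gradM hG hsin))).
have : RInt3 f = 0.
  apply: (@divergence_theorem_grad _ (fun i y => (i == j)%:R * (gs s x y * cos (dot3 k y + th)))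
    _ f (fun i => has_gradZ (i == j)%:R (has_gradM hG hcos))) => // [y|i]; last exact: L1Z.
  rewrite (bigD1 j)//= eqxx mul1r big1 ?addr0 => [|i /negbTE ->]; last by rewrite mul0r.
  by rewrite /f; ring.
by rewrite /f RInt3B ?RInt3Z// => [/eqP|]; [rewrite subr_eq0 => /eqP|exact: L1Z].
Qed.

Lemma gs_le s t x y : 0 < s -> s <= t -> gs t x y <= gs s x y.
Proof.
move=> s0 st; rewrite /gs ler_expR lerN2 ler_wpM2r ?sqd_ge0//.
by rewrite ler_sqr// nnegrE ltW// (lt_le_trans s0).
Qed.

(** With [r = ka * q / 2] the left side is [4 / ka ^+ 2] times the square of [r * exp (- r)], and
    [r * exp (- r) <= 1]. *)
Lemma sqd2_decay (ka q : R) : 0 < ka -> 0 <= q -> q ^+ 2 * expR (- (ka * q)) <= 4 / ka ^+ 2.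
Proof.
move=> k0 q0; have [r re] : exists r, r = ka * q / 2 by exists (ka * q / 2).
have r0 : 0 <= r by rewrite re; apply: divr_ge0 => //; apply: mulr_ge0 => //; exact: ltW.
have -> : q = 2 / ka * r by rewrite re; field; rewrite lt0r_neq0.
have -> : - (ka * (2 / ka * r)) = - r + - r by field; rewrite lt0r_neq0.
have h : r * expR (- r) <= 1.
  rewrite expRN ler_pdivrMr ?expR_gt0// mul1r (le_trans _ (expR_ge1Dx _))// lerDr //.
have h0 : 0 <= r * expR (- r) by apply: mulr_ge0 => //; exact: expR_ge0.
rewrite expRD; move: (expR (- r)) h h0 => E h h0.
rewrite [leLHS](_ : _ = 4 / ka ^+ 2 * ((r * E) * (r * E))); last first.
  by field; rewrite lt0r_neq0.
apply: ler_piMr; first by apply: divr_ge0 => //; exact: sqr_ge0.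
by rewrite -[leRHS](mulr1 1) ler_pM.
Qed.

(** Integrability is asked against one fixed Gaussian, because it is applied to a field that is only
    square integrable, and continuity only at [x], because amplitudes may jump at the origin. Away
    from [x], splitting off [gs s1] leaves a factor [exp (- ka * sqd)] with [ka] of order [s ^+ 2];
    by [sqd2_decay] it is of order [s ^- 4], which beats the prefactor [s ^+ 3]. *)
Lemma approximate_identity (f : V3 -> R) x s1 : 0 < s1 -> meas f ->
  L1 (fun y => f y * gs s1 x y) ->
  (forall e, 0 < e -> exists2 d, 0 < d &
     forall y, (forall i, `|y 0 i - x 0 i| < d) -> `|f y - f x| <= e) ->
  (n.+1%:R ^+ 3 : R) * RInt3 (fun y => f y * gs n.+1%:R x y) @[n --> \oo] -->
    Num.sqrt pi ^+ 3 * f x.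
Proof.
move=> s10 mf Lf cf.
pose w y := `|f y - f x|.
have wg0 y : 0 <= w y * gs s1 x y by apply: mulr_ge0; [exact: normr_ge0|exact: gs_ge0].
have Lw : L1 (fun y => w y * gs s1 x y).
  have L : L1 (fun y => f y * gs s1 x y - f x * gs s1 x y).
    by apply: L1B => //; apply: L1Z; exact: L1_gs.
  have := L1_norm L; congr L1; apply/funext => y.
  by rewrite -mulrBl normrM [`|gs _ _ _|]ger0_norm ?gs_ge0.
pose C := RInt3 (fun y => w y * gs s1 x y).
have C0 : 0 <= C by apply: RInt3_ge0.
pose p3 := Num.sqrt pi ^+ 3 : R.
have p30 : 0 < p3 by rewrite exprn_gt0// sqrtr_gt0 pi_gt0.
apply/cvgrPdist_le => e e0.
have [d d0 Hd] := cf (e / (2 * p3)) (divr_gt0 e0 (mulr_gt0 (ltr0n _ 2) p30)).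
near=> n.
pose s := n.+1%:R : R; have s0 : 0 < s by [].
have s2 : 2 * s1 <= s.
  by rewrite (@le_trans _ _ n%:R)// ?ler_nat//; near: n; exact: nbhs_infty_ger.
have nC : 16 * C / d ^+ 4 / e <= s.
  by rewrite (@le_trans _ _ n%:R)// ?ler_nat//; near: n; exact: nbhs_infty_ger.
have ss1 : s1 <= s by lra.
have Lfs : L1 (fun y => f y * gs s x y).
  apply: L1_le (L1_norm Lf) _ => [|y]; first by apply: measM => //; exact: meas_gs.
  by rewrite !normrM ler_wpM2l// !ger0_norm ?gs_ge0// gs_le.
have [Lg Ig] := gs_integral x s0.
rewrite -/s (_ : _ - _ = s ^+ 3 * RInt3 (fun y => (f x - f y) * gs s x y)); last first.
  rewrite (_ : (fun y => (f x - f y) * _) = fun y => f x * gs s x y - f y * gs s x y); last first.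
    by apply/funext => y; rewrite mulrBl.
  rewrite RInt3B ?RInt3Z ?Ig//; last exact: L1Z.
  by rewrite -/p3 expr_div_n -/p3; field; rewrite lt0r_neq0.
pose ka := s ^+ 2 - s1 ^+ 2.
have kaE : 3 / 4 * s ^+ 2 <= ka by rewrite /ka; nra.
have ka0 : 0 < ka by rewrite (lt_le_trans _ kaE)// mulr_gt0// exprn_gt0.
have d40 : 0 < d ^+ 4 by rewrite exprn_gt0.
have key y : `|(f x - f y) * gs s x y| <=
    e / (2 * p3) * gs s x y + 4 / ka ^+ 2 / d ^+ 4 * (w y * gs s1 x y).
  rewrite normrM (ger0_norm (gs_ge0 _ _ _)) distrC -/(w y).
  have [near_x|] := pselect (forall i, `|y 0 i - x 0 i| < d).
    apply: (@le_trans _ _ (e / (2 * p3) * gs s x y)).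
      by rewrite ler_wpM2r ?gs_ge0// Hd.
    rewrite lerDl; apply: mulr_ge0 => //.
    by rewrite !divr_ge0 ?sqr_ge0 ?(ltW d40).
  move/existsNP => [i /negP]; rewrite -leNgt => di.
  have q0 := sqd_ge0 x y.
  have dq : d ^+ 2 <= sqd x y.
    apply: (@le_trans _ _ ((y 0 i - x 0 i) ^+ 2)).
      by rewrite -[leRHS]real_normK ?num_real// ler_sqr ?nnegrE// ltW.
    by rewrite /sqd (bigD1 i)//= lerDl; apply: sumr_ge0 => j _; exact: sqr_ge0.
  have dq4 : d ^+ 4 <= sqd x y ^+ 2.
    by rewrite (exprM d 2 2) ler_sqr ?nnegrE// sqr_ge0.
  rewrite -[leLHS]add0r; apply: lerD.
    by apply: mulr_ge0; [apply: divr_ge0; [exact: ltW|rewrite mulr_ge0// ltW]|exact: gs_ge0].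
  have -> : gs s x y = expR (- (ka * sqd x y)) * gs s1 x y.
    by rewrite /gs -expRD /ka; congr expR; ring.
  rewrite mulrCA; apply: ler_wpM2r => //.
  rewrite ler_pdivlMr// (le_trans _ (sqd2_decay ka0 q0))// mulrC.
  by rewrite ler_wpM2r ?expR_ge0.
rewrite normrM (ger0_norm (exprn_ge0 _ (ltW s0))).
have Lr : L1 (fun y => e / (2 * p3) * gs s x y + 4 / ka ^+ 2 / d ^+ 4 * (w y * gs s1 x y)).
  by apply: L1D; exact: L1Z.
have Ll : L1 (fun y => (f x - f y) * gs s x y).
  apply: L1_le Lr key; apply: measM; last exact: meas_gs.
  by apply: measB => //; exact: meas_cst.
apply: (@le_trans _ _ (s ^+ 3 * RInt3 (fun y => e / (2 * p3) * gs s x y + 4 / ka ^+ 2 / d ^+ 4 * (w y * gs s1 x y)))).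
  by rewrite ler_wpM2l ?exprn_ge0 ?(ltW s0)//; exact: RInt3_norm_le.
rewrite RInt3D ?RInt3Z//; [|exact: L1Z|exact: L1Z].
rewrite Ig -/C expr_div_n -/p3.
have -> : s ^+ 3 * (e / (2 * p3) * (p3 / s ^+ 3) + 4 / ka ^+ 2 / d ^+ 4 * C) =
   e / 2 + s ^+ 3 * 4 / ka ^+ 2 * (C / d ^+ 4).
  by field; rewrite !lt0r_neq0// exprn_gt0.
rewrite [leRHS](splitr e) lerD2l.
(* From [s >= 2 * s1] comes [ka >= 3/4 * s ^+ 2], so the constant is at most [4 / (9/16) = 64/9],
   below [8]. *)
have h1 : s ^+ 3 * 4 / ka ^+ 2 <= 8 / s.
  rewrite ler_pdivrMr ?exprn_gt0// [leRHS]mulrAC ler_pdivlMr//.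
  have : (3 / 4 * s ^+ 2) ^+ 2 <= ka ^+ 2 by rewrite ler_sqr ?nnegrE ?(ltW ka0)// mulr_ge0 ?sqr_ge0.
  rewrite exprMn; set a := ka ^+ 2; have s4 : 0 <= s ^+ 4 by rewrite exprn_ge0// ltW.
  rewrite -exprM (_ : s ^+ 3 * 4 * s = 4 * s ^+ 4); last by ring.
  rewrite (_ : (2 * 2 = 4)%N)// (_ : (3 / 4) ^+ 2 = 9 / 16 :> R); last by field.
  by move=> ?; lra.
apply: (@le_trans _ _ (8 / s * (C / d ^+ 4))).
  by rewrite ler_wpM2r// divr_ge0// ltW.
move: nC; rewrite ler_pdivrMr// => nC.
have -> : 8 / s * (C / d ^+ 4) = (16 * C / d ^+ 4) / s / 2.
  by field; rewrite !lt0r_neq0.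
by rewrite ler_wpM2r// ler_pdivrMr// (le_trans nC)// mulrC.
Unshelve. all: by end_near. Qed.

End ApproximateIdentity.

(** * Divergence-free fields with a Fourier integral as curl *)

Section TrigIntegral.
Variable R : realType.
Local Notation V3 := (pt3 R).
Implicit Types (s t : R) (x y k : V3) (al ga : V3 -> R).

Lemma continuous_mul3 (f g : V3 -> R) : continuous f -> continuous g ->
  continuous (fun y => f y * g y).
Proof. by move=> cf cg y; exact: (@cvgM _ _ _ _ f g _ _ (cf y) (cg y)). Qed.

Lemma continuous_add3 (f g : V3 -> R) : continuous f -> continuous g ->
  continuous (fun y => f y + g y).
Proof. by move=> cf cg y; exact: (@cvgD _ _ _ _ _ f g _ _ (cf y) (cg y)). Qed.

Lemma continuous_sub3 (f g : V3 -> R) : continuous f -> continuous g ->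
  continuous (fun y => f y - g y).
Proof. by move=> cf cg y; exact: (@cvgB _ _ _ _ _ f g _ _ (cf y) (cg y)). Qed.

(** The real and the imaginary part of a complex Fourier integral both have this shape, which lets
    the analysis stay over the reals. *)
Definition trig al ga x k : R := al k * cos (dot3 k x) + ga k * sin (dot3 k x).
Definition FT al ga x : R := RInt3 (trig al ga x).

Lemma meas_cosdot x : meas (fun k => cos (dot3 k x)).
Proof.
rewrite (_ : (fun _ => _) = fun k => cos (dot3 x k + 0)); last first.
  by apply/funext => k; rewrite addr0 dot3C.
exact: (meas_comp (@measurable_cos R) (meas_dot x 0)).
Qed.

Lemma meas_sindot x : meas (fun k => sin (dot3 k x)).
Proof.
rewrite (_ : (fun _ => _) = fun k => sin (dot3 x k + 0)); last first.
  by apply/funext => k; rewrite addr0 dot3C.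
exact: (meas_comp (@measurable_sin R) (meas_dot x 0)).
Qed.

Lemma L1_mulcos al x : L1 al -> L1 (fun k => al k * cos (dot3 k x)).
Proof. by move=> la; apply: (L1_mul_bounded la (meas_cosdot x)) => k; exact: cos_max. Qed.

Lemma L1_mulsin al x : L1 al -> L1 (fun k => al k * sin (dot3 k x)).
Proof. by move=> la; apply: (L1_mul_bounded la (meas_sindot x)) => k; exact: sin_max. Qed.

Lemma L1_trig al ga x : L1 al -> L1 ga -> L1 (trig al ga x).
Proof. by move=> la lg; apply: L1D; [exact: L1_mulcos|exact: L1_mulsin]. Qed.

Lemma FTE al ga x : L1 al -> L1 ga -> FT al ga x =
  RInt3 (fun k => al k * cos (dot3 k x)) + RInt3 (fun k => ga k * sin (dot3 k x)).
Proof. by move=> la lg; rewrite /FT /trig RInt3D//; [exact: L1_mulcos|exact: L1_mulsin]. Qed.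

Lemma FT_bound al ga x : L1 al -> L1 ga ->
  `|FT al ga x| <= RInt3 (fun k => `|al k| + `|ga k|).
Proof.
move=> la lg; apply: RInt3_norm_le; first exact: L1_trig.
  by apply: L1D; exact: L1_norm.
move=> k; rewrite (le_trans (ler_normD _ _))// lerD// normrM ler_piMr//.
  exact: cos_max.
exact: sin_max.
Qed.

Lemma meas2_dot : meas2 (fun y k => dot3 k y).
Proof.
rewrite (_ : (fun _ _ => _) = fun y k => (k 0 0 * y 0 0 + k 0 1 * y 0 1) + k 0 (1 + 1) * y 0 (1 + 1)).
  by do 2 (try apply: meas2D); apply: meas2M; (apply: meas2l || apply: meas2r); exact: meas_coord.
by apply/funext => y; apply/funext => k; rewrite /dot3 sum3E.
Qed.

Lemma meas2_cosdot : meas2 (fun y k => cos (dot3 k y)).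
Proof. exact: (meas2_comp (@measurable_cos R) meas2_dot). Qed.

Lemma meas2_sindot : meas2 (fun y k => sin (dot3 k y)).
Proof. exact: (meas2_comp (@measurable_sin R) meas2_dot). Qed.

Lemma L1_mul_RInt3_kernel K g al : meas2 K -> (forall x y, `|K x y| <= 1) ->
  L1 g -> L1 al -> L1 (fun y => g y * RInt3 (fun k => al k * K y k)).
Proof.
move=> mK K1 lg la; apply: (@L1_mul_bounded _ _ _ (RInt3 (fun k => `|al k|))) => //.
  apply: (meas_RInt3_kernel mK K1 (L1_gs 0 ltr01)) => // x.
  by rewrite gt_eqF// gs_gt0.
move=> y; apply: RInt3_norm_le; first exact: (L1_kernel y mK K1).
  exact: L1_norm.
by move=> k; rewrite normrM ler_piMr.
Qed.

(** Fubini transfers the trigonometric factors to [g]: pairing a Fourier integral with [g] only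
    involves the transform of [g], which is explicit for a Gaussian. *)
Lemma RInt3_mul_FT (g : V3 -> R) al ga : L1 g -> L1 al -> L1 ga ->
  L1 (fun y => g y * FT al ga y) /\
  RInt3 (fun y => g y * FT al ga y) =
  RInt3 (fun k => al k * RInt3 (fun y => g y * cos (dot3 k y))) +
  RInt3 (fun k => ga k * RInt3 (fun y => g y * sin (dot3 k y))).
Proof.
move=> lg la lga.
have c1 (y k : V3) : `|cos (dot3 k y)| <= 1 by exact: cos_max.
have s1 (y k : V3) : `|sin (dot3 k y)| <= 1 by exact: sin_max.
rewrite -(RInt3_swap meas2_cosdot c1 lg la) -(RInt3_swap meas2_sindot s1 lg lga).
have Lc := L1_mul_RInt3_kernel meas2_cosdot c1 lg la.
have Ls := L1_mul_RInt3_kernel meas2_sindot s1 lg lga.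
rewrite -RInt3D// (_ : (fun y => g y * FT al ga y) = fun y =>
  g y * RInt3 (fun k => al k * cos (dot3 k y)) + g y * RInt3 (fun k => ga k * sin (dot3 k y))).
  by split => //; exact: L1D.
by apply/funext => y; rewrite FTE// mulrDr.
Qed.

End TrigIntegral.

(** * Recovering a field from its curl *)

Section Representation.
Variable R : realType.
Local Notation V3 := (pt3 R).
Variables (b : 'I_3 -> V3 -> R) (db : 'I_3 -> V3 -> 'I_3 -> R).
Variables (al ga : 'I_3 -> 'I_3 -> V3 -> R) (p q : 'I_3 -> V3 -> R).
Hypothesis hb : forall i, has_grad (b i) (db i).
Hypothesis Lb : forall i, L1 (fun y => b i y ^+ 2).
Hypothesis divb : forall y, \sum_(i < 3) db i y i = 0.
Hypothesis curlb : forall i j y, db j y i - db i y j = FT (al i j) (ga i j) y.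
Hypothesis cR : forall i j, continuous (FT (al i j) (ga i j)).
Hypothesis La : forall i j, L1 (al i j).
Hypothesis Lg : forall i j, L1 (ga i j).
Hypothesis Lp : forall i, L1 (p i).
Hypothesis Lq : forall i, L1 (q i).
(** As [s -> 0] the factor [heat s k] tends to [0] except at [k = 0], where it stays [1]; vanishing
    amplitudes give pointwise convergence there too. *)
Hypothesis p0 : forall i, p i 0 = 0.
Hypothesis q0 : forall i, q i 0 = 0.
(** The Poisson equation in Fourier variables. As [div b = 0], minus the Laplacian of [b i] is the
    sum over [j] of the [j]-th partial derivatives of [d_i b_j - d_j b_i]; a partial derivative
    turns the amplitudes [(al, ga)] into [(ga * k_j, - al * k_j)]. *)
Hypothesis pE : forall i k, p i k * dot3 k k = \sum_(j < 3) ga i j k * k 0 j.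
Hypothesis qE : forall i k, q i k * dot3 k k = - \sum_(j < 3) al i j k * k 0 j.

Section FixedPoint.
Variables (i : 'I_3) (x : V3).

Let mb j : meas (b j). Proof. exact: continuous_meas (has_grad_continuous (@hb j)). Qed.

(** [b j] is only square integrable: with [g = u * gs] bounded by [C'], the product satisfies [|b g|
    <= b ^+ 2 + g ^+ 2 <= b ^+ 2 + C' * |g|]. *)
Let L1_b_gsM j s u C : 0 < s -> meas u -> (forall y, `|u y| <= C * (1 + sqd x y) ^+ 2) ->
  L1 (fun y => b j y * (u y * gs s x y)).
Proof.
move=> s0 mu uC; have Lu := L1_gsM s0 mu uC.
have s20 : 0 < s / 2 by rewrite divr_gt0.
pose C' := `|C| * (1 + 8 / (3 * s ^+ 2)) ^+ 2.
have uC' y : `|u y * gs s x y| <= C'.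
  rewrite normrM (ger0_norm (gs_ge0 _ _ _)).
  apply: (@le_trans _ _ (`|C| * ((1 + sqd x y) ^+ 2 * gs s x y))).
    rewrite mulrA ler_wpM2r ?gs_ge0// (le_trans (uC y))// ler_wpM2r ?ler_norm ?sqr_ge0//.
  rewrite /C' ler_wpM2l// (le_trans (gs_absorb x y s0))//.
  rewrite ler_piMr ?sqr_ge0// /gs expR_le1 oppr_le0 mulr_ge0 ?sqr_ge0 ?sqd_ge0//.
have := L1D (Lb j) (L1Z C' (L1_norm Lu)).
move/L1_le; apply.
  by apply: measM => //; exact: L1_meas Lu.
move=> y; set g := u y * _ in uC' *.
have h1 : `|g| ^+ 2 <= C' * `|g| by rewrite expr2 ler_wpM2r// uC'.
rewrite normrM -[b j y ^+ 2]real_normK ?num_real//.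
have := sqr_ge0 (`|b j y| - `|g|); have := sqr_ge0 `|b j y|; have := sqr_ge0 `|g|.
nra.
Qed.

(* Up to the factor [pi^(3/2)], the mean of [b i] against the Gaussian of width [1/s]
   around [x]; [W] below is the same mean of the candidate [FT (p i) (q i)]. *)
Let U (s : R) := RInt3 (fun y => b i y * (s ^+ 3 * gs s x y)).
Let dU (s : R) := RInt3 (fun y => b i y * ((3 * s ^+ 2 - 2 * s ^+ 4 * sqd x y) * gs s x y)).

Let poly_bound (a c : R) y : 0 <= a -> 0 <= c ->
  `|a + c * sqd x y| <= (a + c) * (1 + sqd x y) ^+ 2.
Proof.
move=> a0 c0; have q1 := sqd_ge0 x y.
rewrite ger0_norm; last by rewrite addr_ge0// mulr_ge0.
rewrite mulrDl; apply: lerD; first by rewrite ler_peMr// one_sqd2.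
by rewrite ler_wpM2l// (le_trans _ (sqdX2_ge1 x y))// lerDr.
Qed.

(** The domination holds for [t] between [s / 2] and [2 * s]: the coefficients are bounded at
    [2 * s], where [12 = 3 * 2 ^+ 2] and [32 = 2 * 2 ^+ 4], and the Gaussian at [s / 2]. *)
Let is_derive_U (s : R) : 0 < s -> is_derive s 1 U (dU s).
Proof.
move=> s0; have s20 : 0 < s / 2 by rewrite divr_gt0.
apply: (@is_derive_RInt3 _ (fun s y => b i y * (s ^+ 3 * gs s x y))
  (fun s y => b i y * ((3 * s ^+ 2 - 2 * s ^+ 4 * sqd x y) * gs s x y))
  (fun y => `|b i y * ((12 * s ^+ 2 + 32 * s ^+ 4 * sqd x y) * gs (s / 2) x y)|) _ (s / 2) (2 * s)).
- by lra.
- by lra.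
- move=> t /andP[t1 _]; have t0 : 0 < t by exact: lt_trans t1.
  apply: (@L1_b_gsM _ t (fun=> t ^+ 3) (`|t ^+ 3|)) => // [|y]; first exact: meas_cst.
  by rewrite ler_peMr// one_sqd2.
- move=> t y _; rewrite /gs; apply: is_derive_eq.
  by rewrite /GRing.scale /=; ring.
- apply: L1_norm; apply: (@L1_b_gsM _ (s / 2) (fun y => 12 * s ^+ 2 + 32 * s ^+ 4 * sqd x y)
    (12 * s ^+ 2 + 32 * s ^+ 4)) => //.
    by apply: measD; [exact: meas_cst|apply: measM; [exact: meas_cst|exact: meas_sqd]].
  by move=> y; apply: poly_bound; apply: mulr_ge0 => //; apply: exprn_ge0; exact: ltW.
- move=> t y /andP[t1 t2]; have t0 : 0 < t by exact: lt_trans t1.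
  rewrite !normrM ler_wpM2l//; apply: ler_pM => //; last first.
    by rewrite !ger0_norm ?gs_ge0// gs_le// ltW.
  have q1 := sqd_ge0 x y.
  have ts (n : nat) : t ^+ n <= (2 * s) ^+ n.
    by apply: lerXn2r; rewrite ?nnegrE ?(ltW t0) ?(ltW t2)// (le_trans (ltW t0) (ltW t2)).
  have h2 := ts 2%N; have h4 := ts 4%N; rewrite exprMn in h2; rewrite exprMn in h4.
  have s2 : 0 <= s ^+ 2 by exact: sqr_ge0.
  have s4 : 0 <= s ^+ 4 by apply: exprn_ge0; exact: ltW.
  have t4 : 0 <= t ^+ 4 by apply: exprn_ge0; exact: ltW.
  have h4' : t ^+ 4 * sqd x y <= 16 * s ^+ 4 * sqd x y.
    by rewrite ler_wpM2r// (le_trans h4)// -natrX.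
  have t2' := sqr_ge0 t.
  rewrite (@ger0_norm _ (12 * _ + _)); last first.
    by apply: addr_ge0; apply: mulr_ge0 => //; exact: mulr_ge0.
  have t4q : 0 <= t ^+ 4 * sqd x y by rewrite mulr_ge0.
  rewrite -natrX in h2.
  rewrite ler_norml; apply/andP; split; lra.
Qed.

Let L1_b_dgs j l s : 0 < s -> L1 (fun y => b j y * dgs s x y l).
Proof.
move=> s0; have c0 : 0 <= 2 * s ^+ 2 by apply: mulr_ge0 => //; exact: sqr_ge0.
apply: (@L1_b_gsM j s (fun y => - (2 * s ^+ 2 * (y 0 l - x 0 l))) (2 * s ^+ 2)) => // [|y].
  apply: measN; apply: measM; first exact: meas_cst.
  by apply: measB; [exact: meas_coord|exact: meas_cst].
rewrite normrN normrM (ger0_norm c0); apply: ler_wpM2l => //.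
by rewrite (le_trans (coord_sqd x y l))// sqdX2_ge1.
Qed.

(** The weight in [dU] is minus half the Laplacian of [gs s x]. Integration by parts turns it into
    first derivatives of the Gaussian against the components of the curl. *)
Let dUE (s : R) : 0 < s ->
  dU s = - 2^-1 * \sum_(j < 3) RInt3 (fun y => dgs s x y j * FT (al i j) (ga i j) y).
Proof.
move=> s0.
have hG := has_grad_gs s x.
have hd l := has_grad_dgs s x l.
(* In the divergence of this field the second derivatives of the Gaussian leave only its Laplacian
   times [b i]. The derivatives of [b] combine into [div b] and the differences [d_j b_i - d_i b_j],
   and [b] is never differentiated twice. *)
pose W l y := b i y * dgs s x y l + b l y * dgs s x y i -
  (l == i)%:R * \sum_(j < 3) b j y * dgs s x y j.
have hS := has_grad_sum (index_enum 'I_3) (fun j => has_gradM (hb j) (hd j)).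
have hW l := has_gradB (has_gradD (has_gradM (hb i) (hd l)) (has_gradM (hb l) (hd i)))
  (has_gradZ (l == i)%:R hS).
have LF j := RInt3_mul_FT (L1_dgs x j s0) (La i j) (Lg i j).
pose g y := (4 * s ^+ 4 * sqd x y - 6 * s ^+ 2) * gs s x y.
pose f y := b i y * g y - \sum_(j < 3) dgs s x y j * FT (al i j) (ga i j) y.
have c4 : 0 <= 4 * s ^+ 4 by apply: mulr_ge0 => //; apply: exprn_ge0; exact: ltW.
have c2 : 0 <= 6 * s ^+ 2 by apply: mulr_ge0 => //; apply: sqr_ge0.
have lg : L1 (fun y => b i y * g y).
  apply: (@L1_b_gsM i s (fun y => 4 * s ^+ 4 * sqd x y - 6 * s ^+ 2) (6 * s ^+ 2 + 4 * s ^+ 4)) => // [|y].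
    by apply: measB; [apply: measM; [exact: meas_cst|exact: meas_sqd]|exact: meas_cst].
  apply: le_trans (poly_bound y c2 c4); have q1 := sqd_ge0 x y.
  have h : 0 <= 4 * s ^+ 4 * sqd x y by exact: mulr_ge0.
  rewrite (@ger0_norm _ (6 * s ^+ 2 + _)); last exact: addr_ge0.
  by rewrite ler_norml; apply/andP; split; lra.
have lf : L1 f.
  by apply: L1B => //; apply: L1_sum => j _; case: (LF j).
(* The divergence theorem needs a continuous divergence. Single partial derivatives of [b] may be
   discontinuous, but [f] contains them only through the Fourier integrals of the curl. *)
have cf : continuous f.
  have hg := has_gradM (hb i) (has_gradM (has_gradB (has_gradZ (4 * s ^+ 4) (has_grad_sqd x))
    (has_grad_cst (6 * s ^+ 2))) hG).
  have cj j := continuous_mul3 (has_grad_continuous (hd j)) (@cR i j).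
  have C := continuous_sub3 (has_grad_continuous hg)
    (continuous_add3 (continuous_add3 (cj 0) (cj 1)) (cj (1 + 1))).
  suff -> : f = fun y => b i y * g y - (dgs s x y 0 * FT (al i 0) (ga i 0) y +
    dgs s x y 1 * FT (al i 1) (ga i 1) y +
    dgs s x y (1 + 1) * FT (al i (1 + 1)) (ga i (1 + 1)) y) by exact: C.
  by apply/funext => y; rewrite /f sum3E.
have f0 : RInt3 f = 0.
  apply: (divergence_theorem_grad hW) => // [y|l]; last first.
    apply: L1B; first by apply: L1D; exact: L1_b_dgs.
    by apply: L1Z; apply: L1_sum => j _; exact: L1_b_dgs.
  transitivity (f y + dgs s x y i * \sum_(l < 3) db l y l).
    by rewrite divb mulr0 addr0.
  rewrite /f /g; under eq_bigr => j _ do rewrite -curlb.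
  generalize i; apply: I3P; rewrite !sum3E /sqd !sum3E /dgs
    !eqxx ?I3_neq !mulr1n !mulr0n; ring.
move: f0; rewrite /f RInt3B//; last by apply: L1_sum => j _; case: (LF j).
rewrite RInt3_sum => [|j _]; last by case: (LF j).
move=> /eqP; rewrite subr_eq0 => /eqP <-; rewrite -RInt3Z//.
by apply: (f_equal (@RInt3 R)); apply/funext => y; rewrite /g; field.
Qed.

(** Up to the constant [p3], the factor by which the normalised Gaussian mean damps the frequency
    [k]; it is the heat multiplier at time [1 / (4 * s ^+ 2)]. *)
Let heat (s : R) (k : V3) := expR (- (dot3 k k / (4 * s ^+ 2))).
Let p3 := Num.sqrt pi ^+ 3 : R.
Let tr := trig (p i) (q i) x.
Let W (s : R) := RInt3 (fun k => tr k * (p3 * heat s k)).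
Let dW (s : R) := RInt3 (fun k => tr k * (p3 * (dot3 k k / (2 * s ^+ 3) * heat s k))).

Let meas_kk : meas (fun k : V3 => dot3 k k).
Proof. by rewrite /dot3; apply: meas_sum => j; apply: measM; exact: meas_coord. Qed.

Let meas_heat s : meas (heat s).
Proof.
apply: meas_comp; first exact: measurable_expR.
by apply: measN; apply: measM; [exact: meas_kk|exact: meas_cst].
Qed.

Let heat_le1 s k : 0 < s -> 0 <= heat s k <= 1.
Proof.
move=> s0; rewrite expR_ge0 expR_le1 oppr_le0 divr_ge0 ?dot3_ge0//.
by apply: mulr_ge0 => //; exact: sqr_ge0.
Qed.

Let kk_heat s k : 0 < s -> dot3 k k * heat s k <= 4 * s ^+ 2.
Proof.
move=> s0; have c0 : 0 < 4 * s ^+ 2 by apply: mulr_gt0 => //; exact: exprn_gt0.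
rewrite /heat expRN ler_pdivrMr ?expR_gt0//.
apply: (@le_trans _ _ (4 * s ^+ 2 * (1 + dot3 k k / (4 * s ^+ 2)))).
  by rewrite mulrDr mulr1 [X in _ + X]mulrC divfK ?lt0r_neq0// lerDr ltW.
by rewrite ler_wpM2l ?(ltW c0)// expR_ge1Dx.
Qed.

Let Ltr : L1 tr. Proof. exact: L1_trig. Qed.

(** By [kk_heat] the derivative of the multiplier at [t] is at most
    [4 * t ^+ 2 / (2 * t ^+ 3) = 2 / t], and [t > s / 2] turns this into the dominating constant
    [4 / s]. *)
Let is_derive_W (s : R) : 0 < s -> is_derive s 1 W (dW s).
Proof.
move=> s0; have s20 : 0 < s / 2 by rewrite divr_gt0.
have p30 : 0 <= p3 by apply: exprn_ge0; exact: sqrtr_ge0.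
apply: (@is_derive_RInt3 _ (fun s k => tr k * (p3 * heat s k))
  (fun s k => tr k * (p3 * (dot3 k k / (2 * s ^+ 3) * heat s k)))
  (fun k => p3 * (4 / s) * `|tr k|) _ (s / 2) (2 * s)).
- by lra.
- by lra.
- move=> t /andP[t1 _]; have t0 : 0 < t by exact: lt_trans t1.
  apply: (@L1_mul_bounded _ _ _ p3) => //.
    by apply: measM; [exact: meas_cst|exact: meas_heat].
  move=> k; have /andP[h0 h1] := heat_le1 k t0.
  by rewrite ger0_norm ?mulr_ge0// ler_piMr.
- move=> t k /andP[t1 _]; have t0 : 0 < t by exact: lt_trans t1.
  have t2 : 4 * t ^+ 2 != 0 by rewrite lt0r_neq0// mulr_gt0// exprn_gt0.
  rewrite /heat; apply: is_derive_eq.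
  rewrite /GRing.scale /=; field.
  by rewrite lt0r_neq0.
- by apply: L1Z; exact: L1_norm.
- move=> t k /andP[t1 _]; have t0 : 0 < t by exact: lt_trans t1.
  have /andP[h0 h1] := heat_le1 k t0.
  rewrite normrM mulrC ler_wpM2r//.
  have e : dot3 k k / (2 * t ^+ 3) * heat t k = (dot3 k k * heat t k) / (2 * t ^+ 3).
    by field; rewrite lt0r_neq0.
  have t3 : 0 < 2 * t ^+ 3 by apply: mulr_gt0 => //; exact: exprn_gt0.
  rewrite e ger0_norm; last by rewrite mulr_ge0// divr_ge0 ?(ltW t3)// mulr_ge0 ?dot3_ge0.
  rewrite ler_wpM2l// ler_pdivrMr// (le_trans (kk_heat k t0))//.
  rewrite mulrAC ler_pdivlMr// [leRHS](_ : _ = 4 * t ^+ 2 * (2 * t)); last by ring.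
  by rewrite ler_wpM2l ?mulr_ge0 ?sqr_ge0//; lra.
Qed.

Let fourier_dU (s : R) j : 0 < s ->
  has_int3 (fun k => p3 / s ^+ 3 * heat s k *
     (al i j k * (k 0 j * sin (dot3 k x)) - ga i j k * (k 0 j * cos (dot3 k x))))
  (RInt3 (fun y => dgs s x y j * FT (al i j) (ga i j) y)).
Proof.
move=> s0; have p30 : 0 <= p3 by apply: exprn_ge0; exact: sqrtr_ge0.
have cE (k : V3) : RInt3 (fun y => dgs s x y j * cos (dot3 k y)) =
    p3 / s ^+ 3 * (k 0 j * heat s k) * sin (dot3 k x).
  have := fourier_dgs x k 0 j s0; rewrite addr0 expr_div_n -/p3 -/(heat s k).
  under eq_fun do rewrite addr0.
  by move=> ->; ring.
have sE (k : V3) : RInt3 (fun y => dgs s x y j * sin (dot3 k y)) =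
    - (p3 / s ^+ 3 * (k 0 j * heat s k) * cos (dot3 k x)).
  have := fourier_dgs x k (- (pi / 2)) j s0; rewrite sinBpihalf expr_div_n -/p3 -/(heat s k).
  under eq_fun do rewrite cosBpihalf.
  by move=> ->; ring.
have mH : meas (fun k : V3 => p3 / s ^+ 3 * (k 0 j * heat s k)).
  by apply: measM; [exact: meas_cst|apply: measM; [exact: meas_coord|exact: meas_heat]].
have s30 : 0 <= p3 / s ^+ 3 by apply: divr_ge0 => //; apply: exprn_ge0; exact: ltW.
have bH (k : V3) : `|p3 / s ^+ 3 * (k 0 j * heat s k)| <= p3 / s ^+ 3 * (1 + 4 * s ^+ 2).
  have /andP[h0 h1] := heat_le1 k s0.
  rewrite normrM (ger0_norm s30) ler_wpM2l// normrM (ger0_norm h0).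
  have k1 : `|k 0 j| <= 1 + dot3 k k.
    have := coord_sqd 0 k j; rewrite mxE subr0 /sqd /dot3 => /le_trans; apply.
    by rewrite lerD2l ler_sum// => l _; rewrite mxE subr0 expr2.
  apply: (le_trans (ler_wpM2r h0 k1)); rewrite mulrDl mul1r lerD//; exact: kk_heat.
have Lc : L1 (fun k => al i j k * (p3 / s ^+ 3 * (k 0 j * heat s k) * sin (dot3 k x))).
  apply: (@L1_mul_bounded _ _ _ (p3 / s ^+ 3 * (1 + 4 * s ^+ 2))) => // [|k].
    by apply: measM => //; exact: meas_sindot.
  by rewrite normrM (le_trans _ (bH k))// ler_piMr// sin_max.
have Ls : L1 (fun k => ga i j k * - (p3 / s ^+ 3 * (k 0 j * heat s k) * cos (dot3 k x))).
  apply: (@L1_mul_bounded _ _ _ (p3 / s ^+ 3 * (1 + 4 * s ^+ 2))) => // [|k].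
    by apply: measN; apply: measM => //; exact: meas_cosdot.
  by rewrite normrN normrM (le_trans _ (bH k))// ler_piMr// cos_max.
have [_ ->] := RInt3_mul_FT (L1_dgs x j s0) (La i j) (Lg i j).
under [X in RInt3 X + _]eq_fun do rewrite cE.
under [X in _ + RInt3 X]eq_fun do rewrite sE.
have := has_int3D (conj Lc erefl : has_int3 _ _) (conj Ls erefl : has_int3 _ _).
by move=> /has_int3_eq; apply => // k; ring.
Qed.

Let dU_dW (s : R) : 0 < s -> dU s = dW s.
Proof.
move=> s0; rewrite dUE//.
have H j := fourier_dU j s0.
have := has_int3Z (- 2^-1) (has_int3D (has_int3D (H 0) (H 1)) (H (1 + 1))).
rewrite sum3E => -[_ <-]; apply: (f_equal (@RInt3 R)); apply/funext => k.
have -> : tr k * (p3 * (dot3 k k / (2 * s ^+ 3) * heat s k)) =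
    p3 * heat s k / (2 * s ^+ 3) * (p i k * dot3 k k * cos (dot3 k x) +
      q i k * dot3 k k * sin (dot3 k x)).
  by rewrite /tr /trig; field; rewrite lt0r_neq0.
rewrite pE qE !sum3E.
move: (cos _) (sin _) => c1 c2; field; rewrite lt0r_neq0 //.
Qed.

(** The derivatives are known only for [s > 0], while the constancy criterion wants the whole line;
    hence the change of variable [s = expR r]. *)
Let UW_cst (s t : R) : 0 < s -> 0 < t -> U s - W s = U t - W t.
Proof.
move=> s0 t0; pose Z (r : R) := U (expR r) - W (expR r).
have dZ (r : R) : is_derive r 1 Z 0.
  have e0 := expR_gt0 r.
  have d1 := @is_derive1_comp _ U expR r _ _ (is_derive_U e0) (is_derive_expR r).
  have d2 := @is_derive1_comp _ W expR r _ _ (is_derive_W e0) (is_derive_expR r).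
  have e : dU (expR r) * expR r - dW (expR r) * expR r = 0.
    by rewrite -mulrBl; apply/eqP; rewrite mulf_eq0 subr_eq0; apply/orP; left; apply/eqP; exact: dU_dW.
  by rewrite -e; exact: is_deriveB.
have := derivable_zero_cst (ln s) (ln t) dZ.
by rewrite /Z !lnK.
Qed.

(** A Cauchy-Schwarz bound through the arithmetic-geometric mean: [|b * s ^+ 3 * g| <= (s ^+ 2 * b
    ^+ 2 + s ^+ 4 * g ^+ 2) / 2] with [g ^+ 2 <= g]. The integral of [g] is [p3 / s ^+ 3], so for
    [s <= 1] the total is at most [C * s]. *)
Let U_near0 : U n.+1%:R^-1 @[n --> \oo] --> (0 : R).
Proof.
pose C := 2^-1 * (RInt3 (fun y => b i y ^+ 2) + p3).
apply: norm_cvg0; apply: (squeeze_cvgr _ (cvg_cst 0)); last first.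
  rewrite -(mulr0 C); apply: cvgM (cvg_cst C) (@cvg_harmonic R).
apply: nearW => n; rewrite normr_ge0 /=.
set s := n.+1%:R^-1 : R; have s0 : 0 < s by rewrite invr_gt0.
have s1 : s <= 1 by rewrite invf_le1 ?ler1n.
have [Lgs Igs] := gs_integral x s0.
have LU : L1 (fun y => b i y * (s ^+ 3 * gs s x y)).
  apply: (@L1_b_gsM i s (fun=> s ^+ 3) (`|s ^+ 3|)) => // [|y]; first exact: meas_cst.
  by rewrite ler_peMr// one_sqd2.
have Lr : L1 (fun y => 2^-1 * s ^+ 2 * b i y ^+ 2 + 2^-1 * s ^+ 4 * gs s x y).
  by apply: L1D; exact: L1Z.
have := RInt3_norm_le LU Lr; rewrite -/(U s) => H.
apply: (le_trans (H _)) => [y|].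
  have g0 := gs_ge0 s x y.
  have g1 : gs s x y <= 1.
    by rewrite /gs expR_le1 oppr_le0 mulr_ge0 ?sqr_ge0 ?sqd_ge0.
  set g := gs s x y in g0 g1 *; set c := b i y.
  have s2 := sqr_ge0 s.
  have e1 : `|c * (s ^+ 3 * g)| = `|c| * g * s * s ^+ 2.
    by rewrite normrM (ger0_norm (mulr_ge0 _ g0)) ?exprn_ge0 ?(ltW s0)//; ring.
  have e2 : 2^-1 * s ^+ 2 * c ^+ 2 + 2^-1 * s ^+ 4 * g =
     (2^-1 * `|c| ^+ 2 + 2^-1 * s ^+ 2 * g) * s ^+ 2.
    by rewrite real_normK ?num_real//; ring.
  rewrite e1 e2 ler_wpM2r//.
  have h1 := sqr_ge0 (`|c| - g * s).
  have h2 : g ^+ 2 * s ^+ 2 <= g * s ^+ 2 by rewrite ler_wpM2r// expr2 ler_piMl.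
  rewrite sqrrB exprMn in h1.
  have -> : `|c| * g * s = `|c| * (g * s) by rewrite mulrA.
  move: (`|c| * (g * s)) h1 => X; rewrite -mulr_natl => h1.
  by move: (`|c| ^+ 2) h1 => Y h1; lra.
rewrite RInt3D ?RInt3Z ?Igs//; [|exact: L1Z|exact: L1Z].
have B0 : 0 <= RInt3 (fun y => b i y ^+ 2) by apply: RInt3_ge0 => y; exact: sqr_ge0.
have p30 : 0 <= p3 by apply: exprn_ge0; exact: sqrtr_ge0.
rewrite expr_div_n -/p3 (_ : 2^-1 * s ^+ 4 * (p3 / s ^+ 3) = 2^-1 * p3 * s); last first.
  by field; rewrite lt0r_neq0.
rewrite /C mulrDr [leRHS]mulrDl lerD2r -mulrA [s ^+ 2 * _]mulrC mulrA ler_wpM2l//.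
  by rewrite mulr_ge0// invr_ge0.
by rewrite expr2 ler_piMl// ltW.
Qed.

Let W_near0 : W n.+1%:R^-1 @[n --> \oo] --> (0 : R).
Proof.
have p30 : 0 <= p3 by apply: exprn_ge0; exact: sqrtr_ge0.
have <- : RInt3 (fun _ : V3 => 0) = 0 :> R by exact: RInt3_cst0.
apply: (RInt3_cvg _ (L1Z p3 (L1_norm Ltr))) => [n|k|n k].
- by apply: measM; [exact: L1_meas|apply: measM; [exact: meas_cst|exact: meas_heat]].
- have [->|k0] := eqVneq k 0.
    rewrite /tr /trig p0 q0 !mul0r addr0.
    by under eq_fun do rewrite mul0r; exact: cvg_cst.
  have kk0 : 0 < dot3 k k by rewrite lt_neqAle dot3_ge0 andbT eq_sym dot3_eq0.
  have -> : 0 = tr k * (p3 * 0) by rewrite !mulr0.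
  apply: cvgM; first exact: cvg_cst.
  apply: cvgM; first exact: cvg_cst.
  apply: (squeeze_cvgr _ (cvg_cst 0)); last first.
    rewrite -(mulr0 (4 / dot3 k k)); apply: cvgM (cvg_cst _) (@cvg_harmonic R).
  apply: nearW => n; rewrite expR_ge0 /=.
  set s := n.+1%:R^-1 : R; have s0 : 0 < s by rewrite invr_gt0.
  have s1 : s <= 1 by rewrite invf_le1 ?ler1n.
  rewrite -/(heat s k) mulrAC ler_pdivlMr// mulrC (le_trans (kk_heat k s0))//.
  by rewrite ler_wpM2l// expr2 ler_piMl// ltW.
- have /andP[h0 h1] : 0 <= heat n.+1%:R^-1 k <= 1 by apply: heat_le1; rewrite invr_gt0.
  rewrite normrM mulrC ler_wpM2r// ger0_norm ?mulr_ge0// ler_piMr//.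
Qed.

Let U_neary : U n.+1%:R @[n --> \oo] --> p3 * b i x.
Proof.
have Lg1 : L1 (fun y => b i y * gs 1 x y).
  have := (@L1_b_gsM i 1 (fun=> 1) 1 ltr01 (meas_cst 1)).
  under eq_fun do rewrite mul1r.
  by apply => y; rewrite normr1 mul1r one_sqd2.
have := @approximate_identity _ (b i) x 1 ltr01 (mb i) Lg1.
rewrite -/p3 => H.
rewrite (_ : (fun n => _) = fun n => n.+1%:R ^+ 3 * RInt3 (fun y => b i y * gs n.+1%:R x y)).
  apply: H => e e0; have cb := has_grad_continuous (hb i).
  have /cvgrPdist_le/(_ e e0)/nbhs3P[d d0 H] := @cb x.
  by exists d => // y /H; rewrite distrC.
apply/funext => n; rewrite /U -RInt3Z.
  by apply: (f_equal (@RInt3 R)); apply/funext => y; rewrite mulrCA.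
have := (@L1_b_gsM i n.+1%:R (fun=> 1) 1 (ltr0Sn _ _) (meas_cst 1)).
under eq_fun do rewrite mul1r.
by apply => y; rewrite normr1 mul1r one_sqd2.
Qed.

Let W_neary : W n.+1%:R @[n --> \oo] --> p3 * FT (p i) (q i) x.
Proof.
have p30 : 0 <= p3 by apply: exprn_ge0; exact: sqrtr_ge0.
rewrite -RInt3Z//.
apply: (RInt3_cvg _ (L1Z p3 (L1_norm Ltr))) => [n|k|n k].
- by apply: measM; [exact: L1_meas|apply: measM; [exact: meas_cst|exact: meas_heat]].
- rewrite mulrC -[X in tr k * X]mulr1.
  apply: cvgM; first exact: cvg_cst.
  apply: cvgM; first exact: cvg_cst.
  apply/cvgrPdist_le => e e0; near=> n.
  set s := n.+1%:R : R; have s0 : 0 < s by [].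
  have s1 : 1 <= s by rewrite ler1n.
  have /andP[h0 h1] := heat_le1 k s0.
  rewrite ger0_norm ?subr_ge0//.
  have h2 := expR_ge1Dx (- (dot3 k k / (4 * s ^+ 2))).
  apply: (@le_trans _ _ (dot3 k k / (4 * s ^+ 2))).
    by rewrite lerBlDr -lerBlDl.
  have ks : dot3 k k / e <= s.
    rewrite (@le_trans _ _ n%:R)// ?ler_nat//; near: n; exact: nbhs_infty_ger.
  rewrite ler_pdivrMr ?mulr_gt0 ?exprn_gt0//.
  rewrite ler_pdivrMr// in ks; rewrite (le_trans ks)// mulrC ler_wpM2l ?(ltW e0)//.
  by rewrite expr2; nra.
- have /andP[h0 h1] : 0 <= heat n.+1%:R k <= 1 by apply: heat_le1.
  rewrite normrM mulrC ler_wpM2r// ger0_norm ?mulr_ge0// ler_piMr//.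
Unshelve. all: by end_near. Qed.

Lemma representation_at : b i x = FT (p i) (q i) x.
Proof.
have UW s : 0 < s -> U s = W s.
  move=> s0.
  have h : (fun n : nat => U n.+1%:R^-1 - W n.+1%:R^-1) = cst (U s - W s).
    by apply/funext => n; apply: UW_cst => //; rewrite invr_gt0.
  have H := cvgB U_near0 W_near0; rewrite subr0 in H.
  have {}H : cst (U s - W s) @ \oo --> (0 : R) by rewrite -h; exact: H.
  move: H => /(cvg_unique _ (cvg_cst (U s - W s))) E.
  by apply/eqP; rewrite -subr_eq0 E.
have := W_neary; rewrite (_ : (fun n => _) = fun n => U n.+1%:R).
  move/(cvg_unique _ U_neary) => e.
  have p3n0 : p3 != 0 by rewrite lt0r_neq0// exprn_gt0// sqrtr_gt0 pi_gt0.
  by apply: (mulfI p3n0); exact: e.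
by apply/funext => n; rewrite UW.
Qed.

End FixedPoint.
End Representation.

(** * Plancherel's identity *)

Section Plancherel.
Variable R : realType.
Local Notation V3 := (pt3 R).
Variables (gr gi : V3 -> R) (Cb : R).
Hypothesis Lr : L1 gr.
Hypothesis Li : L1 gi.
Hypothesis br : forall k, `|gr k| <= Cb.
Hypothesis bi : forall k, `|gi k| <= Cb.
(** Continuity is not assumed at the origin, so there the pointwise limit in [plancherel] comes from
    this value: the integrand carries the factor [gr k] or [gi k]. *)
Hypothesis gr0 : gr 0 = 0.
Hypothesis gi0 : gi 0 = 0.
Hypothesis cr : forall k, k != 0 -> {for k, continuous gr}.
Hypothesis ci : forall k, k != 0 -> {for k, continuous gi}.

Let Br := FT gr (fun k => - gi k).
Let Bi := FT gi gr.
Hypothesis LB : L1 (fun x => Br x ^+ 2 + Bi x ^+ 2).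

Lemma meas_FT (al ga : V3 -> R) : L1 al -> L1 ga -> meas (FT al ga).
Proof.
move=> la lg; have g0 x : gs 1 0 x != 0 :> R by rewrite gt_eqF// gs_gt0.
have c1 (y k : V3) : `|cos (dot3 k y)| <= 1 by exact: cos_max.
have s1 (y k : V3) : `|sin (dot3 k y)| <= 1 by exact: sin_max.
rewrite (_ : FT al ga = fun x => RInt3 (fun k => al k * cos (dot3 k x)) +
  RInt3 (fun k => ga k * sin (dot3 k x))); last by apply/funext => x; rewrite FTE.
apply: measD; first exact: (meas_RInt3_kernel (@meas2_cosdot R) c1 (L1_gs 0 ltr01)).
exact: (meas_RInt3_kernel (@meas2_sindot R) s1 (L1_gs 0 ltr01)).
Qed.

Lemma meas2_gs s : meas2 (fun x y : V3 => gs s x y).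
Proof.
apply: meas2_comp; first exact: measurable_expR.
rewrite (_ : (fun x y => _) = fun x y : V3 => (- s ^+ 2) * ((y 0 0 - x 0 0) ^+ 2 +
   (y 0 1 - x 0 1) ^+ 2 + (y 0 (1 + 1) - x 0 (1 + 1)) ^+ 2)); last first.
  by apply/funext => x; apply/funext => y; rewrite /sqd sum3E mulNr.
have m i : meas2 (fun x y : V3 => (y 0 i - x 0 i) ^+ 2).
  have d : meas2 (fun x y : V3 => y 0 i - x 0 i).
    apply: meas2D; first exact: meas2r (@meas_coord _ i).
    exact: meas2l (measN (@meas_coord _ i)).
  by have := meas2M d d; congr meas2; apply/funext => x; apply/funext => y; rewrite expr2.
by apply: meas2M; [exact: meas2l (meas_cst _)|do 2 (try apply: meas2D)].
Qed.

Lemma gs_le1 s (x y : V3) : 0 <= gs s x y <= 1.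
Proof. by rewrite gs_ge0 /gs expR_le1 oppr_le0 mulr_ge0 ?sqr_ge0 ?sqd_ge0. Qed.

Section Window.
Variables (s : R).
Hypothesis s0 : 0 < s.
(** The width for which the transform of the window at [k - k'] is a multiple of [gs s k k'],
    because [4 * sg ^+ 2 = 1 / s ^+ 2]. *)
Let sg := (2 * s)^-1.
Let psi := gs sg (0 : V3).
Let sg0 : 0 < sg. Proof. by rewrite invr_gt0 mulr_gt0. Qed.

Let Lpsi : L1 psi. Proof. exact: L1_gs. Qed.

Let A (k k' : V3) := (Num.sqrt pi / sg) ^+ 3 * expR (- (dot3 (k - k') (k - k') / (4 * sg ^+ 2))).

Let AE k k' : A k k' = 8 * Num.sqrt pi ^+ 3 * s ^+ 3 * gs s k k'.
Proof.
rewrite /A /gs /sg invrK exprMn; congr (_ * expR _); first by ring.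
have -> : dot3 (k - k') (k - k') = sqd k k'.
  by apply: eq_bigr => i _; rewrite !mxE; ring.
by field; rewrite lt0r_neq0.
Qed.

Let dotD (k k' x : V3) : dot3 (k + k') x = dot3 k x + dot3 k' x.
Proof. by rewrite /dot3 -big_split; apply: eq_bigr => i _; rewrite mxE mulrDl. Qed.

Let dotN (k x : V3) : dot3 (- k) x = - dot3 k x.
Proof. by rewrite /dot3 -sumrN; apply: eq_bigr => i _; rewrite mxE mulNr. Qed.

Let dot0 (k : V3) : dot3 k 0 = 0.
Proof. by rewrite /dot3 big1// => i _; rewrite mxE mulr0. Qed.

Let icos (k : V3) : has_int3 (fun x => psi x * cos (dot3 k x)) (A k 0).
Proof.
apply: has_int3_eq (fourier_gs_cos 0 k 0 sg0) _ _ => [x|]; first by rewrite addr0.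
by rewrite dot0 addr0 cos0 mulr1 /A subr0.
Qed.

Let isin (k : V3) : has_int3 (fun x => psi x * sin (dot3 k x)) 0.
Proof.
apply: has_int3_eq (fourier_gs_sin 0 k 0 sg0) _ _ => [x|]; first by rewrite addr0.
by rewrite dot0 addr0 sin0 mulr0.
Qed.

Let Asub (k k' : V3) : A (k - k') 0 = A k k'. Proof. by rewrite /A subr0. Qed.

Let icc (k k' : V3) : has_int3 (fun x => psi x * cos (dot3 k x) * cos (dot3 k' x))
  (2^-1 * (A k k' + A (k + k') 0)).
Proof.
apply: has_int3_eq (has_int3Z 2^-1 (has_int3D (icos (k - k')) (icos (k + k')))) _ _ => [x|].
  by rewrite !dotD !dotN cosD cosD cosN sinN; field.
by rewrite Asub.
Qed.

Let iss (k k' : V3) : has_int3 (fun x => psi x * sin (dot3 k x) * sin (dot3 k' x))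
  (2^-1 * (A k k' - A (k + k') 0)).
Proof.
apply: has_int3_eq (has_int3Z 2^-1 (has_int3D (icos (k - k'))
  (has_int3Z (-1) (icos (k + k'))))) _ _ => [x|].
  by rewrite !dotD !dotN cosD cosD cosN sinN; field.
by rewrite Asub mulN1r.
Qed.

Let ics (k k' : V3) : has_int3 (fun x => psi x * cos (dot3 k x) * sin (dot3 k' x)) 0.
Proof.
apply: has_int3_eq (has_int3Z 2^-1 (has_int3D (isin (k + k'))
  (has_int3Z (-1) (isin (k - k'))))) _ _ => [x|].
  by rewrite !dotD !dotN sinD sinD cosN sinN; field.
by rewrite !mulr0 addr0 mulr0.
Qed.

Let isc (k k' : V3) : has_int3 (fun x => psi x * sin (dot3 k x) * cos (dot3 k' x)) 0.
Proof. by apply: has_int3_eq (ics k' k) _ _ => // x; rewrite mulrAC. Qed.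

Let Lpc (k : V3) : L1 (fun x => psi x * cos (dot3 k x)). Proof. by case: (icos k). Qed.
Let Lps (k : V3) : L1 (fun x => psi x * sin (dot3 k x)). Proof. by case: (isin k). Qed.
Let LNi : L1 (fun k => - gi k). Proof. exact: L1N. Qed.

Let LA (g : V3 -> R) k : L1 g -> L1 (fun k' => g k' * A k k').
Proof.
move=> lg.
have H : L1 (fun k' => g k' * gs s k k').
  apply: (@L1_mul_bounded _ g (gs s k) 1 lg (meas_gs s k)) => y.
  by have /andP[? ?] := gs_le1 s k y; rewrite ger0_norm.
rewrite (_ : (fun k' => _) = fun k' => 8 * Num.sqrt pi ^+ 3 * s ^+ 3 * (g k' * gs s k k')).
  exact: (L1Z (8 * Num.sqrt pi ^+ 3 * s ^+ 3) H).
by apply/funext => k'; rewrite AE mulrCA.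
Qed.

Let LAp (g : V3 -> R) k : L1 g -> L1 (fun k' => g k' * A (k + k') 0).
Proof.
move=> lg; rewrite (_ : (fun k' => _) = fun k' => g k' * A (- k) k'); first exact: LA.
apply/funext => k'; have e : dot3 (k + k') (k + k') = dot3 (- k - k') (- k - k').
  by apply: eq_bigr => i _; rewrite !mxE -opprD mulrNN.
by rewrite /A subr0 e.
Qed.

Let inner (g : V3 -> R) k := RInt3 (fun k' => g k' * A k k').

(** The product-to-sum formulas give terms in [k - k'] and in [k + k']. The latter cancel between
    the two cosines and the two sines, and the mixed products integrate to [0]; what is left is the
    Gaussian convolution of [gr]. *)
Let inner1 (k : V3) : RInt3 (fun x => psi x * cos (dot3 k x) * Br x) +
  RInt3 (fun x => psi x * sin (dot3 k x) * Bi x) = inner gr k.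
Proof.
rewrite (RInt3_mul_FT (Lpc k) Lr LNi).2 (RInt3_mul_FT (Lps k) Li Lr).2.
under [X in RInt3 X + _ + _]eq_fun => k' do rewrite (icc k k').2.
under [X in _ + RInt3 X + _]eq_fun => k' do rewrite (ics k k').2 mulr0.
under [X in _ + (RInt3 X + _)]eq_fun => k' do rewrite (isc k k').2 mulr0.
under [X in _ + (_ + RInt3 X)]eq_fun => k' do rewrite (iss k k').2.
rewrite RInt3_cst0 addr0 add0r -RInt3D.
- by apply: (f_equal (@RInt3 R)); apply/funext => k'; field.
- rewrite (_ : (fun k' => _) = fun k' => 2^-1 * (gr k' * A k k' + gr k' * A (k + k') 0)).
    by apply: L1Z; apply: L1D; [exact: LA|exact: LAp].
  by apply/funext => k'; ring.
- rewrite (_ : (fun k' => _) = fun k' => 2^-1 * (gr k' * A k k' - gr k' * A (k + k') 0)).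
    by apply: L1Z; apply: L1B; [exact: LA|exact: LAp].
  by apply/funext => k'; ring.
Qed.

Let inner2 (k : V3) : RInt3 (fun x => psi x * cos (dot3 k x) * Bi x) -
  RInt3 (fun x => psi x * sin (dot3 k x) * Br x) = inner gi k.
Proof.
rewrite (RInt3_mul_FT (Lpc k) Li Lr).2 (RInt3_mul_FT (Lps k) Lr LNi).2.
under [X in RInt3 X + _ - _]eq_fun => k' do rewrite (icc k k').2.
under [X in _ + RInt3 X - _]eq_fun => k' do rewrite (ics k k').2 mulr0.
under [X in _ - (RInt3 X + _)]eq_fun => k' do rewrite (isc k k').2 mulr0.
under [X in _ - (_ + RInt3 X)]eq_fun => k' do rewrite (iss k k').2.
rewrite RInt3_cst0 addr0 add0r -RInt3B.
- by apply: (f_equal (@RInt3 R)); apply/funext => k'; field.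
- rewrite (_ : (fun k' => _) = fun k' => 2^-1 * (gi k' * A k k' + gi k' * A (k + k') 0)).
    by apply: L1Z; apply: L1D; [exact: LA|exact: LAp].
  by apply/funext => k'; ring.
- rewrite (_ : (fun k' => _) = fun k' => - 2^-1 * (gi k' * A k k' - gi k' * A (k + k') 0)).
    by apply: L1Z; apply: L1B; [exact: LA|exact: LAp].
  by apply/funext => k'; ring.
Qed.

Let mBr : meas Br. Proof. exact: meas_FT. Qed.
Let mBi : meas Bi. Proof. exact: meas_FT. Qed.
Let LpBr : L1 (fun x => psi x * Br x).
Proof. by apply: (L1_mul_bounded Lpsi mBr) => x; exact: FT_bound. Qed.
Let LpBi : L1 (fun x => psi x * Bi x).
Proof. by apply: (L1_mul_bounded Lpsi mBi) => x; exact: FT_bound. Qed.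

Let kcos (g h : V3 -> R) : L1 g -> L1 h ->
  L1 (fun k => g k * RInt3 (fun x => h x * cos (dot3 k x))).
Proof.
move=> lg lh; apply: (L1_mul_RInt3_kernel (K := fun k x => cos (dot3 k x))) => // [|x y].
  have := @meas2_cosdot R; congr meas2.
  by apply/funext => x; apply/funext => y; rewrite dot3C.
exact: cos_max.
Qed.

Let ksin (g h : V3 -> R) : L1 g -> L1 h ->
  L1 (fun k => g k * RInt3 (fun x => h x * sin (dot3 k x))).
Proof.
move=> lg lh; apply: (L1_mul_RInt3_kernel (K := fun k x => sin (dot3 k x))) => // [|x y].
  have := @meas2_sindot R; congr meas2.
  by apply/funext => x; apply/funext => y; rewrite dot3C.
exact: sin_max.
Qed.

(** One factor of each square is expanded as a Fourier integral and Fubini is applied. The remaining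
    integrals, over [x], pair the window and a wave with [Br] and [Bi], and [inner1] and [inner2]
    evaluate them. *)
Lemma windowed_norm : RInt3 (fun x => psi x * (Br x ^+ 2 + Bi x ^+ 2)) =
  RInt3 (fun k => gr k * inner gr k + gi k * inner gi k).
Proof.
have [L1r E1r] := RInt3_mul_FT LpBr Lr LNi.
have [L1i E1i] := RInt3_mul_FT LpBi Li Lr.
transitivity (RInt3 (fun x => psi x * Br x * Br x) + RInt3 (fun x => psi x * Bi x * Bi x)).
  rewrite -RInt3D//; apply: (f_equal (@RInt3 R)); apply/funext => x.
  by rewrite !expr2; ring.
rewrite E1r E1i.
have h (f : V3 -> R) : L1 f -> has_int3 f (RInt3 f) by move=> lf; split.
have := has_int3D (has_int3D (h _ (kcos Lr LpBr)) (h _ (ksin LNi LpBr)))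
  (has_int3D (h _ (kcos Li LpBi)) (h _ (ksin Lr LpBi))).
case=> _ <-; apply: (f_equal (@RInt3 R)); apply/funext => k.
rewrite -inner1 -inner2.
have sw (u v : V3 -> R) : RInt3 (fun x => psi x * u x * v x) = RInt3 (fun x => psi x * v x * u x).
  by apply: (f_equal (@RInt3 R)); apply/funext => x; rewrite mulrAC.
rewrite !(sw _ Br) !(sw _ Bi).
move: (RInt3 _) (RInt3 _) (RInt3 _) (RInt3 _) => X1 X2 X3 X4.
by rewrite !mulrDr mulrN; ring.
Qed.

Lemma innerE g k : L1 g ->
  inner g k = 8 * Num.sqrt pi ^+ 3 * (s ^+ 3 * RInt3 (fun k' => g k' * gs s k k')).
Proof.
move=> lg; rewrite mulrA -RInt3Z.
  by apply: (f_equal (@RInt3 R)); apply/funext => k'; rewrite AE; ring.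
apply: (@L1_mul_bounded _ g (gs s k) 1 lg (meas_gs s k)).
by move=> y; have /andP[? ?] := gs_le1 s k y; rewrite ger0_norm.
Qed.

End Window.

Let p3 := Num.sqrt pi ^+ 3 : R.

Let conv (g : V3 -> R) (n : nat) (k : V3) :=
  8 * p3 * (n.+1%:R ^+ 3 * RInt3 (fun k' => g k' * gs n.+1%:R k k')).

Let L1_mul_gs (g : V3 -> R) s k : L1 g -> L1 (fun k' => g k' * gs s k k').
Proof.
move=> lg; apply: (@L1_mul_bounded _ g (gs s k) 1 lg (meas_gs s k)) => y.
by have /andP[? ?] := gs_le1 s k y; rewrite ger0_norm.
Qed.

Let meas_conv (g : V3 -> R) n : L1 g -> meas (conv g n).
Proof.
move=> lg; apply: measM; first exact: meas_cst.
apply: measM; first exact: meas_cst.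
have g0 x : gs 1 0 x != 0 :> R by rewrite gt_eqF// gs_gt0.
apply: (meas_RInt3_kernel (C := 1) (@meas2_gs n.+1%:R) _ (L1_gs 0 ltr01)) => // x y.
by have /andP[? ?] := gs_le1 n.+1%:R x y; rewrite ger0_norm.
Qed.

Let p30 : 0 <= p3. Proof. by apply: exprn_ge0; exact: sqrtr_ge0. Qed.

Let conv_bound (g : V3 -> R) n k : L1 g -> (forall k, `|g k| <= Cb) ->
  `|conv g n k| <= 8 * p3 * (p3 * Cb).
Proof.
move=> lg gC; have c8 : 0 <= 8 * p3 by exact: mulr_ge0.
have s0 : 0 < n.+1%:R :> R by [].
have s3 : 0 < n.+1%:R ^+ 3 :> R by exact: exprn_gt0.
rewrite normrM (ger0_norm c8) ler_wpM2l// normrM (gtr0_norm s3).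
have [lG iG] := gs_integral k s0.
have : `|RInt3 (fun k' => g k' * gs n.+1%:R k k')| <= Cb * (p3 / n.+1%:R ^+ 3).
  rewrite -expr_div_n -iG -RInt3Z//.
  apply: RInt3_norm_le => [||k']; [exact: L1_mul_gs|exact: L1Z|].
  by rewrite normrM (ger0_norm (gs_ge0 _ _ _)) ler_wpM2r ?gs_ge0.
by rewrite mulrA ler_pdivlMr// mulrC [p3 * Cb]mulrC.
Qed.

Let conv_cvg (g : V3 -> R) k : L1 g -> {for k, continuous g} ->
  conv g n k @[n --> \oo] --> 8 * p3 * (p3 * g k).
Proof.
move=> lg cg; apply: cvgM; first exact: cvg_cst.
apply: (approximate_identity ltr01 (L1_meas lg) (L1_mul_gs 1 k lg)) => e e0.
have /cvgrPdist_le/(_ e e0)/nbhs3P[d d0 H] := cg.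
by exists d => // y /H; rewrite distrC.
Qed.

(** The limit of [windowed_norm]: on the left the window tends to [1], dominated through [LB]; on
    the right the Gaussian convolutions tend to a multiple of the amplitudes. The constant is
    [8 * p3 * p3 = (2 * pi) ^+ 3]. *)
Lemma plancherel :
  RInt3 (fun x => Br x ^+ 2 + Bi x ^+ 2) =
  8 * pi ^+ 3 * RInt3 (fun k => gr k ^+ 2 + gi k ^+ 2).
Proof.
have s0 n : 0 < n.+1%:R :> R by [].
pose S n := RInt3 (fun x => gs (2 * n.+1%:R)^-1 0 x * (Br x ^+ 2 + Bi x ^+ 2)).
have SE n : S n = RInt3 (fun k => gr k * conv gr n k + gi k * conv gi n k).
  rewrite /S (windowed_norm (s0 n)); apply: (f_equal (@RInt3 R)); apply/funext => k.
  by rewrite (innerE (s0 n) k Lr) (innerE (s0 n) k Li).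
have S1 : S n @[n --> \oo] --> RInt3 (fun x => Br x ^+ 2 + Bi x ^+ 2).
  apply: (RInt3_cvg _ LB) => [n|x|n x].
  - by apply: measM; [exact: meas_gs|exact: L1_meas].
  - rewrite -[X in _ --> X]mul1r.
    apply: cvgM; last exact: cvg_cst.
    apply/cvgrPdist_le => e e0; near=> n.
    have q0 := sqd_ge0 0 x; set s := n.+1%:R : R; have s1 : 1 <= s by rewrite ler1n.
    have /andP[h0 h1] := gs_le1 (2 * s)^-1 0 x.
    rewrite ger0_norm ?subr_ge0//.
    have h2 := expR_ge1Dx (- ((2 * s)^-1 ^+ 2 * sqd 0 x)).
    apply: (@le_trans _ _ ((2 * s)^-1 ^+ 2 * sqd 0 x)).
      by rewrite lerBlDr -lerBlDl.
    have ks : sqd 0 x / e <= s.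
      rewrite (@le_trans _ _ n%:R)// ?ler_nat//; near: n; exact: nbhs_infty_ger.
    rewrite ler_pdivrMr// in ks.
    rewrite exprVn mulrC ler_pdivrMr ?exprn_gt0 ?mulr_gt0// (le_trans ks)//.
    by rewrite mulrC ler_wpM2l ?(ltW e0)// expr2; nra.
  - have /andP[h0 h1] := gs_le1 (2 * n.+1%:R)^-1 0 x.
    have b0 : 0 <= Br x ^+ 2 + Bi x ^+ 2 by rewrite addr_ge0 ?sqr_ge0.
    by rewrite ger0_norm ?mulr_ge0// ler_piMl.
have S2 : S n @[n --> \oo] --> 
    RInt3 (fun k => gr k * (8 * p3 * (p3 * gr k)) + gi k * (8 * p3 * (p3 * gi k))).
  rewrite (_ : S = fun n => RInt3 (fun k => gr k * conv gr n k + gi k * conv gi n k)); last first.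
    by apply/funext => n; exact: SE.
  pose D := 8 * p3 * (p3 * Cb).
  have LD : L1 (fun k => D * (`|gr k| + `|gi k|)).
    by apply: L1Z; apply: L1D; exact: L1_norm.
  apply: (RInt3_cvg _ LD) => [n|k|n k].
  - by apply: measD; apply: measM; try exact: L1_meas; exact: meas_conv.
  - have [->|k0] := eqVneq k 0.
      rewrite gr0 gi0 !mul0r addr0.
      by under eq_fun do rewrite !mul0r addr0; exact: cvg_cst.
    apply: cvgD.
      by apply: cvgM; [exact: cvg_cst|exact: conv_cvg Lr (cr k0)].
    by apply: cvgM; [exact: cvg_cst|exact: conv_cvg Li (ci k0)].
  - rewrite (le_trans (ler_normD _ _))// mulrDr; apply: lerD.
      by rewrite normrM mulrC ler_wpM2r// conv_bound.
    by rewrite normrM mulrC ler_wpM2r// conv_bound.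
move: S2 => /(cvg_unique _ S1) ->//.
have L2 (g : V3 -> R) : L1 g -> (forall k, `|g k| <= Cb) -> L1 (fun k => g k ^+ 2).
  move=> lg gC; have := L1_mul_bounded lg (L1_meas lg) gC.
  by congr L1; apply/funext => k; rewrite expr2.
rewrite -RInt3Z; last by apply: L1D; exact: L2.
apply: (f_equal (@RInt3 R)); apply/funext => k.
have <- : p3 * p3 = pi ^+ 3 :> R.
  by rewrite /p3 -exprMn -expr2 sqr_sqrtr// pi_ge0.
by ring.
Unshelve. all: by end_near. Qed.

End Plancherel.

(** * Fourier integrals with rapidly decaying amplitudes *)

Section RapidDecay.
Variable R : realType.
Local Notation V3 := (pt3 R).
Implicit Types (g w : V3 -> R) (k x : V3).

Lemma I1_oneDsqrV : I1 (fun t : R => (oneDsqr t)^-1).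
Proof.
have m : measurable_fun setT (fun t : R => (oneDsqr t)^-1).
  by apply: continuous_measurable_fun; exact: continuous_oneDsqrV.
have p0 (t : R) : 0 <= (oneDsqr t)^-1 by rewrite invr_ge0 (le_trans ler01)// oneDsqr_ge1.
apply/integrableP; split; first exact/measurable_EFinP.
under eq_integral => t _ do rewrite abse_EFin ger0_norm//.
rewrite ge0_symfun_integralT//.
- by rewrite -set_itvcy integral0y_oneDsqr ltry.
- exact: continuous_oneDsqrV.
- by move=> t; rewrite /oneDsqr /= sqrrN.
Qed.

Lemma sqr_enorm k : enorm k ^+ 2 = dot3 k k.
Proof. by rewrite sqr_sqrtr// dot3_ge0. Qed.

Lemma enorm_ge0 k : 0 <= enorm k.
Proof. exact: sqrtr_ge0. Qed.

Lemma enorm_eq0 k : (enorm k == 0) = (k == 0).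
Proof. by rewrite -dot3_eq0 -sqr_enorm sqrf_eq0. Qed.

Lemma enorm0 : enorm (0 : V3) = 0.
Proof. by apply/eqP; rewrite enorm_eq0. Qed.

Lemma enorm_le k : enorm k <= 1 + dot3 k k.
Proof. by rewrite -sqr_enorm; have := sqr_ge0 (enorm k - 1); nra. Qed.

Lemma coord_le_enorm k i : `|k 0 i| <= enorm k.
Proof.
rewrite -(ler_pXn2r (n := 2))// ?nnegrE ?enorm_ge0// real_normK ?num_real// sqr_enorm.
by rewrite /dot3 (bigD1 i)//= -expr2 lerDl; apply: sumr_ge0 => j _; rewrite -expr2 sqr_ge0.
Qed.

Lemma continuous_coord3 i : continuous (fun k : V3 => k 0 i).
Proof. by move=> k; exact/differentiable_continuous/differentiable_coord. Qed.

Lemma continuous_enorm : continuous (@enorm R).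
Proof.
have c : continuous (fun k : V3 => dot3 k k).
  rewrite (_ : (fun _ => _) = fun k : V3 => k 0 0 * k 0 0 + k 0 1 * k 0 1 +
      k 0 (1 + 1) * k 0 (1 + 1)); last by apply/funext => k; rewrite /dot3 sum3E.
  by do 2 (try apply: continuous_add3); apply: continuous_mul3; exact: continuous_coord3.
by move=> k; apply: (@continuous_comp _ _ _ (fun k : V3 => dot3 k k) Num.sqrt);
  [exact: c|exact: sqrt_continuous].
Qed.

(* Continuity is only required off the origin, so that [k / |k|] is tame. *)
Definition tame w := [/\ meas w, forall k, k != 0 -> {for k, continuous w} &
  exists n c, forall k, `|w k| <= c * (1 + dot3 k k) ^+ n].

(** Schwartz decay without smoothness: the class is stable under multiplication by [tame] functions,
    hence by [k / |k|], and its members are bounded and integrable. *)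
Definition rapid g := [/\ meas g, forall k, k != 0 -> {for k, continuous g} &
  forall n, exists c, forall k, `|g k| * (1 + dot3 k k) ^+ n <= c].

Lemma oneD_ge1 k : 1 <= 1 + dot3 k k.
Proof. by rewrite lerDl dot3_ge0. Qed.

Lemma oneDX_ge1 k n : 1 <= (1 + dot3 k k) ^+ n.
Proof. exact/exprn_ege1/oneD_ge1. Qed.

Lemma bound_ge0 w c n : (forall k, `|w k| <= c * (1 + dot3 k k) ^+ n) -> 0 <= c.
Proof.
move=> /(_ 0) h; have := le_trans (normr_ge0 _) h.
by rewrite pmulr_lge0// (lt_le_trans ltr01)// oneDX_ge1.
Qed.

Lemma tameD w1 w2 : tame w1 -> tame w2 -> tame (fun k => w1 k + w2 k).
Proof.
move=> [m1 c1 [n1 [C1 b1]]] [m2 c2 [n2 [C2 b2]]]; split; first exact: measD.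
  by move=> k k0; exact: (@cvgD _ _ _ _ _ w1 w2 _ _ (c1 k k0) (c2 k k0)).
exists (n1 + n2)%N, (C1 + C2) => k.
rewrite (le_trans (ler_normD _ _))// mulrDl lerD//.
  by rewrite (le_trans (b1 k))// ler_wpM2l ?(bound_ge0 b1)// ler_weXn2l ?oneD_ge1 ?leq_addr.
by rewrite (le_trans (b2 k))// ler_wpM2l ?(bound_ge0 b2)// ler_weXn2l ?oneD_ge1 ?leq_addl.
Qed.

Lemma tameM w1 w2 : tame w1 -> tame w2 -> tame (fun k => w1 k * w2 k).
Proof.
move=> [m1 c1 [n1 [C1 b1]]] [m2 c2 [n2 [C2 b2]]]; split; first exact: measM.
  by move=> k k0; exact: (@cvgM _ _ _ _ w1 w2 _ _ (c1 k k0) (c2 k k0)).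
exists (n1 + n2)%N, (C1 * C2) => k.
by rewrite normrM exprD mulrACA ler_pM.
Qed.

Lemma tame_bounded w c : meas w -> (forall k, k != 0 -> {for k, continuous w}) ->
  (forall k, `|w k| <= c) -> tame w.
Proof. by move=> mw cw wc; split => //; exists 0%N, c => k; rewrite expr0 mulr1. Qed.

Lemma tame_cst c : tame (fun=> c).
Proof. by apply: (@tame_bounded _ `|c|) => [|k _|//]; [exact: meas_cst|exact: (@cst_continuous _ _ c)]. Qed.

Lemma tameN w : tame w -> tame (fun k => - w k).
Proof.
move=> tw; rewrite (_ : (fun _ => _) = fun k => -1 * w k); last first.
  by apply/funext => k; rewrite mulN1r.
exact: tameM (tame_cst _) tw.
Qed.

Lemma tameB w1 w2 : tame w1 -> tame w2 -> tame (fun k => w1 k - w2 k).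
Proof. by move=> t1 t2; exact: tameD t1 (tameN t2). Qed.

Lemma tame_coord i : tame (fun k => k 0 i).
Proof.
split; [exact: meas_coord|by move=> k _; exact: continuous_coord3|].
exists 1%N, 1 => k; rewrite mul1r expr1.
exact: le_trans (coord_le_enorm k i) (enorm_le k).
Qed.

Lemma continuous_dot k : continuous (fun x => dot3 x k).
Proof.
move=> x; apply: (has_grad_continuous (f := fun x => dot3 x k) (df := fun _ i => k 0 i)).
have := has_grad_dot k; congr has_grad; apply/funext => y; exact: dot3C.
Qed.

Lemma tame_cos x : tame (fun k => cos (dot3 k x)).
Proof.
apply: (@tame_bounded _ 1) => [|k _|k]; [exact: meas_cosdot| |exact: cos_max].
by apply: (@continuous_comp _ _ _ (fun k => dot3 k x) cos); [exact: continuous_dot|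
  exact: continuous_cos].
Qed.

Lemma tame_sin x : tame (fun k => sin (dot3 k x)).
Proof.
apply: (@tame_bounded _ 1) => [|k _|k]; [exact: meas_sindot| |exact: sin_max].
by apply: (@continuous_comp _ _ _ (fun k => dot3 k x) sin); [exact: continuous_dot|
  exact: continuous_sin].
Qed.

Lemma tame_unit i : tame (fun k => k 0 i / enorm k).
Proof.
apply: (@tame_bounded _ 1) => [|k k0|k].
- by apply: measM (@meas_coord _ i) (measV (continuous_meas continuous_enorm)).
- have ci : {for k, continuous (fun k => (enorm k)^-1)}.
    by apply: (@cvgV _ _ _ _ (@enorm R) (enorm k)) (@continuous_enorm k); rewrite enorm_eq0.
  exact: (@cvgM _ _ _ _ (fun k : V3 => k 0 i) (fun k => (enorm k)^-1) _ _
    (@continuous_coord3 i k) ci).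
- have [->|k0] := eqVneq k 0; first by rewrite enorm0 invr0 mulr0 normr0.
  have e0 : 0 < enorm k by rewrite lt_neqAle enorm_ge0 andbT eq_sym enorm_eq0.
  by rewrite normrM normfV (gtr0_norm e0) ler_pdivrMr// mul1r coord_le_enorm.
Qed.

Lemma rapid_tame g : rapid g -> tame g.
Proof.
move=> [mg cg dg]; split => //; have [c gc] := dg 0%N.
by exists 0%N, c => k; have := gc k; rewrite expr0 !mulr1.
Qed.

Lemma rapid_bounded g : rapid g -> exists c, forall k, `|g k| <= c.
Proof. by move=> [_ _ /(_ 0%N)[c gc]]; exists c => k; have := gc k; rewrite expr0 mulr1. Qed.

Lemma rapidD g1 g2 : rapid g1 -> rapid g2 -> rapid (fun k => g1 k + g2 k).
Proof.
move=> r1 r2; have [m c _] := tameD (rapid_tame r1) (rapid_tame r2); split => // n.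
case: r1 r2 => [_ _ /(_ n)[c1 h1]] [_ _ /(_ n)[c2 h2]]; exists (c1 + c2) => k.
apply: le_trans (lerD (h1 k) (h2 k)); rewrite -mulrDl ler_wpM2r ?ler_normD//.
by rewrite (le_trans ler01)// oneDX_ge1.
Qed.

Lemma rapidM g w : rapid g -> tame w -> rapid (fun k => g k * w k).
Proof.
move=> rg tw; have [m c _] := tameM (rapid_tame rg) tw; split => // n.
case: tw => _ _ [l [C hw]]; case: rg => _ _ /(_ (l + n)%N)[c' h]; exists (C * c') => k.
apply: le_trans (ler_wpM2l (bound_ge0 hw) (h k)).
rewrite normrM exprD -mulrA mulrCA !mulrA ler_wpM2r//.
  by rewrite (le_trans ler01)// oneDX_ge1.
by rewrite mulrAC ler_wpM2r.
Qed.

Lemma rapidN g : rapid g -> rapid (fun k => - g k).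
Proof.
move=> rg; rewrite (_ : (fun _ => _) = fun k => g k * -1); last first.
  by apply/funext => k; rewrite mulrN1.
exact: rapidM rg (tame_cst _).
Qed.

Lemma rapidB g1 g2 : rapid g1 -> rapid g2 -> rapid (fun k => g1 k - g2 k).
Proof. by move=> r1 r2; exact: rapidD r1 (rapidN r2). Qed.

(** [1 + dot3 k k] dominates each [1 + k_i ^+ 2], so its cube dominates their product, whose inverse
    is integrable coordinate by coordinate. *)
Lemma rapid_L1 g : rapid g -> L1 g.
Proof.
move=> [mg _ /(_ 3%N)[c gc]].
apply: L1_le mg (L1Z c (L1_tensor I1_oneDsqrV I1_oneDsqrV I1_oneDsqrV)) _ => k.
rewrite -!invfM ler_pdivlMr; last by rewrite !mulr_gt0// oneDsqr_gt0.
apply: le_trans (gc k); rewrite ler_wpM2l// exprS expr2 mulrA.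
rewrite /dot3 sum3E -(expr2 (k 0 0)) -(expr2 (k 0 1)) -(expr2 (k 0 (1 + 1))).
have h i : 0 <= oneDsqr (k 0 i) by rewrite ltW// oneDsqr_gt0.
have l (a b d : R) : 0 <= a -> 0 <= b -> 0 <= d -> [/\ 1 + a <= 1 + (a + b + d),
    1 + b <= 1 + (a + b + d) & 1 + d <= 1 + (a + b + d)].
  by move=> *; split; lra.
have [l0 l1 l2] := l _ _ _ (sqr_ge0 (k 0 0)) (sqr_ge0 (k 0 1)) (sqr_ge0 (k 0 (1 + 1))).
apply: ler_pM l2; [apply: mulr_ge0; exact: h|exact: h|idtac].
by apply: ler_pM l0 l1; exact: h.
Qed.

Lemma rapid_schwartz (u : R -> R) : schwartzR u -> rapid (fun k => u (enorm k)).
Proof.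
move=> [du bu].
have cu : continuous u.
  by move=> t; apply/differentiable_continuous/derivable1_diffP; exact: (du 0%N).
have c : continuous (fun k : V3 => u (enorm k)).
  by move=> k; apply: (@continuous_comp _ _ _ (@enorm R) u);
    [exact: continuous_enorm|exact: cu].
split => [|k _|n]; [exact: continuous_meas|exact: c|].
(* The extra monomial [t ^+ a] makes the induction on [n] close: one more factor [1 + t ^+ 2] is
   paid for by the bounds at [a] and at [a.+2]. *)
have H a : exists C, forall t, `|t ^+ a * u t| * (1 + t ^+ 2) ^+ n <= C.
  elim: n a => [|n IH] a.
    by have [C hC] := bu a 0%N; exists C => t; have := hC t; rewrite expr0 mulr1.
  have [[C1 h1] [C2 h2]] := (IH a, IH a.+2).
  exists (C1 + C2) => t; apply: le_trans (lerD (h1 t) (h2 t)).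
  rewrite le_eqVlt; apply/orP; left; apply/eqP.
  have -> : `|t ^+ a.+2 * u t| = t ^+ 2 * `|t ^+ a * u t|.
    by rewrite -addn2 exprD mulrAC normrM mulrC ger0_norm ?sqr_ge0.
  by rewrite exprS; ring.
by have [C hC] := H 0%N; exists C => k; have := hC (enorm k); rewrite expr0 mul1r sqr_enorm.
Qed.

End RapidDecay.

(** * Continuity and partial derivatives of Fourier integrals *)

Section TrigIntegralCalculus.
Variable R : realType.
Local Notation V3 := (pt3 R).
Implicit Types (al ga : V3 -> R) (k x : V3).

Lemma le_norm_of_derive (f df : R -> R) : (forall t : R, is_derive t 1 f (df t)) ->
  (forall t, `|df t| <= 1) -> forall a b, `|f a - f b| <= `|a - b|.
Proof.
move=> Df df1.
suff H a b : a <= b -> `|f a - f b| <= `|a - b|.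
  move=> a b; case/orP: (le_total a b) => ab; first exact: H.
  by rewrite distrC (distrC a); exact: H.
move=> ab; have cf : {within `[a, b], continuous f}.
  apply: continuous_subspaceT => t.
  by apply/differentiable_continuous/derivable1_diffP; case: (Df t).
have [c _ e] := MVT_segment ab (fun t _ => Df t) cf.
by rewrite distrC e normrM distrC ler_piMl.
Qed.

(** Cosine and sine are 1-Lipschitz and the amplitudes have finite first moments, so the integral is
    Lipschitz with constant [C]. *)
Lemma continuous_FT al ga : rapid al -> rapid ga -> continuous (FT al ga).
Proof.
move=> ra rg.
have La := rapid_L1 ra; have Lg := rapid_L1 rg.
have L i : L1 (fun k => (`|al k| + `|ga k|) * `|k 0 i|).
  have e : (fun k => (`|al k| + `|ga k|) * `|k 0 i|) =
      fun k => `|al k * k 0 i| + `|ga k * k 0 i|.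
    by apply/funext => k; rewrite !normrM mulrDl.
  rewrite e; apply: L1D; apply/L1_norm/rapid_L1.
    exact: rapidM ra (@tame_coord R i).
  exact: rapidM rg (@tame_coord R i).
pose C := \sum_(i < 3) RInt3 (fun k => (`|al k| + `|ga k|) * `|k 0 i|).
have C0 : 0 <= C.
  by apply: sumr_ge0 => i _; apply: RInt3_ge0 => k; rewrite mulr_ge0// addr_ge0.
have lip (x y : V3) (d : R) : 0 <= d -> (forall i, `|y 0 i - x 0 i| <= d) ->
    `|FT al ga x - FT al ga y| <= C * d.
  move=> d0 hd; rewrite /FT -RInt3B; [|exact: L1_trig|exact: L1_trig].
  rewrite /C -(@RInt3_sum _ _ (index_enum 'I_3) xpredT) => [|i _]; last exact: L.
  rewrite mulrC -RInt3Z; last by apply: L1_sum => i _; exact: L.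
  apply: RInt3_norm_le; first by apply: L1B; exact: L1_trig.
    by apply: L1Z; apply: L1_sum => i _; exact: L.
  move=> k; rewrite /trig opprD addrACA -!mulrBr.
  have hk : `|dot3 k x - dot3 k y| <= d * \sum_(i < 3) `|k 0 i|.
    rewrite /dot3 -sumrB mulr_sumr (le_trans (ler_norm_sum _ _ _))// ler_sum// => i _.
    by rewrite -mulrBr normrM mulrC distrC ler_wpM2r.
  have hc : `|cos (dot3 k x) - cos (dot3 k y)| <= d * \sum_(i < 3) `|k 0 i|.
    apply: le_trans hk; apply: (@le_norm_of_derive cos (fun t => - sin t)) => t.
    by rewrite normrN sin_max.
  have hs : `|sin (dot3 k x) - sin (dot3 k y)| <= d * \sum_(i < 3) `|k 0 i|.
    apply: le_trans hk; apply: (@le_norm_of_derive sin cos) => t.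
    exact: cos_max.
  rewrite -mulr_sumr mulrCA mulrDl (le_trans (ler_normD _ _))// !normrM.
  by rewrite lerD// ler_wpM2l.
move=> x; apply/(@cvgrPdist_le _ _ _ (nbhs x) _ (FT al ga)) => e e0.
have d0 : 0 < e / (C + 1) by rewrite divr_gt0// ltr_wpDl.
apply/nbhs_ballP; exists (e / (C + 1)) => // y [_ xy].
apply: (le_trans (lip x y _ (ltW d0) _)) => [i|].
  by have := xy 0 i; rewrite /ball /= distrC => /ltW.
rewrite mulrC mulrAC ler_pdivrMr ?ltr_wpDl// mulrDr mulr1 lerDl ltW//.
Qed.

(** The directional derivative is the derivative at [0] along the line [x + s e_i]; differentiation
    under the integral is dominated by [|ga k_i| + |al k_i|]. *)
Lemma derive_FT al ga i x : rapid al -> rapid ga ->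
  'D_(ev3 R i) (FT al ga) x = FT (fun k => ga k * k 0 i) (fun k => - (al k * k 0 i)) x.
Proof.
move=> ra rg; have ti := @tame_coord R i : tame (fun k : V3 => k 0 i).
have rga := rapidM rg ti; have ral := rapidM ra ti.
pose F (s : R) (k : V3) := trig al ga (x + s *: ev3 R i) k.
have dotE (s : R) k : dot3 k (x + s *: ev3 R i) = dot3 k x + s * k 0 i.
  rewrite /dot3; under eq_bigr => j _ do rewrite !mxE mulrDr.
  rewrite big_split /=; congr (_ + _).
  rewrite (bigD1 i)//= !eqxx mulr1 big1 ?addr0 1?mulrC// => j /negbTE ji.
  by rewrite ji !mulr0.
have H : is_derive (0 : R) 1 (fun s : R => RInt3 (F s))
    (RInt3 (trig (fun k => ga k * k 0 i) (fun k => - (al k * k 0 i)) x)).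
  have := @is_derive_RInt3 _ F (fun s => trig (fun k => ga k * k 0 i)
    (fun k => - (al k * k 0 i)) (x + s *: ev3 R i))
    (fun k => `|ga k * k 0 i| + `|al k * k 0 i|) 0 (-1) 1.
  rewrite scale0r addr0; apply.
  - by rewrite ltrN10.
  - exact: ltr01.
  - by move=> s _; apply: L1_trig; exact: rapid_L1.
  - move=> s k _; rewrite /F /trig dotE.
    under eq_fun do rewrite dotE.
    by apply: is_derive_eq; rewrite /GRing.scale /=; ring.
  - by apply: L1D; apply/L1_norm/rapid_L1.
  - move=> s k _; rewrite /trig mulNr (le_trans (ler_normB _ _))//.
    rewrite [X in X + _ <= _]normrM [X in _ + X <= _]normrM.
    by rewrite lerD// ler_piMr ?cos_max ?sin_max.
rewrite -[RHS](@derive_val _ _ _ _ _ _ _ H) /derive.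
apply: (f_equal (fun f : R -> R => lim (f @ 0^'))); apply/funext => h /=.
by rewrite /F /FT scale0r ?addr0 ?scaler1 [h *: ev3 R i + x]addrC.
Qed.

End TrigIntegralCalculus.

Local Open Scope complex_scope.

(** * Complex amplitudes and their Fourier integrals *)

Section ComplexFourier.
Variable R : realType.
Local Notation V3 := (pt3 R).
Local Notation C := R[i].
Implicit Types (G w : V3 -> C) (k x : V3) (z c : C).

Lemma cReD z c : complex.Re (z + c) = complex.Re z + complex.Re c.
Proof. by case: z c => ? ? []. Qed.
Lemma cImD z c : complex.Im (z + c) = complex.Im z + complex.Im c.
Proof. by case: z c => ? ? []. Qed.
Lemma cReM z c : complex.Re (z * c) =
  complex.Re z * complex.Re c - complex.Im z * complex.Im c.
Proof. by case: z c => ? ? []. Qed.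
Lemma cImM z c : complex.Im (z * c) =
  complex.Re z * complex.Im c + complex.Im z * complex.Re c.
Proof. by case: z c => ? ? []. Qed.
Lemma cReN z : complex.Re (- z) = - complex.Re z.
Proof. by case: z. Qed.
Lemma cImN z : complex.Im (- z) = - complex.Im z.
Proof. by case: z. Qed.
Lemma Re_conj z : complex.Re (z^*)%R = complex.Re z.
Proof. by case: z. Qed.
Lemma Im_conj z : complex.Im (z^*)%R = - complex.Im z.
Proof. by case: z. Qed.
Lemma complex_ext z c : complex.Re z = complex.Re c -> complex.Im z = complex.Im c -> z = c.
Proof. by case: z c => a b [c d] /= -> ->. Qed.

Lemma cexpiD (s t : R) : cexpi (s + t) = cexpi s * cexpi t.
Proof.
by apply: complex_ext; rewrite ?cReM ?cImM /= ?cosD ?sinD// addrC [X in _ + X]mulrC mulrC.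
Qed.

Lemma realC_sum (I : Type) (s : seq I) (P : pred I) (F : I -> R) :
  (\sum_(i <- s | P i) F i)%:C = \sum_(i <- s | P i) (F i)%:C.
Proof. exact: (raddf_sum (real_complex R)). Qed.

Definition CL1 G := L1 (fun k => complex.Re (G k)) /\ L1 (fun k => complex.Im (G k)).
Definition ctame w := tame (fun k => complex.Re (w k)) /\ tame (fun k => complex.Im (w k)).
Definition crapid G := rapid (fun k => complex.Re (G k)) /\ rapid (fun k => complex.Im (G k)).

Lemma crapid_CL1 G : crapid G -> CL1 G.
Proof. by case=> r i; split; exact: rapid_L1. Qed.

Lemma ctame_real (u : V3 -> R) : tame u -> ctame (fun k => (u k)%:C).
Proof. by move=> tu; split => //; exact: tame_cst. Qed.

Lemma ctame_cst c : ctame (fun=> c).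
Proof. by split; exact: tame_cst. Qed.

Lemma ctameD w1 w2 : ctame w1 -> ctame w2 -> ctame (fun k => w1 k + w2 k).
Proof.
move=> [r1 i1] [r2 i2]; split.
  by under eq_fun do rewrite cReD; exact: tameD.
by under eq_fun do rewrite cImD; exact: tameD.
Qed.

Lemma ctameM w1 w2 : ctame w1 -> ctame w2 -> ctame (fun k => w1 k * w2 k).
Proof.
move=> [r1 i1] [r2 i2]; split.
  by under eq_fun do rewrite cReM; apply: tameB; exact: tameM.
by under eq_fun do rewrite cImM; apply: tameD; exact: tameM.
Qed.

Lemma ctameB w1 w2 : ctame w1 -> ctame w2 -> ctame (fun k => w1 k - w2 k).
Proof.
move=> t1 t2; rewrite (_ : (fun _ => _) = fun k => w1 k + -1 * w2 k).
  exact: (ctameD t1 (ctameM (ctame_cst (-1)) t2)).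
by apply/funext => k; rewrite mulN1r.
Qed.

Lemma ctame_conj w : ctame w -> ctame (fun k => ((w k)^*)%R).
Proof.
move=> [r i]; split; first by under eq_fun do rewrite Re_conj.
by under eq_fun do rewrite Im_conj; exact: tameN.
Qed.

Lemma ctame_sum (I : Type) (s : seq I) (F : I -> V3 -> C) :
  (forall i, ctame (F i)) -> ctame (fun k => \sum_(i <- s) F i k).
Proof.
move=> H; elim: s => [|i s IH].
  by rewrite (_ : (fun _ => _) = fun=> 0); [exact: ctame_cst|apply/funext => k; rewrite big_nil].
rewrite (_ : (fun _ => _) = fun k => F i k + \sum_(i <- s) F i k); first exact: ctameD.
by apply/funext => k; rewrite big_cons.
Qed.

Lemma ctame_cross3 (a b : V3 -> 'I_3 -> C) i : (forall j, ctame (fun k => a k j)) ->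
  (forall j, ctame (fun k => b k j)) -> ctame (fun k => cross3 (a k) (b k) i).
Proof. by move=> ta tb; apply: ctameB; exact: ctameM. Qed.

Lemma ctame_cexpi x : ctame (fun k => cexpi (- dot3 k x)).
Proof.
split => /=; [under eq_fun do rewrite cosN; exact: tame_cos|].
by under eq_fun do rewrite sinN; exact: tameN (tame_sin _).
Qed.

Lemma crapid_ctame G : crapid G -> ctame G.
Proof. by case=> r i; split; exact: rapid_tame. Qed.

Lemma crapidM G w : crapid G -> ctame w -> crapid (fun k => G k * w k).
Proof.
move=> [r1 i1] [r2 i2]; split.
  by under eq_fun do rewrite cReM; apply: rapidB; exact: rapidM.
by under eq_fun do rewrite cImM; apply: rapidD; exact: rapidM.
Qed.

Lemma crapidD G1 G2 : crapid G1 -> crapid G2 -> crapid (fun k => G1 k + G2 k).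
Proof.
move=> [r1 i1] [r2 i2]; split.
  by under eq_fun do rewrite cReD; exact: rapidD.
by under eq_fun do rewrite cImD; exact: rapidD.
Qed.

Lemma crapidZ c G : crapid G -> crapid (fun k => c * G k).
Proof.
move=> rG; rewrite (_ : (fun _ => _) = fun k => G k * c).
  exact: (crapidM rG (ctame_cst c)).
by apply/funext => k; rewrite mulrC.
Qed.

Lemma crapidB G1 G2 : crapid G1 -> crapid G2 -> crapid (fun k => G1 k - G2 k).
Proof.
move=> r1 /(crapidZ (-1)) r2; rewrite (_ : (fun _ => _) = fun k => G1 k + -1 * G2 k).
  exact: crapidD r1 r2.
by apply/funext => k; rewrite mulN1r.
Qed.

Lemma CInt3_sum (I : Type) (s : seq I) (F : I -> V3 -> C) : (forall i, CL1 (F i)) ->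
  CInt3 (fun k => \sum_(i <- s) F i k) = \sum_(i <- s) CInt3 (F i).
Proof.
move=> LF.
have reE (J : seq I) (g : I -> C) : complex.Re (\sum_(i <- J) g i) =
    \sum_(i <- J) complex.Re (g i).
  by elim: J => [|j J IH]; rewrite ?big_nil// !big_cons cReD IH.
have imE (J : seq I) (g : I -> C) : complex.Im (\sum_(i <- J) g i) =
    \sum_(i <- J) complex.Im (g i).
  by elim: J => [|j J IH]; rewrite ?big_nil// !big_cons cImD IH.
apply: complex_ext; rewrite ?reE ?imE// /=.
  by rewrite -RInt3_sum => [|i _]; [under eq_fun do rewrite reE|case: (LF i)].
by rewrite -RInt3_sum => [|i _]; [under eq_fun do rewrite imE|case: (LF i)].
Qed.

Lemma CInt3Z c G : CL1 G -> CInt3 (fun k => c * G k) = c * CInt3 G.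
Proof.
move=> [lr li]; apply: complex_ext; rewrite ?cReM ?cImM /= -?RInt3Z//.
  by rewrite -RInt3B; [under eq_fun do rewrite cReM|exact: L1Z|exact: L1Z].
by rewrite -RInt3D; [under eq_fun do rewrite cImM|exact: L1Z|exact: L1Z].
Qed.

Definition CFT G x : C := CInt3 (fun k => G k * cexpi (dot3 k x)).

Lemma Re_CFT G x : complex.Re (CFT G x) =
  FT (fun k => complex.Re (G k)) (fun k => - complex.Im (G k)) x.
Proof.
by apply: (f_equal (@RInt3 R)); apply/funext => k; rewrite cReM /trig mulNr.
Qed.

Lemma Im_CFT G x : complex.Im (CFT G x) =
  FT (fun k => complex.Im (G k)) (fun k => complex.Re (G k)) x.
Proof.
by apply: (f_equal (@RInt3 R)); apply/funext => k; rewrite cImM /trig addrC.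
Qed.

Lemma CL1_cexpi G x : crapid G -> CL1 (fun k => G k * cexpi (dot3 k x)).
Proof.
move=> rG; apply/crapid_CL1/(crapidM rG).
by split; [exact: tame_cos|exact: tame_sin].
Qed.

Lemma CFT_sum (I : Type) (s : seq I) (F : I -> V3 -> C) x : (forall i, crapid (F i)) ->
  CFT (fun k => \sum_(i <- s) F i k) x = \sum_(i <- s) CFT (F i) x.
Proof.
move=> rF; rewrite -CInt3_sum; last by move=> i; exact: CL1_cexpi.
by apply: (f_equal (@CInt3 R)); apply/funext => k; rewrite mulr_suml.
Qed.

Lemma CFTB G1 G2 x : crapid G1 -> crapid G2 ->
  CFT (fun k => G1 k - G2 k) x = CFT G1 x - CFT G2 x.
Proof.
move=> r1 r2; have [lr1 li1] := CL1_cexpi x r1; have [lr2 li2] := CL1_cexpi x r2.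
apply: complex_ext; rewrite ?cReD ?cImD ?cReN ?cImN /= -RInt3B//;
  by apply: (f_equal (@RInt3 R)); apply/funext => k; case: (G1 k) (G2 k) => a b [c d] /=; ring.
Qed.

Lemma CFTZ c G x : crapid G -> CFT (fun k => c * G k) x = c * CFT G x.
Proof.
move=> rG; rewrite -CInt3Z; last exact: CL1_cexpi.
by apply: (f_equal (@CInt3 R)); apply/funext => k; rewrite mulrA.
Qed.

Lemma CFT_shift G x y : CFT G (x - y) = CFT (fun k => G k * cexpi (- dot3 k y)) x.
Proof.
apply: (f_equal (@CInt3 R)); apply/funext => k.
rewrite -mulrA -cexpiD [- dot3 k y + _]addrC; congr (_ * cexpi _).
by rewrite /dot3 -sumrB; apply: eq_bigr => i _; rewrite !mxE mulrBr.
Qed.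

Lemma cpartial_CFT G i x : crapid G ->
  cpartial i (CFT G) x = CFT (fun k => iC R * (k 0 i)%:C * G k) x.
Proof.
move=> [rr ri].
have eR : (fun y => complex.Re (CFT G y)) =
    FT (fun k => complex.Re (G k)) (fun k => - complex.Im (G k)).
  by apply/funext => y; rewrite Re_CFT.
have eI : (fun y => complex.Im (CFT G y)) =
    FT (fun k => complex.Im (G k)) (fun k => complex.Re (G k)).
  by apply/funext => y; rewrite Im_CFT.
rewrite /cpartial eR eI (derive_FT i x rr (rapidN ri)) (derive_FT i x ri rr).
apply: complex_ext; rewrite ?Re_CFT ?Im_CFT.
  by congr FT; apply/funext => k; case: (G k) => a b /=; ring.
by congr FT; apply/funext => k; case: (G k) => a b /=; ring.
Qed.

End ComplexFourier.

(** * Complex forms of the representation and of Plancherel's identity *)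

Section ComplexRepresentation.
Variable R : realType.
Local Notation V3 := (pt3 R).
Local Notation C := R[i].

Lemma I3_add1 : ((1 : 'I_3) + 1 + 1 = 0) * ((1 : 'I_3) + 1 + 1 + 1 = 1).
Proof. by split; apply: val_inj. Qed.

(* The matrix of [d_i b_j - d_j b_i] when [f] is the curl of [b]. *)
Definition antisym (f : 'I_3 -> V3 -> R) (i j : 'I_3) (k : V3) : R :=
  if j == i then 0 else if j == i + 1 then f (i + 1 + 1) k else - f (i + 1) k.

Lemma antisymP (S : (V3 -> R) -> Prop) f : (forall i, S (f i)) ->
  (forall i, S (fun k => - f i k)) -> S (fun=> 0) -> forall i j, S (antisym f i j).
Proof.
move=> Sf SN S0 i j; rewrite /antisym.
by case: (j == i); [exact: S0|case: (j == i + 1); [exact: Sf|exact: SN]].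
Qed.

Lemma sum_antisym f i (k : V3) : \sum_(j < 3) antisym f i j k * k 0 j =
  f (i + 1 + 1) k * k 0 (i + 1) - f (i + 1) k * k 0 (i + 1 + 1).
Proof.
by move: i; apply: I3P; rewrite sum3E /antisym ?add0r ?I3_add1 ?add0r
  !eqxx ?I3_neq; ring.
Qed.

(** [representation_at] wants all nine differences [d_i b_j - d_j b_i]; the three components of the
    curl, with signs, and zeros on the diagonal fill that matrix. *)
Lemma representation_cyclic (b : 'I_3 -> V3 -> R) db (u v p q : 'I_3 -> V3 -> R) :
  (forall i, has_grad (b i) (db i)) -> (forall i, L1 (fun y => b i y ^+ 2)) ->
  (forall y, \sum_(i < 3) db i y i = 0) ->
  (forall i y, db (i + 1 + 1) y (i + 1) - db (i + 1) y (i + 1 + 1) = FT (u i) (v i) y) ->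
  (forall i, rapid (u i)) -> (forall i, rapid (v i)) ->
  (forall i, rapid (p i)) -> (forall i, rapid (q i)) ->
  (forall i, p i 0 = 0) -> (forall i, q i 0 = 0) ->
  (forall i k, p i k * dot3 k k =
     v (i + 1 + 1) k * k 0 (i + 1) - v (i + 1) k * k 0 (i + 1 + 1)) ->
  (forall i k, q i k * dot3 k k =
     - (u (i + 1 + 1) k * k 0 (i + 1) - u (i + 1) k * k 0 (i + 1 + 1))) ->
  forall i x, b i x = FT (p i) (q i) x.
Proof.
move=> hb Lb divb curlb ru rv rp rq p0 q0 pE qE i x.
have FT0 y : FT (fun=> 0) (fun=> 0) y = 0 :> R.
  rewrite /FT -[RHS](@RInt3_cst0 R); apply: (f_equal (@RInt3 R)); apply/funext => k.
  by rewrite /trig !mul0r addr0.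
have FTN (f g : V3 -> R) y : rapid f -> rapid g ->
    FT (fun k => - f k) (fun k => - g k) y = - FT f g y.
  move=> rf rg; rewrite /FT -RInt3N; last by apply: L1_trig; exact: rapid_L1.
  by apply: (f_equal (@RInt3 R)); apply/funext => k; rewrite /trig; ring.
have r0 : rapid (fun _ : V3 => 0 : R).
  split => [|k _|n]; [exact: meas_cst|exact: (@cst_continuous _ _ (0 : R))|].
  by exists 0 => k; rewrite normr0 mul0r.
have ra f : (forall i, rapid (f i)) -> forall i j, rapid (antisym f i j).
  by move=> rf; apply: antisymP => // j; exact: rapidN.
have curlE j l y : db l y j - db j y l = FT (antisym u j l) (antisym v j l) y.
  have C0 := curlb 0 y; have C1 := curlb 1 y; have C2 := curlb (1 + 1) y.
  rewrite ?add0r ?I3_add1 ?add0r in C0 C1 C2.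
  rewrite /antisym; move: j; apply: I3P; move: l; apply: I3P;
    rewrite ?add0r ?I3_add1 ?add0r ?eqxx ?I3_neq
      ?subrr ?FT0 ?FTN// -?C0 -?C1 -?C2 ?opprB//.
have La f i' j : (forall i, rapid (f i)) -> L1 (antisym f i' j).
  by move=> rf; exact/rapid_L1/ra.
apply: (@representation_at _ b db (antisym u) (antisym v)) => //.
- by move=> j l; apply: continuous_FT; exact: ra.
- by move=> j l; exact: La.
- by move=> j l; exact: La.
- by move=> j; exact: rapid_L1.
- by move=> j; exact: rapid_L1.
- by move=> j k; rewrite sum_antisym.
- by move=> j k; rewrite sum_antisym.
Qed.

(** The equations are real linear, so the real and the imaginary part of [b] satisfy them
    separately, with amplitudes [(Re, - Im)] and [(Im, Re)]. *)
Lemma complex_representation (b : V3 -> 'I_3 -> C) (J G : 'I_3 -> V3 -> C) :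
  (forall i x, differentiable (fun y => complex.Re (b y i)) x /\
               differentiable (fun y => complex.Im (b y i)) x) ->
  (forall i, L1 (fun x => sqmod (b x i))) ->
  (forall x, \sum_(i < 3) cpartial i (fun y => b y i) x = 0) ->
  (forall i x, cpartial (i + 1) (fun y => b y (i + 1 + 1)) x
             - cpartial (i + 1 + 1) (fun y => b y (i + 1)) x = CFT (J i) x) ->
  (forall i, crapid (J i)) -> (forall i, crapid (G i)) -> (forall i, G i 0 = 0) ->
  (forall i k, G i k * (dot3 k k)%:C =
     iC R * cross3 (fun j => (k 0 j)%:C) (fun j => J j k) i) ->
  forall i x, b x i = CFT (G i) x.
Proof.
move=> db Lb divb curlb rJ rG G0 GE i x.
have Lp (f : V3 -> R) j : continuous f -> (forall y, f y ^+ 2 <= sqmod (b y j)) ->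
    L1 (fun y => f y ^+ 2).
  move=> cf fb; apply: (@L1_le _ (fun y => f y ^+ 2)) (Lb j) _ => [|y].
    by under eq_fun do rewrite expr2; apply: measM; exact: continuous_meas.
  by rewrite ger0_norm ?sqr_ge0.
have cRe j : continuous (fun y => complex.Re (b y j)).
  by move=> y; apply: differentiable_continuous; case: (db j y).
have cIm j : continuous (fun y => complex.Im (b y j)).
  by move=> y; apply: differentiable_continuous; case: (db j y).
have sumE (F : 'I_3 -> C) : (\sum_(i < 3) F i = 0) ->
    \sum_(i < 3) complex.Re (F i) = 0 /\ \sum_(i < 3) complex.Im (F i) = 0.
  by rewrite !sum3E => h; rewrite -!cReD -!cImD h.
apply: complex_ext; rewrite ?Re_CFT ?Im_CFT.
  apply: (@representation_cyclic (fun i y => complex.Re (b y i))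
    (fun i y j => 'D_(ev3 R j) (fun y => complex.Re (b y i)) y)
    (fun i k => complex.Re (J i k)) (fun i k => - complex.Im (J i k))
    (fun i k => complex.Re (G i k)) (fun i k => - complex.Im (G i k))).
  - by move=> j y; split => //; case: (db j y).
  - by move=> j; apply: (Lp _ j) => // y; rewrite /sqmod lerDl sqr_ge0.
  - by move=> y; have [h _] := sumE _ (divb y).
  - by move=> j y; have := f_equal (@complex.Re R) (curlb j y); rewrite cReD cReN Re_CFT.
  - by move=> j; case: (rJ j).
  - by move=> j; case: (rJ j) => _; exact: rapidN.
  - by move=> j; case: (rG j).
  - by move=> j; case: (rG j) => _; exact: rapidN.
  - by move=> j; rewrite G0.
  - by move=> j; rewrite G0 oppr0.
  - move=> j k; have := f_equal (@complex.Re R) (GE j k).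
    rewrite /cross3 !(cReM, cImM, cReD, cImD, cReN, cImN) /= => h.
    by rewrite mulr0 subr0 in h; rewrite h; ring.
  - move=> j k; have := f_equal (@complex.Im R) (GE j k).
    rewrite /cross3 !(cReM, cImM, cReD, cImD, cReN, cImN) /= => h.
    by rewrite mulr0 add0r in h; rewrite mulNr h; ring.
apply: (@representation_cyclic (fun i y => complex.Im (b y i))
  (fun i y j => 'D_(ev3 R j) (fun y => complex.Im (b y i)) y)
  (fun i k => complex.Im (J i k)) (fun i k => complex.Re (J i k))
  (fun i k => complex.Im (G i k)) (fun i k => complex.Re (G i k))).
- by move=> j y; split => //; case: (db j y).
- by move=> j; apply: (Lp _ j) => // y; rewrite /sqmod lerDr sqr_ge0.
- by move=> y; have [_ h] := sumE _ (divb y).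
- by move=> j y; have := f_equal (@complex.Im R) (curlb j y); rewrite cImD cImN Im_CFT.
- by move=> j; case: (rJ j).
- by move=> j; case: (rJ j).
- by move=> j; case: (rG j).
- by move=> j; case: (rG j).
- by move=> j; rewrite G0.
- by move=> j; rewrite G0.
- move=> j k; have := f_equal (@complex.Im R) (GE j k).
  rewrite /cross3 !(cReM, cImM, cReD, cImD, cReN, cImN) /= => h.
  by rewrite mulr0 add0r in h; rewrite h; ring.
- move=> j k; have := f_equal (@complex.Re R) (GE j k).
  rewrite /cross3 !(cReM, cImM, cReD, cImD, cReN, cImN) /= => h.
  by rewrite mulr0 subr0 in h; rewrite h; ring.
Qed.

Lemma complex_plancherel (G : V3 -> C) : crapid G -> G 0 = 0 ->
  L1 (fun x => sqmod (CFT G x)) ->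
  RInt3 (fun x => sqmod (CFT G x)) = 8 * pi ^+ 3 * RInt3 (fun k => sqmod (G k)).
Proof.
move=> [rr ri] G0 LG.
have e : (fun x => sqmod (CFT G x)) =
  fun x => FT (fun k => complex.Re (G k)) (fun k => - complex.Im (G k)) x ^+ 2 +
           FT (fun k => complex.Im (G k)) (fun k => complex.Re (G k)) x ^+ 2.
  by apply/funext => x; rewrite /sqmod Re_CFT Im_CFT.
have [c1 h1] := rapid_bounded rr; have [c2 h2] := rapid_bounded ri.
rewrite e; apply: (@plancherel _ _ _ (Num.max c1 c2)).
- exact: rapid_L1.
- exact: rapid_L1.
- by move=> k; rewrite le_max h1.
- by move=> k; rewrite le_max h2 orbT.
- by rewrite G0.
- by rewrite G0.
- by case: rr.
- by case: ri.
- by rewrite -e.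
Qed.

End ComplexRepresentation.

(** * The magnetic energy *)

Section SpinSpace.
Variables (R : realType) (P : nat).
Local Notation C := R[i].

Lemma pauli_herm m (a b : 'I_2) : pauli R m a b = ((pauli R m b a)^*)%R.
Proof.
by move: m; apply: I3P; rewrite /pauli /=; case: a => -[|[|a]]//= ha;
  case: b => -[|[|b]]//= hb; apply: complex_ext => /=; rewrite ?oppr0 ?opprK.
Qed.

(** Agreement off the site [lam] is a symmetric relation between configurations, and the Pauli
    matrices are Hermitian. *)
Lemma sigma_on_herm lam m (Y Z : Hsp R P) :
  ipsp (sigma_on lam m Y) Z = ipsp Y (sigma_on lam m Z).
Proof.
rewrite /ipsp /sigma_on.
under eq_bigr => s _ do rewrite mulr_suml.
rewrite (exchange_big_dep xpredT)//=; apply: eq_bigr => t _.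
rewrite rmorph_sum /= mulr_sumr; apply: eq_big => [s|s _].
  by apply: eq_forallb => mu; rewrite [t mu == _]eq_sym.
by rewrite rmorphM /= -pauli_herm mulrCA mulrA.
Qed.

End SpinSpace.

(** * Fourier amplitudes of the current, the field and the photon state *)

Section Energy.
Variables (R : realType) (P : nat) (xs : 'I_P -> pt3 R) (phi : R -> R[i]).
Variables (M : 'I_P -> R) (X : Hsp R P).
Hypothesis sphi : schwartzC phi.
Local Notation V3 := (pt3 R).
Local Notation C := R[i].
Implicit Types (k x : V3) (i j l m : 'I_3) (s : spin P) (lam : 'I_P).

Let f k : C := phi (enorm k).
Let kC k i : C := (k 0 i)%:C.
Let nh k i : C := (k 0 i / enorm k)%:C.
Let c3 : R := ((2 * pi) ^+ 3)^-1.
Let ka : R := (Num.sqrt ((2 * pi) ^+ 3))^-1.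
Let sq k : C := (Num.sqrt (enorm k))%:C.
(** The Fourier transform of the magnetisation of point spins placed at the [xs lam]. The current,
    the field and the photon state are all obtained from it by cross products with [k] or
    [k / |k|]. *)
Let S k s l : C := \sum_(lam < P) (M lam)%:C * cexpi (- dot3 k (xs lam)) * sigma_on lam l X s.
Let V k s j : C := cross3 (nh k) (S k s) j.
Let J s i k : C := c3%:C * (f k * (iC R * cross3 (kC k) (S k s) i)).
(* The amplitude [i k x J / |k|^2] of [B]; it vanishes at the origin since [x / 0 = 0]. *)
Let G s i k : C := f k * (- c3%:C * cross3 (nh k) (V k s) i).
Let F s j k : C := \sum_(lam < P) \sum_(m < 3)
  (M lam)%:C * Bmx phi m (xs lam) k j * sigma_on lam m X s.
(** What remains of [Bmx] without the radial factors [f] and [sq]. It is [tame], while [sq] occurs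
    only in pairs that cancel [1 / |k|]. *)
Let BW lam m j k : C := iC R * ka%:C * cexpi (- dot3 k (xs lam)) *
  cross3 (nh k) (fun l => (ev3 R m 0 l)%:C) j.

Let crapid_f : crapid f.
Proof. by case: sphi => r i; split; [exact: (rapid_schwartz r)|exact: (rapid_schwartz i)]. Qed.

Let tame_nh i : ctame (fun k => nh k i).
Proof. exact/ctame_real/tame_unit. Qed.

Let tame_kC i : ctame (fun k => kC k i).
Proof. exact/ctame_real/tame_coord. Qed.

Let tame_S s l : ctame (fun k => S k s l).
Proof.
apply: ctame_sum => lam; apply: ctameM; last exact: ctame_cst.
by apply: ctameM; [exact: ctame_cst|exact: ctame_cexpi].
Qed.

Let tame_V s j : ctame (fun k => V k s j).
Proof. exact: (ctame_cross3 j tame_nh (tame_S s)). Qed.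

Let crapid_J s i : crapid (J s i).
Proof.
exact: (crapidZ _ (crapidM crapid_f (ctameM (ctame_cst _) (ctame_cross3 i tame_kC (tame_S s))))).
Qed.

Let crapid_G s i : crapid (G s i).
Proof.
exact: (crapidM crapid_f (ctameM (ctame_cst _) (ctame_cross3 i tame_nh (tame_V s)))).
Qed.

Let nh_enorm k i : nh k i * (enorm k)%:C = kC k i.
Proof.
rewrite /nh /kC -rmorphM /=; have [->|k0] := eqVneq k 0.
  by rewrite !mxE !mul0r.
by rewrite divfK// enorm_eq0.
Qed.

Let nh0 i : nh 0 i = 0.
Proof. by rewrite /nh mxE mul0r. Qed.

Let V0 s j : V 0 s j = 0.
Proof. by rewrite /V /cross3 !nh0 !mul0r subrr. Qed.

Let G0 s i : G s i 0 = 0.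
Proof. by rewrite /G /cross3 !nh0 !mul0r subrr !mulr0. Qed.

Let iC2 : iC R * iC R = -1.
Proof. by apply: complex_ext; rewrite /= ?mulr0 ?mul0r ?mulr1 ?add0r ?addr0 ?oppr0. Qed.

(** The minus sign of [G] is [i * i], and [dot3 k k] clears the two denominators [|k|] hidden in the
    nested [nh]. *)
Let GE s i k : G s i k * (dot3 k k)%:C =
  iC R * cross3 (kC k) (fun j => J s j k) i.
Proof.
rewrite -sqr_enorm expr2 rmorphM /=.
have -> : cross3 (kC k) (fun j => J s j k) i =
   iC R * (c3%:C * f k) * cross3 (kC k) (cross3 (kC k) (S k s)) i.
  by rewrite /J /cross3; ring.
rewrite !mulrA iC2 /G /V /cross3 -!nh_enorm; ring.
Qed.

Let gradrhoE x i : gradrho phi x i =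
  CFT (fun k => iC R * kC k i * (c3%:C * f k)) x.
Proof.
have r : crapid (fun k => c3%:C * f k) := crapidZ _ crapid_f.
have e : rho phi = CFT (fun k => c3%:C * f k) by apply/funext => y; rewrite CFTZ.
by rewrite /gradrho e cpartial_CFT.
Qed.

(** The translations by [xs lam] become the phases of [S], and the gradient of [rho] becomes
    multiplication by [i k]. *)
Let jvectE x i s : jvect phi xs M X x i s = CFT (J s i) x.
Proof.
pose W lam i k := f k * (c3%:C * iC R * kC k i * cexpi (- dot3 k (xs lam))).
have rW lam j : crapid (W lam j).
  exact: (crapidM crapid_f (ctameM (ctameM (ctame_cst _) (tame_kC j)) (ctame_cexpi _))).
have gE lam j : gradrho phi (x - xs lam) j = CFT (W lam j) x.
  rewrite gradrhoE CFT_shift; apply: (f_equal (fun u => CFT u x)); apply/funext => k; rewrite /W;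
    move: (f k) (kC k j) (cexpi _) => a b c; ring.
pose Z lam k := (M lam)%:C * (sigma_on lam (i + 1 + 1) X s * W lam (i + 1) k -
  sigma_on lam (i + 1) X s * W lam (i + 1 + 1) k).
have rZ lam : crapid (Z lam) :=
  crapidZ _ (crapidB (crapidZ _ (rW lam _)) (crapidZ _ (rW lam _))).
have ZE lam : CFT (Z lam) x = (M lam)%:C * cross3 (gradrho phi (x - xs lam))
    (fun l => sigma_on lam l X s) i.
  rewrite /Z (CFTZ _ _ (crapidB (crapidZ _ (rW lam _)) (crapidZ _ (rW lam _)))).
  rewrite (CFTB _ (crapidZ _ (rW lam _)) (crapidZ _ (rW lam _))).
  rewrite !(CFTZ _ _ (rW lam _)) /cross3 !gE.
  by rewrite [X in _ * (X - _)]mulrC [X in _ * (_ - X)]mulrC.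
rewrite /jvect -(eq_bigr _ (fun lam _ => ZE lam)) -CFT_sum//.
apply: (f_equal (fun u => CFT u x)); apply/funext => k; rewrite /J /S /cross3 !mulr_sumr -sumrB !mulr_sumr.
apply: eq_bigr => lam _; rewrite /Z /W.
move: (f k) (kC k _) (kC k _) (cexpi _) (sigma_on _ _ _ _) (sigma_on _ _ _ _) => a b c d e g; ring.
Qed.


Let sqmodM (z w : C) : sqmod (z * w) = sqmod z * sqmod w.
Proof. by case: z w => a b [c d]; rewrite /sqmod /=; ring. Qed.

Let sqmod_real (r : R) : sqmod r%:C = r ^+ 2.
Proof. by rewrite /sqmod /= expr0n addr0. Qed.

Let c3_gt0 : 0 < c3.
Proof. by rewrite invr_gt0 exprn_gt0// mulr_gt0// pi_gt0. Qed.

Let ka2 : ka ^+ 2 = c3.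
Proof. by rewrite exprVn sqr_sqrtr// -invr_ge0 ltW. Qed.

(** The spectral density common to both sides: summed over [j] it is [|G|^2] up to the factor [c3],
    and half of it is the integrand of the photon pairing. *)
Let energy s j k : R := sqmod (f k) * (c3 * sqmod (V k s j)).

Let tame_sqmod (w : V3 -> C) : ctame w -> tame (fun k => sqmod (w k)).
Proof. by move=> [r i]; under eq_fun do rewrite /sqmod !expr2; apply: tameD; exact: tameM. Qed.

Let rapid_sqmod (w : V3 -> C) : crapid w -> rapid (fun k => sqmod (w k)).
Proof.
move=> cw; have [r i] := cw; have [tr ti] := crapid_ctame cw.
by under eq_fun do rewrite /sqmod !expr2; apply: rapidD; exact: rapidM.
Qed.

Let rapid_energy s j : rapid (energy s j).
Proof.
exact: (rapidM (rapid_sqmod crapid_f) (tameM (tame_cst _) (tame_sqmod (tame_V s j)))).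
Qed.

(** [V] is a cross product with the unit vector [nh], hence orthogonal to it, and a further cross
    product with [nh] preserves its length. At the origin both sides are [0]. *)
Let sqmod_G s k : \sum_(i < 3) sqmod (G s i k) = c3 * \sum_(j < 3) energy s j k.
Proof.
rewrite /energy /G -!mulr_sumr; under eq_bigr do rewrite !sqmodM.
rewrite -!mulr_sumr (_ : sqmod (- c3%:C) = c3 ^+ 2); last first.
  by rewrite /sqmod /= sqrrN oppr0 expr0n addr0.
rewrite expr2 !mulrA [c3 * sqmod _]mulrC -!mulrA; do 3 congr (_ * _).
have [->|k0] := eqVneq k 0.
  by rewrite !big1// => i _; rewrite ?V0 /cross3 ?nh0 ?mul0r ?subrr /sqmod expr0n addr0.
have nn : (k 0 0 / enorm k) ^+ 2 + (k 0 1 / enorm k) ^+ 2 + (k 0 (1 + 1) / enorm k) ^+ 2 = 1.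
  have e0 : enorm k != 0 by rewrite enorm_eq0.
  rewrite !expr_div_n -!mulrDl sqr_enorm /dot3 sum3E -!expr2 divff//.
  by move: k0; rewrite -dot3_eq0 /dot3 sum3E -!expr2.
(* Multiplying the right side by [|nh|^2 = 1] makes the equality a polynomial identity in the
   components, with the constraint no longer needed. *)
rewrite -[RHS]mul1r -nn !sum3E /V /cross3 ?I3_add1 ?add0r ?I3_add1 ?add0r /nh.
move: (k 0 0 / _) (k 0 1 / _) (k 0 (1 + 1) / _) => a b c.
by case: (S k s 0) (S k s 1) (S k s (1 + 1)) => d0 d1 [e0 e1] [g0 g1];
  rewrite /sqmod /=; ring.
Qed.

Let BmxE lam m j k : Bmx phi m (xs lam) k j = f k * (sq k * BW lam m j k).
Proof.
rewrite /Bmx -/(f k) -/(sq k) /BW -fmorphV.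
have -> : (cross3 (fun l => k 0 l) (fun l => ev3 R m 0 l) j / enorm k)%:C =
    cross3 (nh k) (fun l => (ev3 R m 0 l)%:C) j.
  by rewrite /cross3 /nh -!rmorphM -rmorphB /=; apply: (f_equal (real_complex R)); ring.
rewrite -/ka; move: (f k) (sq k) (cexpi _) (cross3 _ _ _) => a b c d; ring.
Qed.

Let FE s j k : F s j k = f k * (sq k * (iC R * ka%:C * V k s j)).
Proof.
rewrite /F /V /S /cross3 !mulr_sumr -sumrB !mulr_sumr; apply: eq_bigr => lam _.
under eq_bigr => m _ do rewrite BmxE /BW /cross3.
move: j; apply: I3P; rewrite sum3E ?I3_add1 ?add0r ?I3_add1 ?add0r !mxE
  ?eqxx ?I3_neq /= ?mulr0 ?mulr1 ?subr0 ?sub0r;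
  move: (f k) (sq k) (cexpi _) (nh k 0) (nh k 1) (nh k (1 + 1)) (sigma_on _ 0 _ _) (sigma_on _ 1 _ _) (sigma_on _ (1 + 1) _ _) => a b c d0 d1 d2 g0 g1 g2; ring.
Qed.

Let r2 : C := (Num.sqrt 2)%:C.
Let g s j k : C := F s j k / r2 / (enorm k)%:C.
Let h lam m s j k : C := (Bmx phi m (xs lam) k j)^* * g s j k.

Let conjM (z w : C) : ((z * w)^*)%R = (z^* * w^*)%R.
Proof. exact: rmorphM. Qed.

Let conj_sum (I : finType) (u : I -> C) :
  ((\sum_(i : I) u i)^*)%R = \sum_(i : I) ((u i)^*)%R.
Proof. exact: rmorph_sum. Qed.

Let conj_real (r : R) : ((r%:C)^*)%R = r%:C.
Proof. by apply: complex_ext; rewrite ?Re_conj ?Im_conj /= ?oppr0. Qed.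

Let conj_sqmod (z : C) : z^* * z = (sqmod z)%:C.
Proof. by case: z => a b; apply: complex_ext; rewrite ?cReM ?cImM ?Re_conj ?Im_conj /sqmod /=; ring. Qed.

Let r22 : r2 * r2 = 2.
Proof. by rewrite -rmorphM -expr2 sqr_sqrtr// rmorph_nat. Qed.

(** The singularity [1 / |k|] is only apparent: [Bmx] and [F] each contribute a factor [sq], and at
    the origin [V] vanishes. *)
Let crapid_h lam m s j : crapid (h lam m s j).
Proof.
have tBW : ctame (BW lam m j).
  apply: ctameM; first by apply: ctameM; [exact: ctame_cst|exact: ctame_cexpi].
  by apply: ctame_cross3 => // l; exact: ctame_cst.
have -> : h lam m s j = fun k => f k * ((f k)^* * ((BW lam m j k)^* *
    (iC R * ka%:C * V k s j / r2))).
  apply/funext => k; rewrite /h /g BmxE FE (conjM (f k)) (conjM (sq k)) (conj_real (Num.sqrt (enorm k))) -/(sq k).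
  have [->|k0] := eqVneq k 0; first by rewrite V0 !(mulr0, mul0r).
  have e0 : (enorm k)%:C != 0 :> C.
    by apply: contra k0 => /eqP[/eqP]; rewrite enorm_eq0.
  have e : (enorm k)%:C = sq k * sq k by rewrite -rmorphM -expr2 sqr_sqrtr ?enorm_ge0.
  rewrite e in e0 *; have s0 : sq k != 0 by move: e0; rewrite mulf_eq0 orbb.
  have r0 : r2 != 0.
    by apply/eqP => z; move: r22; rewrite z mul0r => /esym/eqP; rewrite pnatr_eq0.
  move: (f k) ((f k)^*)%R ((BW _ _ _ _)^*)%R (iC R * _ * _) (sq k) s0 (r2) r0 => a b c d t t0 r r0; field.
  by rewrite r0 t0.
apply: (crapidM crapid_f (ctameM (ctame_conj (crapid_ctame crapid_f)) (ctameM (ctame_conj tBW) _))).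
exact: (ctameM (ctameM (ctame_cst _) (tame_V s j)) (ctame_cst _)).
Qed.

(** With the spin matrices moved onto [X], the sum over sites and directions rebuilds the conjugate
    of [F]. The product of the two [1 / r2] is the [1/2], and [|F|^2 / |k|] is [energy]. *)
Let sum_h s j k : \sum_(lam < P) \sum_(m < 3)
    (M lam)%:C / r2 * (sigma_on lam m X s)^* * h lam m s j k = (2^-1 * energy s j k)%:C.
Proof.
have cF : ((F s j k)^*)%R = \sum_(lam < P) \sum_(m < 3)
    (M lam)%:C * (Bmx phi m (xs lam) k j)^* * (sigma_on lam m X s)^*.
  rewrite /F conj_sum; apply: eq_bigr => lam _.
  rewrite conj_sum; apply: eq_bigr => m _.
  by rewrite (conjM ((M lam)%:C * _)) (conjM (M lam)%:C) (conj_real (M lam)).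
transitivity ((F s j k)^* * (r2^-1 * g s j k)).
  rewrite cF mulr_suml; apply: eq_bigr => lam _; rewrite mulr_suml; apply: eq_bigr => m _.
  rewrite /h; ring.
transitivity ((2^-1)%:C * ((F s j k)^* * F s j k / (enorm k)%:C)).
  have -> : (2^-1)%:C = r2^-1 * r2^-1 by rewrite -invfM r22 fmorphV rmorph_nat.
  by rewrite /g; ring.
rewrite conj_sqmod -fmorphV -!rmorphM; apply: (f_equal (real_complex R)); congr (_ * _).
rewrite FE !sqmodM !sqmod_real sqr_sqrtr ?enorm_ge0// ka2 /energy.
have [->|k0] := eqVneq k 0.
  by rewrite V0 /sqmod expr0n addr0 !(mulr0, mul0r).
have e0 : enorm k != 0 by rewrite enorm_eq0.
rewrite (_ : sqmod (iC R) = 1); last by rewrite /sqmod /= expr0n expr1n add0r.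
by move: (sqmod _) (sqmod _) => a b; field.
Qed.

(** Hermitian symmetry of [sigma_on] moves it from the integrals onto [X]. The sums then pass under
    the integral, where [sum_h] applies pointwise in [k]. *)
Let ipsp_A_M : ipsp (A_M phi xs M X) X =
  (- (1 / 2) * \sum_(s : spin P) \sum_(j < 3) RInt3 (energy s j))%:C.
Proof.
have Hg : Hphinv (HintE phi xs M X) = fun k j s => g s j k.
  apply/funext => k; apply/funext => j; apply/funext => s; rewrite /Hphinv /HintE /g /F.
  by congr (_ / _); rewrite mulr_suml; apply: eq_bigr => lam _; rewrite mulr_suml.
pose Y lam m : Hsp R P := fun s => \sum_(j < 3) CInt3 (h lam m s j).
have AE s : A_M phi xs M X s = - \sum_(lam < P) \sum_(m < 3)
    (M lam)%:C / r2 * sigma_on lam m (Y lam m) s.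
  by rewrite /A_M Hg.
transitivity (- \sum_(lam < P) \sum_(m < 3) (M lam)%:C / r2 *
    ipsp (Y lam m) (sigma_on lam m X)).
  rewrite {1}/ipsp; under eq_bigr => s _ do rewrite AE mulNr mulr_suml.
  rewrite sumrN exchange_big /=; congr (- _); apply: eq_bigr => lam _.
  under eq_bigr => s _ do rewrite mulr_suml.
  rewrite exchange_big /=; apply: eq_bigr => m _.
  rewrite -sigma_on_herm /ipsp mulr_sumr; apply: eq_bigr => s _.
  by rewrite mulrA.
rewrite mulNr rmorphN; congr (- _); rewrite /= mulr_sumr realC_sum.
transitivity (\sum_(s : spin P) \sum_(j < 3) \sum_(lam < P) \sum_(m < 3)
   (M lam)%:C / r2 * (sigma_on lam m X s)^* * CInt3 (h lam m s j)).
  under [RHS]eq_bigr => s _ do rewrite exchange_big /=.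
  rewrite [RHS]exchange_big /=; apply: eq_bigr => lam _.
  under [RHS]eq_bigr => s _ do rewrite exchange_big /=.
  rewrite [RHS]exchange_big /=; apply: eq_bigr => m _.
  rewrite /ipsp mulr_sumr; apply: eq_bigr => s _; rewrite /Y mulr_suml mulr_sumr.
  by apply: eq_bigr => j _; ring.
apply: eq_bigr => s _; rewrite mulr_sumr realC_sum; apply: eq_bigr => j _.
transitivity (CInt3 (fun k => (2^-1 * energy s j k)%:C)); last first.
  apply: complex_ext => /=; last exact: RInt3_cst0.
  by rewrite RInt3Z ?div1r//; exact: rapid_L1.
have ch lam m : crapid (fun k => (M lam)%:C / r2 * (sigma_on lam m X s)^* * h lam m s j k).
  exact: crapidZ (crapid_h lam m s j).
under [X in _ = CInt3 X]eq_fun do rewrite -sum_h.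
rewrite CInt3_sum => [|lam]; last first.
  apply: crapid_CL1; elim: (index_enum _) => [|m t IH].
    rewrite (_ : (fun _ => _) = fun k => 0 * f k); first exact: crapidZ.
    by apply/funext => k; rewrite big_nil mul0r.
  rewrite (_ : (fun _ => _) = fun k => (M lam)%:C / r2 * (sigma_on lam m X s)^* * h lam m s j k +
     \sum_(m <- t) (M lam)%:C / r2 * (sigma_on lam m X s)^* * h lam m s j k).
    exact: crapidD.
  by apply/funext => k; rewrite big_cons.
apply: eq_bigr => lam _; rewrite CInt3_sum => [|m]; last exact/crapid_CL1.
by apply: eq_bigr => m _; rewrite CInt3Z//; exact: crapid_CL1.
Qed.

Variable B : V3 -> 'I_3 -> Hsp R P.
Hypothesis HB : is_Bvect phi xs M X B.

Let L1_B i s : L1 (fun x => sqmod (B x i s)).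
Proof.
case: HB => dB LB _ _.
have cR : continuous (fun x => complex.Re (B x i s)).
  by move=> x; apply: differentiable_continuous; case: (dB i s x).
have cI : continuous (fun x => complex.Im (B x i s)).
  by move=> x; apply: differentiable_continuous; case: (dB i s x).
apply: (@L1_le _ _ (fun x => sqnorm3 (B x))) => [||x]; last 1 first.
- have p0 (z : C) : 0 <= sqmod z by rewrite /sqmod addr_ge0 ?sqr_ge0.
  rewrite ger0_norm// /sqnorm3 (bigD1 i)//= (bigD1 s)//= -addrA lerDl addr_ge0 ?sumr_ge0//.
  by move=> j _; exact: sumr_ge0.
- rewrite /sqmod; under eq_fun do rewrite !expr2.
  by apply: measD; apply: measM; exact: continuous_meas.
- exact: LB.
Qed.

Let B_CFT i s x : B x i s = CFT (G s i) x.
Proof.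
case: HB => dB _ divB0 curlBE.
apply: (@complex_representation _ (fun x i => B x i s) (J s) (G s)) => //.
- by move=> y; have := f_equal (@^~ s) (divB0 y).
- by move=> j y; rewrite -jvectE -curlBE.
Qed.

(** Plancherel's constant [8 * pi ^+ 3] cancels the factor [c3] of [sqmod_G] exactly. *)
Let RInt3_sqnorm3 : RInt3 (fun x => sqnorm3 (B x)) =
  \sum_(s : spin P) \sum_(j < 3) RInt3 (energy s j).
Proof.
transitivity (\sum_(i < 3) \sum_(s : spin P) RInt3 (fun x => sqmod (B x i s))).
  have LBi i : L1 (fun x => \sum_(s : spin P) sqmod (B x i s)) by apply: L1_sum.
  rewrite (@RInt3_sum _ _ (index_enum 'I_3) xpredT
    (fun i x => \sum_(s : spin P) sqmod (B x i s)) (fun i _ => LBi i)).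
  by apply: eq_bigr => i _; rewrite RInt3_sum.
rewrite exchange_big /=; apply: eq_bigr => s _.
have LG i : L1 (fun k => sqmod (G s i k)) by exact/rapid_L1/rapid_sqmod.
transitivity (\sum_(i < 3) 8 * pi ^+ 3 * RInt3 (fun k => sqmod (G s i k))).
  apply: eq_bigr => i _.
  have e : (fun x => B x i s) = CFT (G s i) by apply/funext => x; rewrite B_CFT.
  under eq_fun do rewrite B_CFT.
  by apply: complex_plancherel => //; move: (L1_B i s); under eq_fun do rewrite B_CFT.
rewrite -mulr_sumr -RInt3_sum//; under eq_fun do rewrite sqmod_G.
rewrite RInt3Z; last by apply: L1_sum => j _; exact/rapid_L1.
rewrite mulrA (_ : 8 * pi ^+ 3 * c3 = 1) ?mul1r; last first.
  by rewrite /c3 exprMn (_ : 2 ^+ 3 = 8) ?divff// ?mulf_neq0 ?expf_neq0 ?lt0r_neq0 ?pi_gt0//; ring.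
by rewrite RInt3_sum// => j _; exact/rapid_L1.
Qed.

Lemma ipsp_A_M_sqnorm3 :
  ipsp (A_M phi xs M X) X = (- (1 / 2) * RInt3 (fun x => sqnorm3 (B x)))%:C.
Proof. by rewrite ipsp_A_M RInt3_sqnorm3. Qed.

End Energy.

Theorem theorem2p2 (R : realType) (P : nat) (xs : 'I_P -> pt3 R)
  (phi : R -> R[i]) (M : 'I_P -> R) (X : Hsp R P)
  (B : pt3 R -> 'I_3 -> Hsp R P) :
  (0 < P)%N ->
  schwartzC phi ->
  is_Bvect phi xs M X B ->
  ipsp (A_M phi xs M X) X = ((- (1 / 2)) * RInt3 (fun x => sqnorm3 (B x)))%:C.
Proof. by move=> _ sphi; exact: ipsp_A_M_sqnorm3. Qed.
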